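(* Let $S$ be a surface. Every graph $G$ with an edge-maximal embedding on $S$ satisfies $\kappa_\rho(G) \geq k$ if and only if $\kappa_s(S) \geq k$.
   Context: Graphs are simple. $\Lambda(T)$ is the set of leaves of a tree $T$, and $\tau_G$ is the set of spanning trees of $G$. The robust connectivity of $G$ is $\kappa_\rho(G) = \min_{\emptyset \neq R \subseteq V(G)} \max_{T \in \tau_G} \frac{|R \cap \Lambda(T)|}{|R|}$. For a surface $S$, $\mathcal G_S$ denotes the family of simple graphs embedded in $S$; an embedded graph is written $\tilde G$. An embedding $\tilde G \in \mathcal G_S$ of $G$ is edge-maximal if no non-edge $e \notin E(G)$ can be added to the embedding $\tilde G$ without creating a crossing on $S$. For an embedded graph $\tilde G$ in $S$, $S \setminus\!\!\setminus \tilde G$ denotes the surface obtained by cutting $S$ along the edges of $\tilde G$ and puncturing $S$ at each isolated vertex of $\tilde G$ (formally: removing a small open $\varepsilon$-neighborhood of $\tilde G$). $m(\tilde G)$ is the number of vertices in a largest induced embedded subgraph $\tilde G' \subseteq \tilde G$ for which $S \setminus\!\!\setminus \tilde G'$ is a connected surface. The surface connectivity of $S$ is $\kappa_s(S) = \inf\{ m(\tilde G)/|\tilde G| : \tilde G \in \mathcal G_S\}$. *)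

(* Defs.v *)
From HB Require Import structures.
From mathcomp Require Export all_boot all_order all_algebra.
From mathcomp Require Export all_classical all_reals all_analysis.

Set Implicit Arguments.
Unset Strict Implicit.
Unset Printing Implicit Defensive.

Export Order.TTheory GRing.Theory Num.Theory.
Export numFieldNormedType.Exports.

Local Open Scope classical_set_scope.
Local Open Scope ring_scope.

(* A finite simple graph.  Graphs have at least one vertex: neither the robust
   connectivity nor the ratio m / |G| makes sense without this. *)
Record sgraph := SGraph {
  vertex :> finType;
  edge : rel vertex;
  edge_sym : symmetric edge;
  edge_irr : irreflexive edge;
  vertex_gt0 : (0 < #|vertex|)%N
}.

Definition edge_set (G : sgraph) : {set {set G}} :=
  [set e : {set G} | [exists u, exists v, edge u v && (e == [set u; v]%SET)]]%SET.

(* Adjacency in the spanning subgraph (V(G), T) of G. *)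
Definition adj (G : sgraph) (T : {set {set G}}) : rel G :=
  fun u v => ([set u; v]%SET \in T).

(* [ucycle] also accepts the empty cycle and the closed walk u, v, u along one
   edge, so a genuine cycle is one with at least three vertices. *)
Definition acyclic (V : finType) (r : rel V) : Prop :=
  forall c : seq V, (2 < size c)%N -> ~ ucycle r c.

Definition spanning_tree (G : sgraph) (T : {set {set G}}) : Prop :=
  [/\ T \subset edge_set G,
      forall u v, connect (adj T) u v &
      acyclic (adj T)].

(* The bound is "at most 1" so that the only vertex of the one-vertex tree is
   a leaf; in every other tree all degrees are positive and a leaf is a vertex
   of degree exactly 1. *)
Definition leaves (G : sgraph) (T : {set {set G}}) : {set G} :=
  [set v : G | #|[set u : G | adj T u v]%SET| <= 1]%N%SET.

(* All the ratios lie in [0, 1], so the default values of the iterated minimum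
   and maximum do not affect their values (as G has a vertex, the minimum is
   over a nonempty family; the maximum is over an empty one only when G is
   disconnected, in which case it is 0). *)
Definition robust_connectivity (R : realType) (G : sgraph) : R :=
  \big[Num.min/1]_(A : {set G} | A != finset.set0)
    \big[Num.max/0]_(T : {set {set G}} | `[< spanning_tree T >])
      (#|A :&: leaves T|%:R / #|A|%:R).

(* Every point has an open neighbourhood U which f maps homeomorphically, with
   inverse g, onto an open subset of the plane. *)
Definition locally_planar (R : realType) (S : topologicalType) : Prop :=
  forall x : S, exists (U : set S) (f : S -> R * R) (g : R * R -> S),
    [/\ open U /\ U x, open (f @` U),
        {within U, continuous f}, {within f @` U, continuous g} &
        forall y, U y -> g (f y) = y].

(* A surface is a compact connected 2-manifold without boundary; second
   countability follows from compactness. *)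
Definition surface (R : realType) (S : topologicalType) : Prop :=
  [/\ [set: S] !=set0, hausdorff_space S, compact [set: S],
      connected [set: S] & locally_planar R S].

(* C is a simple arc with ends x and y. *)
Definition simple_arc (R : realType) (S : topologicalType) (x y : S)
    (C : set S) : Prop :=
  exists f : R -> S,
    [/\ {within `[0, 1], continuous f}, set_inj `[0, 1] f,
        f 0 = x, f 1 = y & f @` `[0, 1] = C].

(* An embedding of G in S.  It need not be cellular, and G need not be
   connected. The value of [curve] at a nonadjacent pair is irrelevant. *)
Record embedding (R : realType) (S : topologicalType) (G : sgraph) :=
  Embedding {
  point : G -> S;
  curve : G -> G -> set S;
  point_inj : injective point;
  curve_sym : forall u v, edge u v -> curve u v = curve v u;
  curve_arc : forall u v, edge u v ->
    simple_arc R (point u) (point v) (curve u v);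
  curve_point : forall u v w, edge u v -> curve u v (point w) ->
    w = u \/ w = v;
  (* two distinct edges meet at most in vertices *)
  curve_curve : forall u v u' v', edge u v -> edge u' v' ->
    [set u; v]%SET != [set u'; v']%SET ->
    curve u v `&` curve u' v' `<=` range point
}.

Section Embedded.
Variables (R : realType) (S : topologicalType) (G : sgraph).
Variable Gt : embedding R S G.

(* The point set in S of the embedded subgraph induced by A. *)
Definition support (A : {set G}) : set S :=
  [set x | (exists2 u, u \in A & x = point Gt u) \/
           (exists u v, [/\ u \in A, v \in A, edge u v & curve Gt u v x])].

Definition edge_maximal : Prop :=
  forall u v : G, u != v -> ~~ edge u v ->
  ~ exists C : set S,
      simple_arc R (point Gt u) (point Gt v) C /\
      C `&` support [set: G]%SET `<=` [set point Gt u; point Gt v].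

(* The surface obtained by cutting S along the embedded subgraph induced by A
   (and puncturing it at the isolated vertices) has the complement of that
   subgraph as its interior, so it is connected iff the complement is. *)
Definition nonseparating (A : {set G}) : Prop := connected (~` support A).

Definition max_nonseparating : nat :=
  (\max_(A : {set G} | `[< nonseparating A >]) #|A|)%N.

End Embedded.

Definition surface_connectivity (R : realType) (S : topologicalType) : R :=
  inf [set q : R | exists (G : sgraph) (Gt : embedding R S G),
                     q = (max_nonseparating Gt)%:R / #|G|%:R].

(* Main.v *)
(* Let A be a set of vertices of an edge-maximal embedding whose complement W =
   S \ supp A is connected. Two vertices on the boundary of one face can be
   joined by an arc through that face, hence are adjacent. An arc in W from one
   vertex outside A to another passes through faces and edges not within A, so
   G - A is connected; likewise every vertex of A has a neighbour outside A.
   Therefore some spanning tree has all of A among its leaves. If A is the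
   whole vertex set, G is complete and all vertices but one can be leaves,
   which suffices because a triangle in a disc shows that the surface
   connectivity is at most 2/3.

   Conversely, given any embedding of G, choose for every separating induced
   subgraph supp A one point on each of two sides, add these points as
   vertices, and add edges until the embedding is edge-maximal. If A consists
   of the vertices of G that are leaves of a spanning tree T of the result, the
   path of T between the two points chosen for A would avoid supp A, so A is
   nonseparating.

   The curves are arbitrary topological arcs, so the only delicate point is
   that a face adherent to an edge can be reached from both ends of that edge.
   Locally this rests on the fact that an arc does not separate the plane
   (Janiszewski's theorem), and an arc in the face is then obtained by walking
   along the edge through shrinking neighbourhoods. *)
Require Import Defs.
From mathcomp Require Import lra ring zify.
Set Implicit Arguments.
Unset Strict Implicit.
Unset Printing Implicit Defensive.
Local Open Scope classical_set_scope.
Local Open Scope ring_scope.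

(** For wild curves a face adherent to an edge may fail to be accessible at a prescribed point of
    it; only some accessible point nearby is certain. What the walk along an edge propagates is
    therefore adherence, not access. The parameters at which an open set F adheres to the arc form a
    closed set, and the crux is that this set is open. Next to a parameter where openness failed
    there would be a piece of the arc to which F does not adhere. The rest of the arc near that
    parameter does not separate the plane, so a point of F could be joined through this gap to every
    nearby point off the drawing; F would hold both sides of the arc and adhere further after all. F
    is a component within a small neighbourhood rather than a whole face: successive steps can then
    be joined by short arcs, and these shrink to the vertex, as the limit requires. Janiszewski's
    theorem is obtained without homology, from Z/2-valued functions that are locally constant off
    two closed sets. *)

(** * Locally constant predicates and pasted paths *)

(** The part of [A] where [D] holds and the part where it fails are both relatively open. Nearly
    every connectedness argument below is an instance, with [D] membership in a suitable set. *)
Lemma connected_locconst (T : topologicalType) (A D : set T) (p q : T) :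
  connected A -> (forall x, A x -> \forall y \near x, A y -> (D y <-> D x)) ->
  A p -> A q -> D p -> D q.
Proof.
move=> cA loc Ap Aq Dp.
have key (E : set T) : (forall x, A x -> E x -> \forall y \near x, A y -> E y) ->
    A `&` E = A `&` [set x | \forall y \near x, A y -> E y].
  move=> locE; apply/seteqP; split=> x [Ax].
    by move=> Ex; split=> //; exact: locE.
  by move=> nE; split=> //; exact: (nbhs_singleton nE).
have opn (E : set T) : open [set x | \forall y \near x, A y -> E y].
  rewrite openE => x /= nE; rewrite /interior /=.
  by have := nbhs_interior nE.
have : A `&` D = A.
  apply: cA; first by exists p.
    exists [set x | \forall y \near x, A y -> D y] => //.
    by apply: key => x Ax Dx; near=> y => Ay; apply/(near (loc x Ax) y).
  exists (~` [set x | \forall y \near x, A y -> ~ D y]); first exact: open_closedC.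
  have -> : A `&` D = A `\` (A `&` ~` D).
    apply/seteqP; split=> x.
      by move=> [Ax Dx]; split=> // -[].
    by move=> [Ax nD]; split=> //; apply: contrapT => Dx; apply: nD.
  rewrite key; last first.
    by move=> x Ax Dx; near=> y => Ay Dy; apply: Dx; apply/(near (loc x Ax) y).
  apply/seteqP; split=> x.
    by move=> [Ax nD]; split=> // nn; apply: nD.
  by move=> [Ax nD]; split=> // -[].
by move=> E; have : A q by []; rewrite -{1}E => -[].
Unshelve. all: by end_near. Qed.

Lemma continuous_paste (R : realType) (S : topologicalType) (f g : R -> S) (c : R) : continuous f -> continuous g -> f c = g c ->
  continuous (fun t => if t <= c then f t else g t).
Proof.
move=> cf cg fg t V nV.
suff : \forall u \near t, V (if u <= c then f u else g u) by [].
move: nV; have [tc|tc|->] := ltgtP t c => nV.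
- have cft := cf t V nV; near=> u.
  rewrite ifT; first by near: u.
  by apply: ltW; near: u; apply: open_nbhs_nbhs; split=> //; exact: open_lt.
- have cft := cg t V nV; near=> u.
  rewrite ifF; first by near: u.
  by apply/negbTE; rewrite -ltNge; near: u; apply: open_nbhs_nbhs; split=> //; exact: open_gt.
- have cft := cf c V nV; have cgt : nbhs c (g @^-1` V) by apply: cg; rewrite -fg.
  by near=> u; case: ifP => _; near: u.
Unshelve. all: by end_near. Qed.

Section Clamp.
Variable R : realType.

(** A retraction onto the unit interval: composing with it turns a path continuous within the
    interval into one continuous on the whole line, so that the subspace topology can be left
    behind. *)
Definition clamp (t : R) : R := if t <= 0 then 0 else if t <= 1 then t else 1.

Lemma clamp_id t : 0 <= t <= 1 -> clamp t = t.
Proof.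
rewrite /clamp => /andP[t0 ->]; case: ifP => // t0'.
by apply/eqP; rewrite eq_sym eq_le t0' t0.
Qed.

Lemma clamp01 t : 0 <= clamp t <= 1.
Proof. by rewrite /clamp; case: (leP t 0) => /= ?; [lra|case: (leP t 1) => /= ?; lra]. Qed.

Lemma clamp_continuous : continuous clamp.
Proof.
apply: continuous_paste; first by move=> ?; exact: cvg_cst.
  by apply: continuous_paste => // ?; [exact: cvg_id|exact: cvg_cst].
by rewrite ler01.
Qed.

End Clamp.
Arguments clamp {R}.

(** * Simple arcs *)

Section Arcs.
Variables (R : realType) (S : topologicalType).
Implicit Types (f g : R -> S) (x y z : S) (C D Z M : set S) (a b c s t : R).

Definition injon f a b :=
  forall s t, a <= s <= b -> a <= t <= b -> f s = f t -> s = t.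

Lemma affine_continuous (a b : R) : continuous (fun t : R => a + t * b).
Proof.
move=> t; apply: cvgD; first exact: cvg_cst.
by apply: cvgMl; exact: cvg_id.
Qed.

Lemma injon_set_inj f a b : injon f a b -> set_inj `[a, b] f.
Proof.
move=> inf s t /set_mem; rewrite /= in_itv /= => sab /set_mem.
by rewrite /= in_itv /= => tab; exact: inf.
Qed.

Lemma arc_image f a b : a < b -> continuous f -> injon f a b ->
  simple_arc R (f a) (f b) (f @` `[a, b]).
Proof.
move=> ab cf inf; exists (fun t => f (a + t * (b - a))); split.
- apply: continuous_subspaceT => t; apply: continuous_comp; last exact: cf.
  exact: affine_continuous.
- apply: injon_set_inj => s t s01 t01.
  move=> /inf E; have {}E : a + s * (b - a) = a + t * (b - a) by (apply: E; nra).
  by move/addrI/mulIf : E; apply; rewrite subr_eq0 gt_eqF.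
- by rewrite mul0r addr0.
- by rewrite mul1r addrC subrK.
- apply/seteqP; split=> z [t] /=; rewrite in_itv /= => t01 <-.
    by exists (a + t * (b - a)) => //=; rewrite in_itv /=; nra.
  have ba : b - a != 0 by rewrite subr_eq0 gt_eqF.
  exists ((t - a) / (b - a)); last by rewrite divfK // addrC subrK.
  by rewrite in_itv /= divr_ge0 ?ler_pdivrMr ?mul1r; lra.
Qed.

Lemma within_nbhs (T U : topologicalType) (A : set T) (f : T -> U) (x : T) (V : set U) :
  {within A, continuous f} -> A x -> nbhs (f x) V -> \forall y \near x, A y -> V (f y).
Proof. by move=> /subspace_continuousP cf Ax nV; exact: (cf x Ax V nV). Qed.

Lemma within_clamp f : {within `[0, 1], continuous f} -> continuous (f \o clamp).
Proof.
move=> cf t V nV; suff : \forall u \near t, V (f (clamp u)) by [].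
have i01 (u : R) : `[0%R, 1%R]%classic (clamp u) by rewrite /= in_itv /= clamp01.
have n : \forall u \near t, `[0%R, 1%R]%classic (clamp u) -> V (f (clamp u)).
  exact: (clamp_continuous (within_nbhs cf (i01 t) nV)).
by near=> u; apply: (near n u).
Unshelve. all: by end_near. Qed.

Lemma simple_arcP x y C : simple_arc R x y C -> exists f,
  [/\ continuous f, injon f 0 1, f 0 = x, f 1 = y & C = f @` `[0, 1]].
Proof.
have i0 : 0 <= (0 : R) <= 1 by rewrite lexx ler01.
have i1 : 0 <= (1 : R) <= 1 by rewrite lexx ler01.
move=> [f [cf inf f0 f1 fC]]; exists (f \o clamp).
split; rewrite /= ?clamp_id //; first exact: within_clamp.
  move=> s t s01 t01 /=; rewrite !clamp_id // => /inf; apply.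
    by apply/mem_set; rewrite /= in_itv.
  by apply/mem_set; rewrite /= in_itv.
rewrite -fC; apply/seteqP; split=> z [t /=]; rewrite in_itv /= => t01 <-.
  by exists t => //=; rewrite ?in_itv //= clamp_id.
by exists t => //=; rewrite ?in_itv //= clamp_id.
Qed.

Lemma simple_arc_left x y C : simple_arc R x y C -> C x.
Proof.
by move=> /simple_arcP[f [_ _ <- _ ->]]; exists 0 => //=; rewrite in_itv /= lexx ler01.
Qed.

Lemma simple_arc_right x y C : simple_arc R x y C -> C y.
Proof.
by move=> /simple_arcP[f [_ _ _ <- ->]]; exists 1 => //=; rewrite in_itv /= lexx ler01.
Qed.

Lemma simple_arc_sym x y C : simple_arc R x y C -> simple_arc R y x C.
Proof.
move=> /simple_arcP[f [cf inf <- <- ->]]; exists (fun t => f (1 - t)); split.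
- apply: continuous_subspaceT => t; apply: continuous_comp; last exact: cf.
  by apply: cvgB; [exact: cvg_cst|exact: cvg_id].
- apply: injon_set_inj => s t s01 t01.
  move=> /inf E; have {}E : 1 - s = 1 - t by apply: E; lra.
  lra.
- by rewrite subr0.
- by rewrite subrr.
- apply/seteqP; split=> z [t /=]; rewrite in_itv /= => t01 <-.
    by exists (1 - t) => //=; rewrite in_itv /=; lra.
  by exists (1 - t); [rewrite /= in_itv /=; lra|rewrite opprB addrC subrK].
Qed.

Lemma simple_arc_compact x y C : simple_arc R x y C -> compact C.
Proof.
move=> /simple_arcP[f [cf _ _ _ ->]]; apply: continuous_compact; last exact: segment_compact.
exact: continuous_subspaceT.
Qed.

Lemma simple_arc_connected x y C : simple_arc R x y C -> connected C.
Proof.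
move=> /simple_arcP[f [cf _ _ _ ->]]; apply: connected_continuous_connected; last exact: continuous_subspaceT.
exact: segment_connected.
Qed.

Lemma simple_arc_cat x y z C D : simple_arc R x y C -> simple_arc R y z D ->
  C `&` D `<=` [set y] -> simple_arc R x z (C `|` D).
Proof.
move=> /simple_arcP[f [cf inf f0 f1 ->]] /simple_arcP[g [cg ing g0 g1 ->]] CD.
pose h t := if t <= 1 then f t else g (t - 1).
have hf t : t <= 1 -> h t = f t by rewrite /h => ->.
have hg t : 1 <= t -> h t = g (t - 1).
  by rewrite le_eqVlt => /orP[/eqP <-|t1]; rewrite /h ?lexx ?subrr ?f1 ?g0 // leNgt t1.
have ch : continuous h.
  apply: continuous_paste => //; last by rewrite subrr f1 g0.
  move=> t; apply: continuous_comp; last exact: cg.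
  by apply: cvgB; [exact: cvg_id|exact: cvg_cst].
(* By [CD] a common value is [y], which [f] takes only at 1 and [g] only at 0. *)
have cross s t : 0 <= s <= 1 -> 1 <= t <= 2 -> f s = g (t - 1) -> s = t.
  move=> s01 t12 E.
  have Ey : f s = y.
    apply: CD; split; first by exists s => //=; rewrite in_itv.
    by exists (t - 1) => //=; rewrite in_itv /=; lra.
  have s1 : s = 1 by apply: inf => //; [lra|rewrite f1].
  have : t - 1 = 0 by apply: ing; [lra|lra|rewrite g0 -E].
  lra.
have inh : injon h 0 2.
  move=> s t s02 t02; have [s1|s1] := leP s 1; have [t1|t1] := leP t 1.
  - by rewrite !hf //; apply: inf; lra.
  - by rewrite hf // hg ?ltW //; apply: cross; lra.
  - by rewrite hg ?ltW // hf // => E; apply/esym/cross => //; lra.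
  - rewrite !hg ?ltW // => /ing E; have {}E : s - 1 = t - 1 by apply: E; lra.
  lra.
have := arc_image _ ch inh; rewrite ltr0n => /(_ isT).
rewrite hf ?ler01 // f0 hg ?ler1n // (_ : 2 - 1 = 1) ?g1; last by lra.
congr simple_arc; apply/seteqP; split=> u.
  move=> [t /=]; rewrite in_itv /= => t02; have [t1|t1] := leP t 1.
    by rewrite hf // => <-; left; exists t => //=; rewrite in_itv /=; lra.
  rewrite hg ?ltW // => <-; right; exists (t - 1) => //=; rewrite in_itv /=; lra.
move=> [|] [t /=]; rewrite in_itv /= => t01 <-.
  by exists t; [rewrite /= in_itv /=; lra|rewrite hf //; lra].
exists (t + 1); first by rewrite /= in_itv /=; lra.
by rewrite hg ?addrK //; lra.
Qed.

(** The hitting times have an infimum, which is itself a hitting time because [Z] is closed. *)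
Lemma first_hit f Z : continuous f -> closed Z -> Z (f 1) ->
  exists s, [/\ 0 <= s <= 1, Z (f s) & forall t, 0 <= t < s -> ~ Z (f t)].
Proof.
move=> cf cZ Z1.
pose H := [set t : R | 0 <= t <= 1 /\ Z (f t)].
have H1 : H 1 by split=> //; rewrite lexx ler01.
have hinf : has_inf H by split; [exists 1|exists 0 => t [/andP[]]].
have lbi t : H t -> inf H <= t by move=> Ht; apply: ge_inf Ht; exact: hinf.2.
have i0 : 0 <= inf H by apply: lb_le_inf; [exists 1|move=> t [/andP[]]].
have i1 : inf H <= 1 by exact: lbi.
exists (inf H); split; first by rewrite i0 i1.
  apply: contrapT => nZ.
  have : nbhs (inf H) (f @^-1` (~` Z)).
    by apply: cf; apply: open_nbhs_nbhs; split=> //; exact: closed_openC.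
  move=> /nbhs_ballP[e /= e0 be].
  have [t Ht te] := inf_adherent e0 hinf.
  apply: (be t); last exact: Ht.2.
  by rewrite /ball /=; have := lbi _ Ht => ?; rewrite ltr_norml; lra.
move=> t /andP[t0 ti] Zt; have : inf H <= t by apply: lbi; split=> //; rewrite t0; lra.
lra.
Qed.

Lemma simple_arc_sub_left f t : continuous f -> injon f 0 1 -> 0 < t <= 1 ->
  simple_arc R (f 0) (f t) (f @` `[0, t]).
Proof.
move=> cf inf /andP[t0 t1]; apply: arc_image => // u v u01 v01; apply: inf; lra.
Qed.

Lemma simple_arc_sub_right f t : continuous f -> injon f 0 1 -> 0 <= t < 1 ->
  simple_arc R (f t) (f 1) (f @` `[t, 1]).
Proof.
move=> cf inf /andP[t0 t1]; apply: arc_image => // u v u01 v01; apply: inf; lra.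
Qed.

(** The arc is cut at its first point of [Z]. With [Z] a drawn graph, the result stays in one face
    up to its end. *)
Lemma simple_arc_trim x y C Z : simple_arc R x y C -> closed Z -> Z y -> ~ Z x ->
  exists z C', [/\ Z z, simple_arc R x z C', C' `<=` C & C' `&` Z `<=` [set z]].
Proof.
move=> /simple_arcP[f [cf inf <- <- ->]] cZ Zy nZx.
have [s [s01 Zs ns]] := first_hit cf cZ Zy.
have s0 : 0 < s.
  by rewrite lt_neqAle; have /andP[-> _] := s01; rewrite andbT; apply: contra_notN nZx => /eqP ->.
exists (f s), (f @` `[0, s]); split=> //; first by apply: simple_arc_sub_left => //; lra.
  by move=> _ [t /= + <-]; rewrite in_itv /= => ts; exists t => //=; rewrite in_itv /=; lra.
move=> _ [[t /= + <-] Zt]; rewrite in_itv /= => /andP[t0].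
by rewrite le_eqVlt => /orP[/eqP ->//|ts]; exfalso; apply: (ns t) => //; rewrite t0.
Qed.

Lemma simple_arc_sub x y C z : simple_arc R x y C -> C z -> z <> y ->
  exists C', [/\ simple_arc R z y C', C' `<=` C & z <> x -> ~ C' x].
Proof.
move=> /simple_arcP[f [cf inf <- <- ->]] [t /=]; rewrite in_itv /= => t01 <- ty.
have t1 : t < 1.
  by rewrite lt_neqAle; have /andP[_ ->] := t01; rewrite andbT; apply: contra_notN ty => /eqP ->.
exists (f @` `[t, 1]); split; first by apply: simple_arc_sub_right => //; lra.
  by move=> _ [u /= + <-]; rewrite in_itv /= => ts; exists u => //=; rewrite in_itv /=; lra.
move=> tx [u /=]; rewrite in_itv /= => u01 /inf u0.
have {}u0 : u = 0 by apply: u0; lra.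
by have t0 : t = 0 by [lra]; apply: tx; rewrite t0.
Qed.

Lemma simple_arc_split x y C : simple_arc R x y C ->
  exists p C1 C2, [/\ simple_arc R p x C1, simple_arc R p y C2,
    C1 `<=` C `\ y & C2 `<=` C `\ x].
Proof.
move=> /simple_arcP[f [cf inf <- <- ->]].
have h0 : (0:R) < 1/2 by lra.
exists (f (1/2)), (f @` `[0, 1/2]), (f @` `[1/2, 1]); split.
- by apply/simple_arc_sym/simple_arc_sub_left => //; lra.
- by apply/simple_arc_sub_right => //; lra.
- move=> _ [t /= + <-]; rewrite in_itv /= => ts; split.
    by exists t => //=; rewrite in_itv /=; lra.
  move=> /inf E; have {}E : t = 1 by apply: E; lra.
  lra.
- move=> _ [t /= + <-]; rewrite in_itv /= => ts; split.
    by exists t => //=; rewrite in_itv /=; lra.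
  move=> /inf E; have {}E : t = 0 by apply: E; lra.
  lra.
Qed.

(* Equality is included for the sake of transitivity; [arcc M x x] holds even
   if [x] is not in [M]. *)
Definition arcc M x y := x = y \/ exists2 C, simple_arc R x y C & C `<=` M.

Lemma arcc_refl M x : arcc M x x. Proof. by left. Qed.

Lemma arcc_sym M x y : arcc M x y -> arcc M y x.
Proof. by move=> [->|[C aC CM]]; [left|right; exists C => //; exact: simple_arc_sym]. Qed.

Lemma arcc_sub M M' x y : M `<=` M' -> arcc M x y -> arcc M' x y.
Proof. by move=> MM' [->|[C aC CM]]; [left|right; exists C => //; exact: subset_trans MM']. Qed.

Hypothesis hS : hausdorff_space S.

Lemma simple_arc_closed x y C : simple_arc R x y C -> closed C.
Proof. by move=> aC; apply: compact_closed => //; exact: simple_arc_compact aC. Qed.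

(** Two arcs laid end to end may cross: the first is cut at its first point on the second, which is
    followed from there on. *)
Lemma arcc_trans M y x z : arcc M x y -> arcc M y z -> arcc M x z.
Proof.
move=> [->//|[C aC CM]] [<-|[D aD DM]]; first by right; exists C.
have [->|xz] := pselect (x = z); first by left.
right; have [Dx|nDx] := pselect (D x).
  have [D' [aD' D'D _]] := simple_arc_sub aD Dx xz.
  by exists D' => //; exact: subset_trans DM.
have [w [C' [Dw aC' C'C C'D]]] := simple_arc_trim aC (simple_arc_closed aD) (simple_arc_left aD) nDx.
have [wz|wz] := pselect (w = z).
  by exists C'; [rewrite -wz|exact: subset_trans CM].
have [D' [aD' D'D _]] := simple_arc_sub aD Dw wz.
exists (C' `|` D').
  apply: simple_arc_cat aC' aD' _ => u [C'u D'u]; apply: C'D; split=> //; exact: D'D.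
by rewrite subUset; split; [exact: subset_trans CM|exact: subset_trans DM].
Qed.

Lemma arcc_connected M x y : M x -> arcc M x y ->
  exists2 C, connected C & [/\ C x, C y & C `<=` M].
Proof.
move=> Mx [<-|[C aC CM]].
  by exists [set x]; [exact: connected1|split=> // _ ->].
exists C; first exact: simple_arc_connected aC.
by split=> //; [exact: simple_arc_left aC|exact: simple_arc_right aC].
Qed.

End Arcs.

(* Concatenation of infinitely many arcs: on [k, k + 1] the path follows [phi
   k]. *)
Section ArcSequence.
Variables (R : realType) (S : topologicalType) (phi : nat -> R -> S).
Hypothesis cphi : forall n, continuous (phi n).
Hypothesis phi01 : forall n, phi n 1 = phi n.+1 0.

Fixpoint chain (n : nat) : R -> S :=
  if n is m.+1 then fun u => if u <= n%:R then chain m u else phi n (u - n%:R)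
  else phi 0%N.

Lemma chainE n k u : (k <= n)%N -> k%:R <= u -> u <= k.+1%:R ->
  chain n u = phi k (u - k%:R).
Proof.
elim: n => [|n IH]; first by rewrite leqn0 => /eqP ->; rewrite subr0.
rewrite leq_eqVlt ltnS => /orP[/eqP -> ku uk|kn ku uk] /=.
  have [un|//] := leP; have -> : u = n.+1%:R by apply/eqP; rewrite eq_le un ku.
  case: n IH {ku uk un} => [|n] IH /=; first by rewrite subrr phi01.
  rewrite ifF; last by apply/negbTE; rewrite -ltNge ltr_nat.
  by rewrite subrr -phi01; congr phi; rewrite -natrB // subSnn.
by rewrite ifT ?IH // (le_trans uk) // ler_nat.
Qed.

Lemma chain_eq n m u : (n <= m)%N -> u <= n.+1%:R -> chain m u = chain n u.
Proof.
move=> nm un; elim: m nm => [|m IH]; first by rewrite leqn0 => /eqP ->.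
rewrite leq_eqVlt ltnS => /orP[/eqP -> //|nm] /=.
by rewrite ifT ?IH // (le_trans un) // ler_nat.
Qed.

Lemma chain_continuous n : continuous (chain n).
Proof.
elim: n => [|n IH] /=; first exact: cphi.
apply: continuous_paste => //.
  move=> t; apply: continuous_comp; last exact: cphi.
  by apply: cvgB; [exact: cvg_id|exact: cvg_cst].
rewrite (@chainE n n n.+1%:R) ?ler_nat // subrr -phi01.
by congr phi; rewrite -natrB // subSnn.
Qed.

(** Each [chain n] is final up to time [n.+1], so the index need only grow with [u]. *)
Definition chain_all (u : R) : S := chain (Num.truncn u) u.

Lemma chain_allE n u : u <= n.+1%:R -> chain_all u = chain n u.
Proof.
move=> un; rewrite /chain_all; have [h|/ltnW h] := leqP n (Num.truncn u).
  exact: chain_eq.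
apply/esym/chain_eq => //; have [u0|u0] := leP 0 u; last first.
  by rewrite (le_trans (ltW u0)).
by have /andP[_ /ltW] := truncn_itv u0.
Qed.

Lemma chain_all_continuous : continuous chain_all.
Proof.
move=> u; pose n := Num.truncn `|u|.
have un : u < n.+1%:R.
  by rewrite (le_lt_trans (ler_norm _)) //; have /andP[] := truncn_itv (normr_ge0 u).
move=> V; rewrite (chain_allE (ltW un)) => nV.
suff : \forall v \near u, V (chain_all v) by [].
have nv : \forall v \near u, v < n.+1%:R.
  by apply: open_nbhs_nbhs; split=> //; exact: open_lt.
have nc := @chain_continuous n u V nV.
near=> v; rewrite (@chain_allE n); first by near: v.
by apply: ltW; near: v.
Unshelve. all: by end_near. Qed.

Lemma chain_all_phi k u : k%:R <= u -> u <= k.+1%:R -> chain_all u = phi k (u - k%:R).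
Proof. by move=> ku uk; rewrite (chain_allE uk) (@chainE _ k). Qed.

End ArcSequence.

(** That the pieces shrink to [b] is continuity at the end of the infinite path; the disjointness
    hypotheses make it injective. *)
Lemma arc_sequence (R : realType) (S : topologicalType) (x : nat -> S)
    (E : nat -> set S) (b : S) :
  (forall n, simple_arc R (x n) (x n.+1) (E n)) ->
  (forall n, E n `&` E n.+1 `<=` [set x n.+1]) ->
  (forall n m, (n.+1 < m)%N -> E n `&` E m = set0) ->
  (forall n, ~ E n b) ->
  (forall V, nbhs b V -> exists N, forall n, (N <= n)%N -> E n `<=` V) ->
  simple_arc R (x 0%N) b (b |` \bigcup_n E n).
Proof.
move=> aE E1 E2 nb Eb.
have /choice[phi phiP] : forall n, exists f : R -> S, [/\ continuous f, injon f 0 1,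
    f 0 = x n, f 1 = x n.+1 & E n = f @` `[0, 1]].
  by move=> n; exact: simple_arcP.
have cphi n : continuous (phi n) by have [] := phiP n.
have phi01 n : phi n 1 = phi n.+1 0 by have [_ _ _ ->] := phiP n; have [_ _ ->] := phiP n.+1.
have iphi n : injon (phi n) 0 1 by have [] := phiP n.
have phiE n t : 0 <= t <= 1 -> E n (phi n t).
  by have [_ _ _ _ ->] := phiP n => t01; exists t => //=; rewrite in_itv.
pose g := chain_all phi.
have gphi k u : k%:R <= u -> u <= k.+1%:R -> g u = phi k (u - k%:R) by exact: chain_all_phi.
have cg : continuous g by exact: chain_all_continuous.
have gk u : 0 <= u -> exists k, [/\ k%:R <= u < k.+1%:R, g u = phi k (u - k%:R) &
    0 <= u - k%:R < 1].
  move=> u0; exists (Num.truncn u); have /andP[h1 h2] := truncn_itv u0; split.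
  - by rewrite h1 h2.
  - by apply: gphi => //; exact: ltW.
  - by move: h2; rewrite -natr1; lra.
have gE u k : k%:R <= u -> u <= k.+1%:R -> E k (g u).
  move=> h1 h2; rewrite (gphi k) //; apply: phiE.
  by move: h2; rewrite -natr1; lra.
have ig' u v : 0 <= u -> 0 <= v -> u <= v -> g u = g v -> u = v.
  move=> u0 v0 uv; have [k [ku guk uk]] := gk u u0; have [l [lv gvl vl]] := gk v v0.
  have kl : (k <= l)%N.
    by rewrite -ltnS -(ltr_nat R); move: ku lv; lra.
  rewrite guk gvl => e.
  move: kl; rewrite leq_eqVlt => /orP[/eqP klE|].
    move: e vl; rewrite -klE => /iphi e vl.
    have : u - k%:R = v - k%:R by apply: e; lra.
    lra.
  (* In consecutive pieces the common value must be [x k.+1], which [phi k] takes only at 1, whereas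
     the local parameter of [u] is below 1. *)
  rewrite leq_eqVlt => /orP[/eqP klE|kl].
    have : phi k (u - k%:R) = x k.+1.
      apply: E1; split; first by apply: phiE; lra.
      by rewrite e -klE; apply: phiE; rewrite klE; lra.
    have [_ _ _ <- _] := phiP k => /iphi h.
    have : u - k%:R = 1 by apply: h; lra.
    lra.
  have : (E k `&` E l) (phi k (u - k%:R)).
    by split; [|rewrite e]; apply: phiE; lra.
  by rewrite E2.
have ig u v : 0 <= u -> 0 <= v -> g u = g v -> u = v.
  move=> u0 v0 e; have [uv|/ltW uv] := leP u v; first exact: ig'.
  by apply/esym; apply: ig'.
(* Maps the half-open unit interval onto the half-line, with inverse [u / (1 + u)]; [F] sends the
   missing end 1 to [b]. *)
pose tau (t : R) := t / (1 - t).
have tau0 t : 0 <= t < 1 -> 0 <= tau t by move=> h; apply: divr_ge0; lra.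
have tauK u : 0 <= u -> tau (u / (1 + u)) = u.
  by move=> u0; rewrite /tau; field; apply/andP; split; lra.
have tau_inj s t : 0 <= s < 1 -> 0 <= t < 1 -> tau s = tau t -> s = t.
  move=> h1 h2 /eqP; rewrite eqr_div; [|lra|lra].
  by move=> /eqP; lra.
pose F t := if t < 1 then g (tau t) else b.
have gnb u : 0 <= u -> g u <> b.
  move=> u0 gb; have [k [ku _ _]] := gk u u0; apply: (nb k); rewrite -gb; apply: gE; lra.
have Fl t : t < 1 -> F t = g (tau t) by rewrite /F => ->.
exists F; split.
- apply/subspace_continuousP => t /=; rewrite in_itv /= => /andP[t0 t1] V.
  move: t1; rewrite le_eqVlt => /orP[/eqP -> |t1].
    rewrite /from_subspace {1}(_ : F 1 = b); last by rewrite /F ltxx.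
    move=> nV; have [N NV] := Eb V nV.
    suff : \forall u \near (1 : R), `[0%R, 1%R]%classic u -> V (F u) by [].
    have nN : \forall u \near (1 : R), N%:R / (1 + N%:R) < u.
      apply: open_nbhs_nbhs; split; first exact: open_gt.
      by rewrite /= ltr_pdivrMr ?mul1r; [rewrite ltrDr ltr01|rewrite -(natrD _ 1 N) ltr0n].
    near=> u; rewrite /= in_itv /= => /andP[u0 u1]; rewrite /F.
    case: ifPn => [u1'|_]; last exact: nbhs_singleton.
    have tu : 0 <= tau u by apply: tau0; lra.
    have [k [ku _ _]] := gk _ tu; apply: (NV k); last by apply: gE; lra.
    have : N%:R / (1 + N%:R) < u by near: u.
    have N0 : 0 <= N%:R :> R by [].
    rewrite ltr_pdivrMr; last lra.
    move=> Nu; have : N%:R <= tau u by rewrite /tau ler_pdivlMr; lra.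
    move=> Nt; have : (N < k.+1)%N by rewrite -(ltr_nat R); lra.
    by rewrite ltnS.
  rewrite /from_subspace (Fl _ t1) => nV.
  suff : \forall u \near t, `[0%R, 1%R]%classic u -> V (F u) by [].
  have nt : \forall u \near t, u < 1.
    by apply: open_nbhs_nbhs; split=> //; exact: open_lt.
  have ct : {for t, continuous (g \o tau)}.
    apply: continuous_comp; last exact: cg.
    apply: cvgM; first exact: cvg_id.
    apply: cvgV; first by rewrite subr_eq0 gt_eqF.
    by apply: cvgB; [exact: cvg_cst|exact: cvg_id].
  have nc : \forall u \near t, V (g (tau u)) by exact: (ct V nV).
  by near=> u => _; rewrite Fl; near: u.
- apply: injon_set_inj => s t s01 t01; rewrite /F.
  case: ifPn => s1; case: ifPn => t1.
  + by move=> /ig e; apply: tau_inj; [lra|lra|apply: e; apply: tau0; lra].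
  + by move=> /gnb []; apply: tau0; lra.
  + by move=> /esym /gnb []; apply: tau0; lra.
  + by move: s1 t1; lra.
- by rewrite /F ltr01 /tau mul0r (gphi 0%N) // subrr; have [] := phiP 0%N.
- by rewrite /F ltxx.
- apply/seteqP; split=> z.
    move=> [t /=]; rewrite in_itv /= /F => t01; case: ifPn => t1 <-; last by left.
    have tu : 0 <= tau t by apply: tau0; lra.
    by have [k [ku _ _]] := gk _ tu; right; exists k => //; apply: gE; lra.
  move=> [->|[k _]]; first by exists 1; rewrite ?/F ?ltxx //= in_itv /= ler01 lexx.
  have [_ _ _ _ ->] := phiP k => -[t /=]; rewrite in_itv /= => t01 <-.
  have k0 : 0 <= k%:R :> R by [].
  pose u := k%:R + t; exists (u / (1 + u)).
    rewrite /= in_itv /=; apply/andP; split; first by apply: divr_ge0; rewrite /u; lra.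
    by rewrite ler_pdivrMr /u; lra.
  rewrite /F ifT; last by rewrite ltr_pdivrMr /u; lra.
  rewrite tauK; last by rewrite /u; lra.
  rewrite (gphi k); [by rewrite /u addrC addKr|rewrite /u; lra|].
  by rewrite /u -natr1; lra.
Unshelve. all: by end_near. Qed.

(** * Separation in the plane *)

(** Subdivision of an interval without a Lebesgue number: the supremum of the [z] with [P a z] is
    itself reached, and if it were below [b] the local hypothesis would carry [P] past it. *)
Lemma interval_induction (R : realType) (P : R -> R -> Prop) (a b : R) : a <= b ->
  (forall x y z, a <= x -> x <= y -> y <= z -> z <= b -> P x y -> P y z -> P x z) ->
  (forall x, a <= x <= b -> exists2 e, 0 < e & forall y z,
     a <= y -> y <= x -> x <= z -> z <= b -> x - e < y -> z < x + e -> P y z) ->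
  P a b.
Proof.
move=> ab Padd Ploc.
pose H := [set z : R | a <= z <= b /\ P a z].
have Ha : H a.
  split; first by rewrite lexx.
  have [|e e0] := Ploc a; first by rewrite lexx.
  by apply; rewrite ?lexx //; lra.
have Hs : has_sup H by split; [exists a|exists b => z [/andP[]]].
have aS : a <= sup H by apply: ub_le_sup => //; exact: Hs.2.
have Sb : sup H <= b by apply: ge_sup; [exists a|move=> z [/andP[]]].
have [|e e0 He] := Ploc (sup H); first by rewrite aS Sb.
have [z [/andP[az zb] Pz] ze] := sup_adherent e0 Hs.
have zS : z <= sup H by apply: ub_le_sup; [exact: Hs.2|split; rewrite ?az].
have PS y : sup H <= y -> y <= b -> y < sup H + e -> P a y.
  by move=> h1 h2 h3; apply: (Padd _ z) => //; [lra|apply: He => //; lra].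
have [Sb'|] := ltP (sup H) b; last by move=> bS; apply: PS; lra.
pose y := Num.min b (sup H + e / 2).
have [yb yS] : y <= b /\ y <= sup H + e / 2 by split; rewrite /y ge_min lexx ?orbT.
have Sy : sup H < y by rewrite /y lt_min Sb' /=; lra.
have : y <= sup H.
  apply: ub_le_sup; first exact: Hs.2.
  by split; [lra|apply: PS; lra].
lra.
Qed.

(** * Splitting locally constant Z/2-valued functions *)

Section Splitting.
Variables (T : topologicalType) (X Y : set T) (f : T -> bool).
Hypotheses (cX : closed X) (cY : closed Y) (XY : X `&` Y = set0).

Definition locconst (h : T -> bool) (A : set T) (z : T) :=
  \forall z' \near z, A z' -> h z' = h z.

Hypothesis lf : forall z, ~ X z -> ~ Y z -> locconst f setT z.

(* [f] is a sum (in Z/2) of a function on [A `\` X] and one on [A `\` Y], both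
   locally constant: the vanishing of a Mayer-Vietoris obstruction. *)
Definition split_on (A : set T) := exists u v : T -> bool,
  [/\ forall z, A z -> ~ X z -> locconst u A z,
      forall z, A z -> ~ Y z -> locconst v A z &
      forall z, A z -> ~ X z -> ~ Y z -> u z (+) v z = f z].

Lemma near_not (Z : set T) z : closed Z -> ~ Z z -> \forall z' \near z, ~ Z z'.
Proof.
by move=> cZ nZ; apply: open_nbhs_nbhs; split=> //; exact: (closed_openC cZ).
Qed.

Lemma split_on_sub (A B : set T) : A `<=` B -> split_on B -> split_on A.
Proof.
move=> AB [u [v [lu lv uv]]]; exists u, v; split.
- move=> z Az Xz; have := lu z (AB z Az) Xz; apply: filterS => z' h /AB; exact: h.
- move=> z Az Xz; have := lv z (AB z Az) Xz; apply: filterS => z' h /AB; exact: h.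
- by move=> z /AB; exact: uv.
Qed.

(** Where [X] is absent, [f] itself can serve as the summand that is locally constant off [Y]. *)
Lemma split_onX (A : set T) : A `&` X = set0 -> split_on A.
Proof.
move=> AX; have nX z : A z -> ~ X z.
  by move=> Az Xz; have : (A `&` X) z by []; rewrite AX.
exists (fun=> false), f; split=> [z _ _|z Az nY|z //]; first by near=> z'.
by have := lf (nX z Az) nY; apply: filterS => z' h _; exact: h.
Unshelve. all: by end_near. Qed.

Lemma split_onY (A : set T) : A `&` Y = set0 -> split_on A.
Proof.
move=> AX; have nX z : A z -> ~ Y z.
  by move=> Az Xz; have : (A `&` Y) z by []; rewrite AX.
exists f, (fun=> false); split=> [z Az nY|z _ _|z _ _ _]; last by rewrite addbF.
  by have := lf nY (nX z Az); apply: filterS => z' h _; exact: h.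
by near=> z'.
Unshelve. all: by end_near. Qed.

(* On the connected overlap the two splittings differ by a constant. *)
Lemma split_on_glue (A B : set T) : closed A -> closed B -> connected (A `&` B) ->
  split_on A -> split_on B -> split_on (A `|` B).
Proof.
move=> cA cB cAB [u1 [v1 [lu1 lv1 uv1]]] [u2 [v2 [lu2 lv2 uv2]]].
(* The difference of the two splittings. Off both sets its two expressions agree, because either
   pair sums to [f]; since no point lies in both sets, [w] is locally constant on the whole
   overlap. *)
pose w z := if `[< X z >] then v1 z (+) v2 z else u1 z (+) u2 z.
have wu z : A z -> B z -> ~ X z -> w z = u1 z (+) u2 z by move=> _ _ /asboolPn; rewrite /w => /negbTE ->.
have wv z : A z -> B z -> ~ Y z -> w z = v1 z (+) v2 z.
  move=> Az Bz nY; rewrite /w; case: asboolP => // nX.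
  have := uv1 z Az nX nY; rewrite -(uv2 z Bz nX nY).
  by case: (u1 z); case: (v1 z); case: (u2 z); case: (v2 z).
have nXY z : ~ X z \/ ~ Y z.
  have [Xz|] := pselect (X z); last by left.
  by right=> Yz; have : (X `&` Y) z by []; rewrite XY.
have lw z : (A `&` B) z -> locconst w (A `&` B) z.
  move=> [Az Bz]; have [nX|nY] := nXY z.
    have n1 := lu1 z Az nX; have n2 := lu2 z Bz nX; have n3 := near_not cX nX.
    near=> z' => -[Az' Bz']; rewrite !wu //; last by near: z'.
    by congr addb; [apply: (near n1 z')|apply: (near n2 z')].
  have n1 := lv1 z Az nY; have n2 := lv2 z Bz nY; have n3 := near_not cY nY.
  near=> z' => -[Az' Bz']; rewrite !wv //; last by near: z'.
  by congr addb; [apply: (near n1 z')|apply: (near n2 z')].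
have [k wk] : exists k, forall z, A z -> B z -> w z = k.
  have [[z0 [Az0 Bz0]]|n] := pselect (A `&` B !=set0); last first.
    by exists false => z Az Bz; exfalso; apply: n; exists z.
  exists (w z0) => z Az Bz.
  apply: (@connected_locconst _ (A `&` B) [set z | w z = w z0] z0) => // x ABx.
  by have := lw x ABx; apply: filterS => y h /h /= ->.
(* Adding [k] to both summands makes them agree with the first splitting on the overlap and leaves
   their sum over Z/2 unchanged. *)
exists (fun z => if `[< A z >] then u1 z else u2 z (+) k),
  (fun z => if `[< A z >] then v1 z else v2 z (+) k).
have eu z : B z -> ~ X z -> (if `[< A z >] then u1 z else u2 z (+) k) = u2 z (+) k.
  move=> Bz nX; case: asboolP => // Az; rewrite -(wk z Az Bz) wu //.
  by case: (u1 z); case: (u2 z).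
have ev z : B z -> ~ Y z -> (if `[< A z >] then v1 z else v2 z (+) k) = v2 z (+) k.
  move=> Bz nX; case: asboolP => // Az; rewrite -(wk z Az Bz) wv //.
  by case: (v1 z); case: (v2 z).
have gen (Z : set T) (h1 h2 : T -> bool) z : closed Z -> (A `|` B) z -> ~ Z z ->
    (forall z, A z -> ~ Z z -> locconst h1 A z) ->
    (forall z, B z -> ~ Z z -> locconst h2 B z) ->
    (forall z, B z -> ~ Z z -> (if `[< A z >] then h1 z else h2 z (+) k) = h2 z (+) k) ->
    locconst (fun z => if `[< A z >] then h1 z else h2 z (+) k) (A `|` B) z.
  move=> cZ ABz nZ l1 l2 e; have nn := near_not cZ nZ.
  have nA : \forall z' \near z, A z' -> A z /\ h1 z' = h1 z.
    have [Az|nAz] := pselect (A z).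
      by have := l1 z Az nZ; apply: filterS => z' h /h.
    by have := near_not cA nAz; apply: filterS => z' h /h.
  have nB : \forall z' \near z, B z' -> B z /\ h2 z' = h2 z.
    have [Az|nAz] := pselect (B z).
      by have := l2 z Az nZ; apply: filterS => z' h /h.
    by have := near_not cB nAz; apply: filterS => z' h /h.
  near=> z' => -[Az'|Bz'].
    have [Az e1] : A z /\ h1 z' = h1 z by apply: (near nA z').
    by rewrite !asboolT.
  have [Bz e1] : B z /\ h2 z' = h2 z by apply: (near nB z').
  have nZ' : ~ Z z' by near: z'.
  by rewrite !e // e1.
split.
- by move=> z ABz nX; apply: (gen X).
- by move=> z ABz nY; apply: (gen Y).
- move=> z [Az|Bz] nX nY; first by rewrite !asboolT // uv1.
  by rewrite eu // ev // -(uv2 z Bz nX nY); case: (u2 z); case: (v2 z); case: (k).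
Unshelve. all: by end_near. Qed.

(** The first summand is constant along [M1], which avoids [X], and the second along [M2], which
    avoids [Y]. *)
Lemma split_on_eq (A M1 M2 : set T) p q : split_on A -> connected M1 -> connected M2 ->
  M1 `<=` A `\` X -> M2 `<=` A `\` Y -> M1 p -> M1 q -> M2 p -> M2 q -> f p = f q.
Proof.
move=> [u [v [lu lv uv]]] c1 c2 s1 s2 p1 q1 p2 q2.
have [Ap nXp] := s1 _ p1; have [Aq nXq] := s1 _ q1.
have [_ nYp] := s2 _ p2; have [_ nYq] := s2 _ q2.
rewrite -uv // -uv //; congr addb; apply/esym.
  apply: (@connected_locconst _ M1 [set z | u z = u p] p) => // x Mx.
  have [Ax nXx] := s1 _ Mx.
  by have := lu x Ax nXx; apply: filterS => y h /s1[/h /= ->].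
apply: (@connected_locconst _ M2 [set z | v z = v p] p) => // x Mx.
have [Ax nXx] := s2 _ Mx.
by have := lv x Ax nXx; apply: filterS => y h /s2[/h /= ->].
Qed.

End Splitting.

Lemma pair_continuous (T : topologicalType) (R : realType) (f g : T -> R) (t : T) :
  {for t, continuous f} -> {for t, continuous g} ->
  {for t, continuous (fun t => (f t, g t))}.
Proof. by move=> cf cg; exact: (cvg_pair cf cg). Qed.

(** * Rectangles, segments and inversion in the plane *)

Section Plane.
Variable R : realType.
Implicit Types (a b c d e : R) (z p q : R * R).

Definition rect a b c d := [set z : R * R | (a <= z.1 <= b) /\ (c <= z.2 <= d)].

Lemma rect_setX a b c d : rect a b c d = `[a, b] `*` `[c, d].
Proof. by apply/seteqP; split=> z; rewrite /rect /= !in_itv. Qed.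

Lemma rect_compact a b c d : compact (rect a b c d).
Proof. by rewrite rect_setX; apply: compact_setX; exact: segment_compact. Qed.

Lemma plane_hausdorff : hausdorff_space (R * R)%type.
Proof. exact: (@norm_hausdorff R (R * R)%type). Qed.

Lemma rect_closed a b c d : closed (rect a b c d).
Proof. by apply: compact_closed; [exact: plane_hausdorff|exact: rect_compact]. Qed.

Lemma rect_vconn a c d : connected (rect a a c d).
Proof.
have -> : rect a a c d = (fun t => (a, t)) @` `[c, d].
  apply/seteqP; split=> [[x y] [/= ax cy]|_ [t /= + <-]]; last by rewrite in_itv /rect /= lexx.
  by exists y; rewrite /= ?in_itv //; congr pair; lra.
apply: connected_continuous_connected; first exact: segment_connected.
apply: continuous_subspaceT => t; apply: pair_continuous; [exact: cvg_cst|exact: cvg_id].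
Qed.

Lemma rect_hconn a b c : connected (rect a b c c).
Proof.
have -> : rect a b c c = (fun t => (t, c)) @` `[a, b].
  apply/seteqP; split=> [[x y] [/= ax cy]|_ [t /= + <-]]; last by rewrite in_itv /rect /= lexx.
  by exists x; rewrite /= ?in_itv //; congr pair; lra.
apply: connected_continuous_connected; first exact: segment_connected.
apply: continuous_subspaceT => t; apply: pair_continuous; [exact: cvg_id|exact: cvg_cst].
Qed.

Lemma nbhs_rect z (V : set (R * R)) : nbhs z V -> exists2 e, 0 < e &
  rect (z.1 - e) (z.1 + e) (z.2 - e) (z.2 + e) `<=` V.
Proof.
move=> /nbhs_ballP[e /= e0 zV]; exists (e / 2); first by lra.
move=> w [h1 h2]; apply: zV; split; rewrite /ball /= ltr_norml; lra.
Qed.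

(** A small square avoids [X] or [Y] and so admits a splitting. Squares are glued to a column of
    some positive width and columns to the rectangle; the overlaps are segments, hence connected. *)
Lemma split_on_rect (X Y : set (R * R)) f a b c d : closed X -> closed Y -> X `&` Y = set0 ->
  (forall z, ~ X z -> ~ Y z -> locconst f setT z) -> a <= b -> c <= d ->
  split_on X Y f (rect a b c d).
Proof.
move=> cX cY XY lf ab cd.
have loc z : exists2 e, 0 < e & split_on X Y f (rect (z.1 - e) (z.1 + e) (z.2 - e) (z.2 + e)).
  have [Xz|nX] := pselect (X z).
    have nY : ~ Y z by move=> Yz; have : (X `&` Y) z by []; rewrite XY.
    have [e e0 eY] := nbhs_rect (near_not cY nY); exists e => //.
    by apply: split_onY => //; apply/seteqP; split=> // w [/eY].
  have [e e0 eY] := nbhs_rect (near_not cX nX); exists e => //.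
  by apply: split_onX => //; apply/seteqP; split=> // w [/eY].
have col x : exists2 e, 0 < e & split_on X Y f (rect (x - e) (x + e) c d).
  apply: (@interval_induction R (fun c d => exists2 e, 0 < e & split_on X Y f (rect (x - e) (x + e) c d)) c d) => //.
    move=> c1 c2 c3 h1 h2 h3 h4 [e1 e10 s1] [e2 e20 s2].
    exists (Num.min e1 e2); first by rewrite lt_min e10.
    set e := Num.min e1 e2.
    have [e1e e2e] : e <= e1 /\ e <= e2 by split; rewrite /e ge_min lexx ?orbT.
    apply: (@split_on_sub _ _ _ _ _ (rect (x - e) (x + e) c1 c2 `|` rect (x - e) (x + e) c2 c3)).
      move=> z [z1 z2]; have [zc|zc] := leP z.2 c2; [left|right]; split=> //; lra.
    apply: split_on_glue => //; try exact: rect_closed.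
    - rewrite (_ : _ `&` _ = rect (x - e) (x + e) c2 c2); first exact: rect_hconn.
      apply/seteqP; split=> z; first by move=> [[? ?] [? ?]]; split=> //; lra.
      by move=> [? ?]; split; split=> //; lra.
    - by apply: split_on_sub s1 => z [z1 z2]; split=> //; lra.
    - by apply: split_on_sub s2 => z [z1 z2]; split=> //; lra.
  move=> y _; have [e e0 s] := loc (x, y); exists e => // y1 y2 ? ? ? ? ? ?.
  by exists e => //; apply: split_on_sub s => z [/= z1 z2]; split=> /=; lra.
apply: (@interval_induction R (fun a b => split_on X Y f (rect a b c d)) a b) => //.
  move=> a1 a2 a3 h1 h2 h3 h4 s1 s2.
  apply: (@split_on_sub _ _ _ _ _ (rect a1 a2 c d `|` rect a2 a3 c d)).
    move=> z [z1 z2]; have [zc|zc] := leP z.1 a2; [left|right]; split=> //; lra.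
  apply: split_on_glue => //; try exact: rect_closed.
  rewrite (_ : _ `&` _ = rect a2 a2 c d); first exact: rect_vconn.
  apply/seteqP; split=> z; first by move=> [[? ?] [? ?]]; split=> //; lra.
  by move=> [? ?]; split; split=> //; lra.
move=> x _; have [e e0 s] := col x; exists e => // y1 y2 ? ? ? ? ? ?.
by apply: split_on_sub s => z [z1 z2]; split=> //; lra.
Qed.

Lemma compact_rect (M : set (R * R)) : compact M -> exists N, forall z, M z -> `|z| <= N.
Proof.
move=> /compact_bounded[N [_ /(_ (N + 1))]] h; exists (N + 1) => z Mz.
by apply: h => //; lra.
Qed.

(* The Phragmen-Brouwer property of the plane. *)
Lemma disjoint_nonseparating (X Y M1 M2 : set (R * R)) f p q :
  closed X -> closed Y -> X `&` Y = set0 ->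
  (forall z, ~ X z -> ~ Y z -> locconst f setT z) ->
  compact M1 -> connected M1 -> M1 `&` X = set0 -> M1 p -> M1 q ->
  compact M2 -> connected M2 -> M2 `&` Y = set0 -> M2 p -> M2 q ->
  f p = f q.
Proof.
move=> cX cY XY lf k1 c1 M1X p1 q1 k2 c2 M2Y p2 q2.
have [N1 h1] := compact_rect k1; have [N2 h2] := compact_rect k2.
have b z N : `|z| <= N -> rect (- N) N (- N) N z.
  by rewrite prod_normE ge_max => /andP[]; rewrite !ler_norml.
have s : split_on X Y f (rect (- Num.max N1 N2) (Num.max N1 N2) (- Num.max N1 N2) (Num.max N1 N2)).
  have N10 : 0 <= N1 by exact: le_trans (normr_ge0 p) (h1 _ p1).
  have N0 : 0 <= Num.max N1 N2 by rewrite le_max N10.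
  by apply: split_on_rect => //; lra.
apply: (split_on_eq s c1 c2) => // z Mz; split.
- by apply: b; rewrite le_max h1.
- by move=> Xz; have : (M1 `&` X) z by []; rewrite M1X.
- by apply: b; rewrite le_max (h2 _ Mz) orbT.
- by move=> Xz; have : (M2 `&` Y) z by []; rewrite M2Y.
Qed.


Definition seg p q (t : R) : R * R := p + t *: (q - p).

Lemma seg0 p q : seg p q 0 = p. Proof. by rewrite /seg scale0r addr0. Qed.
Lemma seg1 p q : seg p q 1 = q. Proof. by rewrite /seg scale1r addrC subrK. Qed.

Lemma seg_continuous p q : continuous (seg p q).
Proof.
move=> t; apply: cvgD; first exact: cvg_cst.
by apply: cvgZ; [exact: cvg_id|exact: cvg_cst].
Qed.

Lemma seg_inj p q : p <> q -> injective (seg p q).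
Proof.
move=> pq s t /addrI /eqP; rewrite -subr_eq0 -scalerBl scaler_eq0 subr_eq0 => /orP[/eqP //|].
by rewrite subr_eq0 => /eqP E; case: pq.
Qed.

Lemma seg_dist p q (c : R * R) (t : R) : 0 <= t <= 1 ->
  `|c - seg p q t| <= (1 - t) * `|c - p| + t * `|c - q|.
Proof.
move=> t01; have -> : c - seg p q t = (1 - t) *: (c - p) + t *: (c - q).
  rewrite /seg; case: c p q => [c1 c2] [p1 p2] [q1 q2].
  by apply/eqP; rewrite xpair_eqE; apply/andP; split; apply/eqP => /=; rewrite /GRing.scale /=; ring.
rewrite (le_trans (ler_normD _ _)) // !normrZ !ger0_norm //; lra.
Qed.

Lemma seg_ball p q (c : R * R) (r t : R) : 0 <= t <= 1 -> `|c - p| < r -> `|c - q| < r ->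
  `|c - seg p q t| < r.
Proof. move=> t01 h1 h2; apply: le_lt_trans (seg_dist _ _ _ t01) _.
by have [h|h] := leP t (1 / 2); nra. Qed.

Lemma seg_simple_arc p q : p <> q -> simple_arc R p q (seg p q @` `[0, 1]).
Proof.
move=> pq; have := @arc_image R _ (seg p q) 0 1 ltr01 (@seg_continuous p q).
by rewrite seg0 seg1; apply => s t _ _; exact: seg_inj.
Qed.

Lemma seg_arcc (M : set (R * R)) p q : (forall t, 0 <= t <= 1 -> M (seg p q t)) ->
  arcc R M p q.
Proof.
move=> h; have [->|pq] := pselect (p = q); first exact: arcc_refl.
right; exists (seg p q @` `[0, 1]); first exact: seg_simple_arc.
by move=> _ [t /= + <-]; rewrite in_itv /=; exact: h.
Qed.

Lemma arcc_ball (c : R * R) r p q : `|c - p| < r -> `|c - q| < r ->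
  arcc R [set z | `|c - z| < r] p q.
Proof. by move=> h1 h2; apply: seg_arcc => t t01; exact: seg_ball. Qed.

Lemma nbhs_norm_ball z (V : set (R * R)) : nbhs z V ->
  exists2 r, 0 < r & [set w | `|z - w| < r] `<=` V.
Proof.
by move=> /nbhs_ballP[r /= r0 h]; exists r => //; move: h; rewrite -ball_normE.
Qed.

Lemma norm_ball_nbhs z r : 0 < r -> nbhs z [set w | `|z - w| < r].
Proof. by move=> r0; have := nbhsx_ballx z r r0; rewrite -ball_normE. Qed.

Lemma arcc_locconst (O : set (R * R)) p z : open O -> O z ->
  locconst (fun w => `[< arcc R O p w >]) setT z.
Proof.
move=> oO Oz; have [r r0 rO] := nbhs_norm_ball (open_nbhs_nbhs (conj oO Oz)).
have := norm_ball_nbhs z r0; apply: filterS => w zw _.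
have A : arcc R O z w by apply: arcc_sub rO _; apply: arcc_ball => //; rewrite subrr normr0.
apply/asboolP/asboolP => h.
  by apply: (arcc_trans plane_hausdorff) h (arcc_sym A).
exact: (arcc_trans plane_hausdorff) h A.
Qed.

Lemma locconst_arcc f (M : set (R * R)) p q :
  (forall z, M z -> locconst f setT z) -> M p -> arcc R M p q -> f p = f q.
Proof.
move=> lf Mp /(arcc_connected Mp)[C cC [Cp Cq CM]]; apply/esym.
apply: (@connected_locconst _ C [set z | f z = f p] p) => // x Cx.
by have := lf x (CM x Cx); apply: filterS => y h _ /=; rewrite h.
Qed.

(** Each point is joined to a corner [(c.1 + M, c.2 + M)] by two axis-parallel segments, along each
    of which one coordinate is fixed and far from that of [c]. *)
Lemma arcc_far (c : R * R) N p q : N < `|p - c| -> N < `|q - c| ->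
  arcc R [set z | N < `|z - c|] p q.
Proof.
have farE z : (N < `|z - c|) = (N < `|z.1 - c.1|) || (N < `|z.2 - c.2|).
  by rewrite prod_normE lt_max.
have key p' M : N < M -> N < `|p' - c| -> 0 <= M ->
    arcc R [set z | N < `|z - c|] p' (c.1 + M, c.2 + M).
  move=> NM + M0; have cM (a : R) : N < `|a + M - a|.
    by rewrite (_ : a + M - a = M); [rewrite ger0_norm|ring].
  rewrite farE => /orP[h|h].
    apply: (arcc_trans plane_hausdorff) (_ : arcc _ _ _ (p'.1, c.2 + M)) _.
      apply: seg_arcc => t _ /=; rewrite farE (_ : (seg _ _ t).1 = p'.1) ?h //.
      by rewrite /seg /= /GRing.scale /=; ring.
    apply: seg_arcc => t _ /=; rewrite farE (_ : (seg _ _ t).2 = c.2 + M).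
      by rewrite (cM c.2) orbT.
    by rewrite /seg /= /GRing.scale /=; ring.
  apply: (arcc_trans plane_hausdorff) (_ : arcc _ _ _ (c.1 + M, p'.2)) _.
    apply: seg_arcc => t _ /=; rewrite farE (_ : (seg _ _ t).2 = p'.2) ?h ?orbT //.
    by rewrite /seg /= /GRing.scale /=; ring.
  apply: seg_arcc => t _ /=; rewrite farE (_ : (seg _ _ t).1 = c.1 + M).
    by rewrite (cM c.1).
  by rewrite /seg /= /GRing.scale /=; ring.
move=> hp hq; have NM : N < `|N| + 1 by rewrite (le_lt_trans (ler_norm _)) // ltrDl.
have M0 : 0 <= `|N| + 1 by rewrite addr_ge0.
exact: (arcc_trans plane_hausdorff) (key _ _ NM hp M0) (arcc_sym (key _ _ NM hq M0)).
Qed.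

(** Inversion for the maximum norm: still an involution with reciprocal norm. It fixes 0, because
    the inverse of 0 is 0. *)
Definition inversion (w : R * R) : R * R := (`|w| ^- 2) *: w.

Lemma inversion_norm w : `|inversion w| = `|w|^-1.
Proof.
have [->|w0] := eqVneq w 0; first by rewrite /inversion scaler0 normr0 invr0.
rewrite /inversion normrZ ger0_norm ?invr_ge0 ?exprn_ge0 //.
by rewrite expr2 invfM mulfVK // normr_eq0.
Qed.

Lemma inversion_neq0 w : w != 0 -> inversion w != 0.
Proof. by move=> w0; rewrite -normr_eq0 inversion_norm invr_eq0 normr_eq0. Qed.

Lemma inversionK w : inversion (inversion w) = w.
Proof.
have [->|w0] := eqVneq w 0; first by rewrite /inversion !scaler0.
rewrite {1}/inversion inversion_norm /inversion scalerA.
by rewrite exprVn invrK mulfV ?scale1r // sqrf_eq0 normr_eq0.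
Qed.

Lemma inversion_continuous w : w != 0 -> {for w, continuous inversion}.
Proof.
move=> w0; apply: cvgZ; last exact: cvg_id.
apply: cvgV; first by rewrite sqrf_eq0 normr_eq0.
by apply: cvgM; exact: norm_continuous.
Qed.

(* Janiszewski's theorem in the case of a one-point intersection: the inversion
   sends that point to infinity and makes the two sets disjoint. *)
Lemma janiszewski (X Y : set (R * R)) (c p q : R * R) : compact X -> compact Y ->
  X `&` Y `<=` [set c] -> arcc R (~` X) p q -> arcc R (~` Y) p q ->
  ~ X p -> ~ Y p -> ~ X q -> ~ Y q ->
  arcc R (~` (X `|` Y)) p q.
Proof.
move=> kX kY XYc; have cX := compact_closed plane_hausdorff kX.
have cY := compact_closed plane_hausdorff kY.
have oXY : open (~` (X `|` Y)) by apply: closed_openC; exact: closedU.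
move=> [<-|[M1 a1 M1X]]; first by move=> *; exact: arcc_refl.
move=> [<-|[M2 a2 M2Y]]; first by move=> *; exact: arcc_refl.
move=> nXp nYp nXq nYq.
(* Locally constant off both sets, so that the claim becomes [f p = f q], the conclusion of
   [disjoint_nonseparating]. *)
pose f w := `[< arcc R (~` (X `|` Y)) p w >].
suff : f p = f q by rewrite /f asboolT; [move=> /esym/asboolP|exact: arcc_refl].
have lf z : ~ X z -> ~ Y z -> locconst f setT z.
  by move=> nX nY; apply: arcc_locconst => // -[].
have k1 := simple_arc_compact a1; have c1 := simple_arc_connected a1.
have k2 := simple_arc_compact a2; have c2 := simple_arc_connected a2.
have [p1 q1] := (simple_arc_left a1, simple_arc_right a1).
have [p2 q2] := (simple_arc_left a2, simple_arc_right a2).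
have [[Xc Yc]|nc] := pselect ((X `&` Y) c); last first.
  have XY0 : X `&` Y = set0 by apply/seteqP; split=> // z XYz; apply: nc; rewrite -(XYc z XYz).
  apply: (disjoint_nonseparating cX cY XY0 lf k1 c1 _ p1 q1 k2 c2 _ p2 q2).
  - by apply/seteqP; split=> // z [/M1X].
  - by apply/seteqP; split=> // z [/M2Y].
have [NX hNX] := compact_rect kX; have [NY hNY] := compact_rect kY.
pose N := Num.max NX NY + `|c|.
have bN z : N < `|z - c| -> ~ X z /\ ~ Y z.
  move=> Nz; have : Num.max NX NY < `|z|.
    by have := ler_normB z c; move: Nz; rewrite /N; lra.
  by rewrite gt_max => /andP[h1 h2]; split=> [/hNX|/hNY]; lra.
have N0 : 0 <= N.
  by rewrite addr_ge0 // le_max (le_trans (normr_ge0 c)) //; exact: hNX.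
pose J (w : R * R) := c + inversion w.
pose J' z := inversion (z - c).
have J'K z : J (J' z) = z by rewrite /J /J' inversionK addrC subrK.
have J'0 z : z <> c -> J' z != 0.
  by move=> zc; apply: inversion_neq0; rewrite subr_eq0; apply/eqP.
have Jcont w : w != 0 -> {for w, continuous J}.
  by move=> w0; apply: cvgD; [exact: cvg_cst|exact: inversion_continuous].
have near0 (w : R * R) : w != 0 -> \forall w' \near w, w' != 0.
  move=> w0; have := norm_ball_nbhs w (_ : 0 < `|w|); rewrite normr_gt0 => /(_ w0).
  by apply: filterS => w' /=; apply: contraTneq => ->; rewrite subr0 ltxx.
(* [far] stands for the point at infinity, which the inversion brings to 0. As [f] is constant
   beyond radius [N], giving [f'] the value [f far] at 0 makes it locally constant there. *)
pose far := c + (N + 1, 0).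
pose f' w := if w == 0 then f far else f (J w).
have Jfar w : w != 0 -> `|w| < (N + 1)^-1 -> N < `|J w - c|.
  move=> w0 h; rewrite /J addrAC subrr add0r inversion_norm.
  rewrite (@lt_trans _ _ (N + 1)) ?ltrDl // -(invrK (N + 1)) ltf_pV2 ?posrE ?invr_gt0 ?normr_gt0 //; lra.
have farN : N < `|far - c|.
  rewrite /far addrAC subrr add0r prod_normE lt_max /= ger0_norm; [apply/orP; left|]; lra.
have ffar z : N < `|z - c| -> f z = f far.
  move=> h; apply: (locconst_arcc _ h (arcc_far h farN)) => w /bN[]; exact: lf.
(* With [c] sent to infinity these sets are closed and disjoint but possibly unbounded, which is why
   [disjoint_nonseparating] is stated for closed sets. *)
pose X' := [set w | w != 0 /\ X (J w)]; pose Y' := [set w | w != 0 /\ Y (J w)].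
have clo (Z : set (R * R)) : closed Z -> (forall z, N < `|z - c| -> ~ Z z) ->
    closed [set w | w != 0 /\ Z (J w)].
  move=> cZ Zfar; rewrite -[X in closed X]setCK; apply: open_closedC.
  rewrite openE => w; rewrite /interior => nw.
  have [w0|w0] := eqVneq w 0.
    have := norm_ball_nbhs 0 (_ : 0 < (N + 1)^-1); rewrite invr_gt0 => /(_ _) h.
    rewrite w0; apply: filterS (h _) => [w' /= | ]; last by lra.
    by rewrite sub0r normrN => hw [w'0]; apply: Zfar; exact: Jfar.
  have nZ : ~ Z (J w) by move=> Zw; apply: nw.
  have h0 : \forall w' \near w, ~ Z (J w') by exact: (Jcont w w0 _ (near_not cZ nZ)).
  by apply: filterS h0 => w' h [_].
have cX' : closed X' by apply: clo => // z /bN[].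
have cY' : closed Y' by apply: clo => // z /bN[].
have XY' : X' `&` Y' = set0.
  apply/seteqP; split=> // w [[w0 Xw] [_ Yw]]; have /= := XYc _ (conj Xw Yw).
  move=> /eqP; rewrite /J -subr_eq0 addrAC subrr add0r => /eqP i0.
  by move: (inversion_neq0 w0); rewrite i0 eqxx.
have lf' w : ~ X' w -> ~ Y' w -> locconst f' setT w.
  move=> nX nY; have [w0|w0] := eqVneq w 0.
    have := norm_ball_nbhs 0 (_ : 0 < (N + 1)^-1); rewrite invr_gt0 => /(_ _) h.
    rewrite w0; apply: filterS (h _) => [w' /= | ]; last by lra.
    rewrite sub0r normrN => hw _; rewrite /f' eqxx; case: ifPn => // w'0.
    by apply: ffar; exact: Jfar.
  have nX' : ~ X (J w) by move=> Xw; apply: nX.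
  have nY' : ~ Y (J w) by move=> Xw; apply: nY.
  have n1 : \forall w' \near w, f (J w') = f (J w).
    have h0 : \forall w' \near w, [set: R * R] (J w') -> f (J w') = f (J w).
      exact: (Jcont w w0 _ (lf _ nX' nY')).
    by apply: filterS h0 => w' ->.
  have n2 := near0 w w0.
  near=> w' => _; rewrite /f' (negbTE w0) ifF; first by near: w'.
  by apply/negbTE; near: w'.
(* [c] belongs to the set that the arc avoids, so the inversion is continuous along the arc. *)
have img (M Z : set (R * R)) : Z c -> M `<=` ~` Z -> compact M -> connected M ->
    [/\ compact (J' @` M), connected (J' @` M) & J' @` M `&` [set w | w != 0 /\ Z (J w)] = set0].
  move=> Zc MZ kM cM; have cont : {within M, continuous J'}.
    apply: continuous_in_subspaceT => z /set_mem Mz.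
    apply: (@continuous_comp _ _ _ (fun z => z - c) inversion).
      by apply: cvgB; [exact: cvg_id|exact: cvg_cst].
    by apply: inversion_continuous; rewrite subr_eq0; apply/eqP => zc; apply: (MZ z Mz); rewrite zc.
  split; [exact: continuous_compact|exact: connected_continuous_connected|].
  by apply/seteqP; split=> // _ [[z Mz <-] [_]]; rewrite J'K; exact: MZ.
have [i1 i2 i3] := img _ _ Xc M1X k1 c1; have [j1 j2 j3] := img _ _ Yc M2Y k2 c2.
have fJ z : z <> c -> f z = f' (J' z).
  by move=> zc; rewrite /f' (negbTE (J'0 z zc)) J'K.
rewrite !fJ; [|by move=> E; apply: nXq; rewrite E|by move=> E; apply: nXp; rewrite E].
by apply: (disjoint_nonseparating cX' cY' XY' lf' i1 i2 i3 _ _ j1 j2 j3).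
Unshelve. all: by end_near. Qed.

(* Cut the arc into pieces so short that each lies in a small square containing
   neither [p] nor [q], and add them to [Y] one by one by [janiszewski]. *)
Lemma arc_nonseparating (e : R -> R * R) s t (Y : set (R * R)) p q : s <= t ->
  continuous e -> injon e s t -> compact Y ->
  (e @` `[s, t]) `&` Y `<=` [set e t] ->
  ~ (e @` `[s, t]) p -> ~ (e @` `[s, t]) q -> ~ Y p -> ~ Y q ->
  arcc R (~` Y) p q -> arcc R (~` (e @` `[s, t] `|` Y)) p q.
Proof.
move=> st ce ine kY eY nep neq nYp nYq aY.
(* [Y] is quantified here because the induction absorbs the later pieces of the arc into it. *)
pose P x y := forall Y : set (R * R), compact Y ->
  (e @` `[x, y]) `&` Y `<=` [set e y] -> ~ Y p -> ~ Y q ->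
  arcc R (~` Y) p q -> arcc R (~` (e @` `[x, y] `|` Y)) p q.
have ksub x y : compact (e @` `[x, y]).
  by apply: continuous_compact; [exact: continuous_subspaceT|exact: segment_compact].
have nsub x y r : s <= x -> y <= t -> ~ (e @` `[s, t]) r -> ~ (e @` `[x, y]) r.
  move=> sx yt h [u /= + ur]; rewrite in_itv /= => xuy; apply: h; exists u => //=.
  by rewrite in_itv /=; lra.
suff : P s t by apply.
apply: interval_induction => //.
  move=> x y z sx xy yz zt Pxy Pyz {}Y {}kY {}eY {}nYp {}nYq {}aY.
  have -> : e @` `[x, z] `|` Y = e @` `[x, y] `|` (e @` `[y, z] `|` Y).
    rewrite setUA; congr setU; apply/seteqP; split=> r.
      move=> [u /=]; rewrite in_itv /= => xuz <-; have [uy|uy] := leP u y; [left|right];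
        exists u => //=; rewrite in_itv /=; lra.
    by move=> [|] [u /=]; rewrite in_itv /= => xuz <-; exists u => //=; rewrite in_itv /=; lra.
  (* The later piece together with [Y] meets the earlier piece at most in [e y]: for the piece by
     injectivity, and for [Y] because a common point is [e z], which the earlier piece contains only
     if [y = z]. *)
  apply: Pxy.
  - exact: compactU.
  - move=> r [[u /=]]; rewrite in_itv /= => xuy <- [[v /=]|Yr].
      rewrite in_itv /= => yvz /ine E.
      have {}E : v = u by apply: E; lra.
      by rewrite (_ : u = y) //; lra.
    have : e u = e z.
      apply: eY; split=> //; exists u => //=; rewrite in_itv /=; lra.
    move=> /ine E; have {}E : u = z by apply: E; lra.
    by rewrite (_ : u = y) //; lra.
  - by move=> [|//]; apply: nsub => //; lra.
  - by move=> [|//]; apply: nsub => //; lra.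
  - apply: Pyz => // r [[u /=]]; rewrite in_itv /= => yuz <- Yr; apply: eY; split=> //.
    by exists u => //=; rewrite in_itv /=; lra.
move=> x xst.
have far r : ~ (e @` `[s, t]) r -> 0 < `|r - e x|.
  by move=> h; rewrite normr_gt0 subr_eq0; apply: contra_notN h => /eqP ->; exists x => //=; rewrite in_itv.
pose r := Num.min `|p - e x| `|q - e x| / 2.
have r0 : 0 < r by rewrite /r divr_gt0 // lt_min !far.
have [rp rq] : r < `|p - e x| /\ r < `|q - e x|.
  have m1 : Num.min `|p - e x| `|q - e x| <= `|p - e x| by rewrite ge_min lexx.
  have m2 : Num.min `|p - e x| `|q - e x| <= `|q - e x| by rewrite ge_min lexx orbT.
  by move: r0; rewrite /r => r0; split; lra.
have /nbhs_ballP[d /= d0 dr] := ce x _ (norm_ball_nbhs (e x) r0).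
exists d => // y z sy yx xz zt xdy zxd {}Y {}kY {}eY {}nYp {}nYq {}aY.
have er u : y <= u <= z -> `|e u - e x| < r.
  by move=> yuz; rewrite distrC; apply: dr; rewrite /ball /= ltr_norml; lra.
apply: janiszewski kY eY _ aY _ nYp _ nYq => //; [|by apply: nsub|by apply: nsub].
apply: arcc_sub (arcc_far rp rq) => w /= h [u /=]; rewrite in_itv /= => /er + uw.
by rewrite uw; lra.
Qed.

End Plane.

(** A detour from [a] to [b] over any [d] must also pass the mean of [a] and [b], on one of its two
    legs. *)
Lemma between_midpoint (R : realType) (a b d : R) : let v := (a + b) / 2 in
  Num.min a d <= v <= Num.max a d \/ Num.min d b <= v <= Num.max d b.
Proof.
rewrite /= !ge_min !le_max.
have [ab|ab] := leP a b; have [dv|dv] := leP d ((a + b) / 2).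
- by right; apply/andP; split; apply/orP; [left|right]; lra.
- by left; apply/andP; split; apply/orP; [left|right]; lra.
- by left; apply/andP; split; apply/orP; [right|left]; lra.
- by right; apply/andP; split; apply/orP; [right|left]; lra.
Qed.

(** * Charts and arcs in surfaces *)

Section Surface.
Variables (R : realType) (S : topologicalType).
Hypotheses (hS : hausdorff_space S) (kS : compact [set: S]) (lS : locally_planar R S).
Implicit Types (x y z : S) (O M C K : set S) (p q : R * R).

(* On the closed square of radius [r] around [phi x], [psi] is a
   parametrization, with inverse [phi], of a neighbourhood of [x] contained in
   [O]. *)
Definition chart_at x O (phi : S -> R * R) (psi : R * R -> S) (r : R) :=
  [/\ 0 < r, psi (phi x) = x,
     forall p, `|phi x - p| <= r ->
       [/\ O (psi p), phi (psi p) = p, {for p, continuous psi} &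
           {for psi p, continuous phi}] &
     forall p V, `|phi x - p| <= r -> nbhs p V -> nbhs (psi p) (psi @` V)].

Lemma chart_exists x O : open O -> O x ->
  exists phi psi r, chart_at x O phi psi r.
Proof.
move=> oO Ox; have [U [f [g [[oU Ux] ofU cf cg gf]]]] := lS x.
have cfx y : U y -> {for y, continuous f}.
  by move: cf; rewrite continuous_open_subspace // => cf /mem_set; exact: cf.
have cgx p : (f @` U) p -> {for p, continuous g}.
  by move: cg; rewrite continuous_open_subspace // => cg /mem_set; exact: cg.
have fUx : (f @` U) (f x) by exists x.
have nO : nbhs (f x) (g @^-1` O).
  by apply: (cgx _ fUx); rewrite gf //; exact: open_nbhs_nbhs.
have nU : nbhs (f x) (f @` U) by exact: open_nbhs_nbhs.
have [r r0 hr] := nbhs_norm_ball (filterI nO nU).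
(* Halving makes the closed square fit into the open square of radius [r], on which the chart is
   controlled. *)
exists f, g, (r / 2); split; [lra|exact: gf| |].
- move=> p hp; have [Op [y Uy yp]] : (g @^-1` O `&` f @` U) p by apply: hr => /=; lra.
  split=> //; rewrite -?yp ?gf //; first by apply: cgx; exists y.
  exact: cfx.
- move=> p V hp nV; have [Op [y Uy yp]] : (g @^-1` O `&` f @` U) p by apply: hr => /=; lra.
  rewrite -yp gf // in nV *.
  have n1 : \forall y' \near y, V (f y') by exact: (cfx y Uy V nV).
  have n2 : \forall y' \near y, U y' by exact: open_nbhs_nbhs.
  apply: filterS2 n1 n2.
  by move=> y' Vy' Uy'; exists (f y') => //; exact: gf.
Qed.

Lemma chart_nbhs x O phi psi r r' : chart_at x O phi psi r -> 0 < r' ->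
  nbhs x (psi @` [set p | `|phi x - p| < r']).
Proof.
move=> [r0 px h1 h2] r'0; rewrite -{1}px; apply: h2.
  by rewrite subrr normr0 ltW.
exact: norm_ball_nbhs.
Qed.

Lemma chart_simple_arc x O phi psi r (C : set (R * R)) p q : chart_at x O phi psi r ->
  C `<=` [set p | `|phi x - p| <= r] -> simple_arc R p q C ->
  simple_arc R (psi p) (psi q) (psi @` C).
Proof.
move=> [r0 px h1 h2] Cr /simple_arcP[e [ce ie <- <- CE]]; rewrite {C}CE in Cr *.
have er t : 0 <= t <= 1 -> `|phi x - e t| <= r.
  by move=> t01; apply: Cr; exists t => //=; rewrite in_itv.
exists (psi \o e); split=> //; last by rewrite image_comp.
- apply: continuous_in_subspaceT => t /set_mem /=; rewrite in_itv /= => /er /h1[_ _ c _].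
  by apply: continuous_comp => //; exact: ce.
- apply: injon_set_inj => s t s01 t01 /= E; apply: ie => //.
  have [_ <- _ _] := h1 _ (er s s01); have [_ <- _ _] := h1 _ (er t t01).
  by rewrite E.
Qed.

Lemma chart_arcc x O phi psi r (M : set (R * R)) p q : chart_at x O phi psi r ->
  M `<=` [set p | `|phi x - p| <= r] -> arcc R M p q -> arcc R (psi @` M) (psi p) (psi q).
Proof.
move=> cx Mr [->|[C aC CM]]; first exact: arcc_refl.
right; exists (psi @` C); last exact: image_subset.
by apply: (chart_simple_arc cx) => //; exact: subset_trans Mr.
Qed.

Lemma local_arcc x O : open O -> O x -> \forall y \near x, arcc R O x y.
Proof.
move=> oO Ox; have [phi [psi [r ch]]] := chart_exists oO Ox.
have [r0 px h1 _] := ch; apply: filterS (chart_nbhs ch r0) => _ [p pr <-].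
rewrite -{1}px; apply: (@arcc_sub _ _ (psi @` [set p | `|phi x - p| < r])).
  by move=> _ [q qr <-]; have [] := h1 q (ltW qr).
apply: (chart_arcc ch) => [q qr|]; first exact: ltW.
by apply: arcc_ball => //; rewrite subrr normr0.
Qed.

Lemma near_arcc O x y : open O -> O y -> \forall z \near y, arcc R O x z <-> arcc R O x y.
Proof.
move=> oO Oy; apply: filterS (local_arcc oO Oy) => z yz; split=> h.
  exact: (arcc_trans hS) h (arcc_sym yz).
exact: (arcc_trans hS) h yz.
Qed.

Lemma connected_arcc O M x y : open O -> connected M -> M `<=` O -> M x -> M y -> arcc R O x y.
Proof.
move=> oO cM MO Mx My.
apply: (@connected_locconst _ M [set z | arcc R O x z] x) => //; last exact: arcc_refl.
by move=> z /MO Oz; apply: filterS (near_arcc x oO Oz) => w h _.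
Qed.

(** The inverse of [e] is continuous on the compact arc and extends to the compact, hence normal,
    space by Tietze's theorem. The extension later confines each stage of the walk to a range of
    parameters. *)
Lemma arc_coordinate (e : R -> S) : continuous e -> injon e 0 1 ->
  exists2 h : S -> R, continuous h & forall t, 0 <= t <= 1 -> h (e t) = t.
Proof.
move=> ce ie.
have cE a b : closed (e @` `[a, b]).
  apply: compact_closed => //; apply: continuous_compact; last exact: segment_compact.
  exact: continuous_subspaceT.
have /choice[k kP] : forall x, exists t : R, 0 <= t <= 1 /\ ((e @` `[0, 1]) x -> e t = x).
  move=> x; have [[t /=]|n] := pselect ((e @` `[0, 1]) x).
    by rewrite in_itv /= => t01 tx; exists t.
  by exists 0; split=> //; rewrite lexx ler01.
have k01 x : 0 <= k x <= 1 by have [] := kP x.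
have ke t : 0 <= t <= 1 -> k (e t) = t.
  by move=> t01; apply: ie => //; have [_ ->//] := kP (e t).
have ck : {within e @` `[0, 1], continuous k}.
  apply/subspace_continuousP => _ [t /= + <-]; rewrite in_itv /= => t01 V.
  rewrite /from_subspace ke // => /nbhs_ballP[d /= d0 dV].
  suff : \forall y \near e t, (e @` `[0, 1]) y -> V (k y) by [].
  (* The parameters at distance at least [d] from [t] have images in two closed sets that miss
     [e t], so only closer parameters occur near [e t]. *)
  have n1 : ~ (e @` `[0, t - d]) (e t).
    by move=> [s /=]; rewrite in_itv /= => s01 /ie E; have : s = t; [apply: E; lra|lra].
  have n2 : ~ (e @` `[t + d, 1]) (e t).
    by move=> [s /=]; rewrite in_itv /= => s01 /ie E; have : s = t; [apply: E; lra|lra].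
  apply: filterS2 (near_not (cE 0 (t - d)) n1) (near_not (cE (t + d) 1) n2).
  move=> y h1 h2 [s /=]; rewrite in_itv /= => s01 sy.
  apply: dV; rewrite -sy ke // /ball /= ltr_norml; apply/andP; split.
    have [|h] := leP (t + d) s; last lra.
    by move=> h; exfalso; apply: h2; exists s => //=; rewrite in_itv /=; lra.
  have [|h] := leP s (t - d); last lra.
  by move=> h; exfalso; apply: h1; exists s => //=; rewrite in_itv /=; lra.
have kb x : `|k x| <= 1 by have /andP[k0 k1] := k01 x; rewrite ger0_norm.
have [g [gk cg _]] := continuous_bounded_extension (compact_normal hS kS) (cE 0 1) ltr01 ck (fun x _ => kb x).
exists g => // t t01; rewrite -gk ?ke //; apply/mem_set.
by exists t => //=; rewrite in_itv.
Qed.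

Definition nowhere_dense_closed K :=
  closed K /\ forall O, open O -> O !=set0 -> exists2 z, O z & ~ K z.

Lemma nowhere_denseU K1 K2 : nowhere_dense_closed K1 -> nowhere_dense_closed K2 ->
  nowhere_dense_closed (K1 `|` K2).
Proof.
move=> [c1 d1] [c2 d2]; split; first exact: closedU.
move=> O oO O0; have [x Ox nx] := d1 O oO O0.
have oO1 : open (O `&` ~` K1) by apply: openI => //; exact: closed_openC.
have [|y [Oy ny1] ny2] := d2 _ oO1; first by exists x.
by exists y => // -[].
Qed.

Lemma nowhere_dense_seq (I : eqType) (s : seq I) (F : I -> set S) :
  (forall i, i \in s -> nowhere_dense_closed (F i)) ->
  nowhere_dense_closed [set x | exists2 i, i \in s & F i x].
Proof.
elim: s => [_|i s IH h].
  have -> : [set x | exists2 i : I, i \in [::] & F i x] = set0.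
    by apply/seteqP; split=> // x [].
  by split; [exact: closed0|move=> O _ [x Ox]; exists x].
have -> : [set x | exists2 j, j \in i :: s & F j x] = F i `|` [set x | exists2 j, j \in s & F j x].
  apply/seteqP; split=> x.
    by move=> [j]; rewrite inE => /orP[/eqP -> ?|js ?]; [left|right; exists j].
  by move=> [?|[j js ?]]; [exists i|exists j] => //; rewrite inE ?eqxx ?js ?orbT.
apply: nowhere_denseU; first by apply: h; rewrite inE eqxx.
by apply: IH => j js; apply: h; rewrite inE js orbT.
Qed.

Lemma nowhere_dense1 x : nowhere_dense_closed [set x].
Proof.
split; first by apply: accessible_closed_set1; exact: hausdorff_accessible.
move=> O oO [y Oy]; have [phi [psi [r [r0 py h1 _]]]] := chart_exists oO Oy.
have [xy|xy] := pselect (x = y); last by exists y => // E; apply: xy.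
have [|Oz pz _ _] := h1 (phi y + (r, 0)).
  rewrite opprD addrA subrr sub0r normrN prod_normE /= normr0 ge_max (ltW r0) ?andbT //=.
  by rewrite ger0_norm // ltW.
exists (psi (phi y + (r, 0))) => // E.
have : phi y + (r, 0) = phi y + 0 by rewrite -pz E xy addr0.
by move/addrI => -[]; lra.
Qed.

(* Otherwise an injective continuous real function exists on a square, and it
   takes some value both on a segment and on a detour with the same ends. *)
Lemma nowhere_dense_arc x y C : simple_arc R x y C -> nowhere_dense_closed C.
Proof.
move=> aC; split; first exact: simple_arc_closed aC.
move: aC => /simple_arcP[e [ce ie _ _ CE]] O oO [x0 Ox0].
apply: contrapT => nO.
have OC z : O z -> C z by move=> Oz; apply: contrapT => nC; apply: nO; exists z.
have [h ch he] := arc_coordinate ce ie.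
have [phi [psi [r [r0 py h1 _]]]] := chart_exists oO Ox0.
have hinj z z' : O z -> O z' -> h z = h z' -> z = z'.
  move=> /OC + /OC; rewrite CE => -[t /= + <-] [t' /= + <-]; rewrite !in_itv /= => t01 t01'.
  by rewrite !he // => ->.
pose A := phi x0; pose B := A + (r, 0); pose D := A + (0, r).
have nr : `|r| <= r by rewrite ger0_norm // ltW.
have AA : `|A - A| <= r by rewrite subrr normr0 ltW.
have AB : `|A - B| <= r.
  by rewrite opprD addrA subrr sub0r normrN prod_normE /= normr0 ge_max nr ltW.
have AD : `|A - D| <= r.
  by rewrite opprD addrA subrr sub0r normrN prod_normE /= normr0 ge_max nr ltW.
have sb p q t : 0 <= t <= 1 -> `|A - p| <= r -> `|A - q| <= r -> `|A - seg p q t| <= r.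
  by move=> t01 hp hq; apply: le_trans (seg_dist _ _ _ t01) _; nra.
pose k p := h (psi p).
have kinj p q : `|A - p| <= r -> `|A - q| <= r -> k p = k q -> p = q.
  by move=> /h1[Op e1 _ _] /h1[Oq e2 _ _] /hinj E; rewrite -e1 -e2 E.
have ivt p q v : `|A - p| <= r -> `|A - q| <= r -> Num.min (k p) (k q) <= v <= Num.max (k p) (k q) ->
    exists2 t, 0 <= t <= 1 & k (seg p q t) = v.
  move=> hp hq hv; have := @IVT R (k \o seg p q) 0 1 v ler01.
  rewrite /= seg0 seg1 => /(_ _ hv)[|t]; last by rewrite in_itv /= => t01 E; exists t.
  apply: continuous_in_subspaceT => t /set_mem /=; rewrite in_itv /= => t01.
  have [_ _ cp _] := h1 _ (sb p q t t01 hp hq).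
  apply: (@continuous_comp _ _ _ (psi \o seg p q) h); last exact: ch.
  by apply: continuous_comp => //; exact: seg_continuous.
have kAB : k A <> k B.
  by move=> /(kinj _ _ AA AB); rewrite /B -{1}(addr0 A) => /addrI -[]; lra.
(* A value taken neither at [A] nor at [B], although these are the only points that the segment from
   [A] to [B] shares with the detour over [D]. *)
pose v := (k A + k B) / 2.
have [vA vB] : v <> k A /\ v <> k B by rewrite /v; split=> ?; apply: kAB; lra.
have [t t01 tv] : exists2 t, 0 <= t <= 1 & k (seg A B t) = v.
  by apply: ivt => //; rewrite ge_min le_max /v; have [] := leP (k A) (k B); lra.
have segAB : seg A B t = A + (t * r, 0).
  by rewrite /seg /B (addrAC A) subrr add0r; congr (_ + (_, _)); exact: mulr0.
have : (exists2 s, 0 <= s <= 1 & k (seg A D s) = v) \/ (exists2 s, 0 <= s <= 1 & k (seg D B s) = v).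
  have := between_midpoint (k A) (k B) (k D); rewrite -/v.
  by move=> /= [] hv; [left|right]; exact: ivt hv.
move=> [|] [s s01 sv].
  have E := kinj _ _ (sb _ _ _ s01 AA AD) (sb _ _ _ t01 AA AB) (etrans sv (esym tv)).
  have segAD : seg A D s = A + (0, s * r).
    by rewrite /seg /D (addrAC A) subrr add0r; congr (_ + (_, _)); exact: mulr0.
  move: E; rewrite segAB segAD => /addrI -[_ s0].
  by apply: vA; rewrite -sv segAD s0 addr0.
have E := kinj _ _ (sb _ _ _ s01 AD AB) (sb _ _ _ t01 AA AB) (etrans sv (esym tv)).
have segDB : seg D B s = A + (s * r, (1 - s) * r).
  by rewrite /seg /B /D; apply: injective_projections; rewrite /= /GRing.scale /=; ring.
move: E; rewrite segAB segDB => /addrI -[_ s0].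
have s1 : s = 1 by nra.
by apply: vB; rewrite -sv s1 seg1.
Qed.

End Surface.

(** * Following an arc along one of its sides *)

(* Trim each [D n] at its first point on [D n.+1]. *)
Lemma arc_telescope (R : realType) (S : topologicalType) (w : nat -> S) (D : nat -> set S) :
  hausdorff_space S -> (forall n, simple_arc R (w n) (w n.+1) (D n)) ->
  (forall n m, (n.+1 < m)%N -> D n `&` D m = set0) -> ~ D 1%N (w 0%N) ->
  exists x E, [/\ x 0%N = w 0%N, forall n, simple_arc R (x n) (x n.+1) (E n),
    forall n, E n `<=` D n & forall n, E n `&` E n.+1 `<=` [set x n.+1]].
Proof.
move=> hS aD DD nD1.
have wD n : D n.+1 (w n.+1) by exact: simple_arc_left (aD n.+1).
(* A point on [D n] but not on [D n.+1] is carried to one on [D n.+1] but not on [D n.+2]; the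
   latter holds because [D n] and [D n.+2] are disjoint. *)
have /choice[F FP] : forall nx : nat * S, exists yE : S * set S, D nx.1 nx.2 -> ~ D nx.1.+1 nx.2 ->
    [/\ D nx.1.+1 yE.1, ~ D nx.1.+2 yE.1, simple_arc R nx.2 yE.1 yE.2, yE.2 `<=` D nx.1 &
        yE.2 `&` D nx.1.+1 `<=` [set yE.1]].
  move=> [n x] /=; have [[Dx nDx]|h] := pselect (D n x /\ ~ D n.+1 x); last first.
    by exists (x, set0) => h1 h2; exfalso; apply: h.
  have xw : x <> w n.+1 by move=> E; apply: nDx; rewrite E.
  have [C [aC CD _]] := simple_arc_sub (aD n) Dx xw.
  have [y [E [Dy aE EC ED]]] := simple_arc_trim aC (simple_arc_closed hS (aD n.+1)) (wD n) nDx.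
  exists (y, E) => _ _; split=> //=.
    move=> D2y; have : (D n `&` D n.+2) y.
      by split=> //; apply: CD; apply: EC; exact: simple_arc_right aE.
    by rewrite DD.
  exact: subset_trans CD.
pose x := fix x n : S := if n is m.+1 then (F (m, x m)).1 else w 0%N.
have xD n : D n (x n) /\ ~ D n.+1 (x n).
  elim: n => [|n [h1 h2]] /=; first by split=> //; exact: simple_arc_left (aD 0%N).
  by have [] := FP (n, x n) h1 h2.
have xE n : [/\ D n.+1 (x n.+1), ~ D n.+2 (x n.+1), simple_arc R (x n) (x n.+1) (F (n, x n)).2,
     (F (n, x n)).2 `<=` D n & (F (n, x n)).2 `&` D n.+1 `<=` [set x n.+1]].
  by have [h1 h2] := xD n; exact: FP (n, x n) h1 h2.
exists x, (fun n => (F (n, x n)).2); split=> // n; [by have [] := xE n|by have [] := xE n|].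
move=> y [E1 E2]; have [_ _ _ _] := xE n; apply; split=> //.
by have [_ _ _ h _] := xE n.+1; exact: h.
Qed.

Lemma ratio01 (R : realType) (a b t : R) : a <= t <= b -> a < b ->
  0 <= (t - a) / (b - a) <= 1.
Proof.
move=> /andP[at1 tb] ab; have ba : 0 < b - a by rewrite subr_gt0.
by rewrite ler_pdivrMr // mul1r lerD2r tb andbT divr_ge0 ?subr_ge0 // ltW.
Qed.

Section Follow.
Variables (R : realType) (S : topologicalType).
Hypotheses (hS : hausdorff_space S) (kS : compact [set: S]) (lS : locally_planar R S).
Variable K : set S.
Hypothesis ndK : nowhere_dense_closed K.
Implicit Types (e : R -> S) (O F N V C : set S) (x y z p : S).

Lemma image_reverse e : (fun t => e (1 - t)) @` `[0, 1] = e @` `[0, 1].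
Proof.
apply/seteqP; split=> _ [t /= + <-]; rewrite in_itv /= => t01.
  by exists (1 - t) => //=; rewrite in_itv /=; lra.
by exists (1 - t); [rewrite /= in_itv /=; lra|rewrite opprB addrC subrK].
Qed.

Lemma injon_reverse e : injon e 0 1 -> injon (fun t => e (1 - t)) 0 1.
Proof.
move=> ie s t s01 t01 /ie E; have {}E : 1 - s = 1 - t by apply: E; lra.
lra.
Qed.

Lemma continuous_reverse e : continuous e -> continuous (fun t : R => e (1 - t)).
Proof.
move=> ce t; apply: continuous_comp; last exact: ce.
by apply: cvgB; [exact: cvg_cst|exact: cvg_id].
Qed.

Lemma image_closed e a b : continuous e -> closed (e @` `[a, b]).
Proof.
move=> ce; apply: compact_closed => //; apply: continuous_compact; last exact: segment_compact.
exact: continuous_subspaceT.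
Qed.

Lemma chart_open x O phi psi r r' : chart_at x O phi psi r -> r' <= r ->
  open (psi @` [set q : R * R | `|phi x - q| < r']).
Proof.
move=> [r0 _ _ h2] r'r; rewrite openE => _ [q /= qr <-]; apply: h2; first lra.
have := norm_ball_nbhs q (_ : 0 < r' - `|phi x - q|); rewrite subr_gt0 => /(_ qr).
apply: filterS => w /= qw; have := ler_normD (phi x - q) (q - w).
by rewrite addrA subrK; lra.
Qed.

Lemma dist_continuous (z : R * R) : continuous (fun p : R * R => `|z - p|).
Proof.
by move=> p; apply: cvg_norm; apply: cvgB; [exact: cvg_cst|exact: cvg_id].
Qed.

Lemma near_dist_gt (z p : R * R) (r : R) : r < `|z - p| -> \forall q \near p, r < `|z - q|.
Proof.
move=> rp; have n : nbhs `|z - p| [set t | r < t].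
  by apply: open_nbhs_nbhs; split=> //; exact: open_gt.
exact: (@dist_continuous z p _ n).
Qed.

Lemma near_dist_lt (z p : R * R) (r : R) : `|z - p| < r -> \forall q \near p, `|z - q| < r.
Proof.
move=> rp; have n : nbhs `|z - p| [set t | t < r].
  by apply: open_nbhs_nbhs; split=> //; exact: open_lt.
exact: (@dist_continuous z p _ n).
Qed.

Lemma cball_compact (z : R * R) (r : R) : compact [set p | `|z - p| <= r].
Proof.
apply: (@subclosed_compact _ _ (rect (z.1 - r) (z.1 + r) (z.2 - r) (z.2 + r))).
- have := @closed_comp _ _ (fun p : R * R => `|z - p|) [set t : R | t <= r] _ (@closed_le R r).
  by apply => p _; exact: dist_continuous.
- exact: rect_compact.
- move=> p /=; rewrite prod_normE ge_max /= !ler_norml /rect /= => /andP[h1 h2].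
  split; lra.
Qed.

(* If [F] adheres to [e r] but not to the point [e r'] shortly before it, then
   both sides of the arc at [e r] belong to [F]: walk around through the gap at
   [e r']. *)
Lemma gap_both_sides e O F (r r' d : R) (phi : S -> R * R) (psi : R * R -> S) (rho : R) :
  continuous e -> injon e 0 1 -> e @` `[0, 1] `<=` K -> open F -> F `<=` ~` K ->
  (forall x, O x -> closure F x -> F x \/ K x) -> O `&` K `<=` e @` `[0, 1] ->
  chart_at (e r) O phi psi rho ->
  0 < d -> 0 <= r - d -> r + d <= 1 ->
  (forall t, r - d <= t <= r + d -> (psi @` [set q | `|phi (e r) - q| < rho]) (e t)) ->
  r - d <= r' -> r' < r -> closure F (e r) -> ~ closure F (e r') ->
  exists2 k, 0 < k <= rho &
    forall q, `|phi (e r) - q| < k -> ~ K (psi q) -> F (psi q).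
Proof.
move=> ce ie eK oF FK clF OK ch d0 rd0 rd1 ed rdr' r'r cF ncF.
have [rho0 psix h1 _] := ch; set z0 := phi (e r).
have ge t : r - d <= t <= r + d -> `|z0 - phi (e t)| < rho /\ psi (phi (e t)) = e t.
  by move=> /ed[q /= qr <-]; have [_ -> _ _] := h1 q (ltW qr).
have [eta eta0 heta] : exists2 eta, 0 < eta & forall t, r' - eta < t < r' + eta -> ~ closure F (e t).
  have n1 : \forall t \near r', ~ closure F (e t).
    exact: (ce r' _ (near_not (@closed_closure _ F) ncF)).
  move/nbhs_ballP : n1 => [eta /= eta0 h]; exists eta => // t tr; apply: h.
  by rewrite /ball /= ltr_norml; lra.
(* The arc without its part over []r' - eta, r + d[]. Adding the rim of the chart to it yields [Y],
   which meets the piece over [[r', r + d]] at most in [e (r + d)], as [arc_nonseparating] requires.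
   The parameters between [r' - eta] and [r'] are left open as the gap. *)
pose E := e @` `[0, r' - eta] `|` e @` `[r + d, 1].
have cE : closed E by apply: closedU; exact: image_closed.
pose Y := [set p : R * R | `|z0 - p| = rho] `|` [set p | `|z0 - p| <= rho /\ E (psi p)].
have cnorm := @dist_continuous z0.
have kY : compact Y.
  apply: (@subclosed_compact _ _ [set p | `|z0 - p| <= rho]); [|exact: cball_compact|].
    apply: closedU.
      by apply: (@closed_comp _ _ (fun p : R * R => `|z0 - p|) [set t : R | t = rho]) => //; exact: closed_eq.
    rewrite -[X in closed X]setCK; apply: open_closedC.
    rewrite openE => p np; rewrite /interior.
    have [pr|pr] := leP `|z0 - p| rho; last first.
      by apply: filterS (near_dist_gt pr) => q /= h [h' _]; lra.
    have nE : ~ E (psi p) by move=> Ep; apply: np.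
    have [_ _ cp _] := h1 p pr.
    have n1 : \forall q \near p, ~ E (psi q) by exact: (cp _ (near_not cE nE)).
    by apply: filterS n1 => q h [].
  by move=> p [/= ->|[]].
have er0 : 0 <= r <= 1 by lra.
have nYz0 : ~ Y z0.
  move=> [/= |[_ +]]; first by rewrite subrr normr0; lra.
  rewrite psix => -[] [t /=]; rewrite in_itv /= => th /ie E'.
    by have : t = r by [apply: E'; lra]; lra.
  by have : t = r by [apply: E'; lra]; lra.
have cY := compact_closed (@plane_hausdorff R) kY.
have [k0 k00 hk0] := nbhs_norm_ball (near_not cY nYz0).
(* A ball of this radius misses [Y], so that any two of its points are joined off [Y]. *)
pose k := Num.min k0 rho.
have kk0 : k <= k0 by rewrite /k ge_min lexx.
have kr : k <= rho by rewrite /k ge_min lexx orbT.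
have k_gt0 : 0 < k by rewrite /k lt_min k00.
exists k; first by rewrite k_gt0.
move=> q qk nKq.
have [y [Fp [p pk py]]] := cF _ (chart_nbhs ch k_gt0); rewrite -py in Fp.
clear y py.
rewrite -/z0 /= in pk.
have nKp : ~ K (psi p) by exact: FK.
pose L := r + d - r'.
have rrd : r < r + d by rewrite ltrDl.
have L0 : 0 < L by rewrite /L; lra.
(* The clamp keeps [g] inside the chart for every real [t], hence continuous on the whole line. *)
pose tau t := r' + clamp t * L.
have tauP t : r' <= tau t <= r + d.
  by have := clamp01 t; rewrite /tau; have : L = r + d - r' by []; nra.
have tau01 t : 0 <= t <= 1 -> tau t = r' + t * L by move=> t01; rewrite /tau clamp_id.
pose g t := phi (e (tau t)).
have gE t : `|z0 - g t| < rho /\ psi (g t) = e (tau t).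
  by apply: ge; have := tauP t; lra.
have cg : continuous g.
  move=> t; apply: (@continuous_comp _ _ _ (fun t => e (tau t)) phi).
    apply: continuous_comp; last exact: ce.
    apply: cvgD; first exact: cvg_cst.
    by apply: cvgM; [exact: clamp_continuous|exact: cvg_cst].
  have [gr <-] := gE t; by have [] := h1 _ (ltW gr).
have ig : injon g 0 1.
  move=> s t s01 t01 E'; have : e (tau s) = e (tau t).
    by have [_ <-] := gE s; have [_ <-] := gE t; rewrite E'.
  move=> /ie {}E'; have := tauP s; have := tauP t => h h'.
  have {}E' : tau s = tau t by apply: E'; lra.
  move: E'; rewrite !tau01 // => /addrI /mulIf; apply; by rewrite gt_eqF.
have nX q' : ~ K (psi q') -> ~ (g @` `[0, 1]) q'.
  move=> nK [t _ tq]; apply: nK; rewrite -tq; have [_ ->] := gE t; apply: eK.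
  by exists (tau t) => //=; rewrite in_itv /=; have := tauP t; lra.
have nYk q' : `|z0 - q'| < k -> ~ Y q' by move=> h; apply: hk0 => /=; lra.
have aY : arcc R (~` Y) p q.
  by apply: arcc_sub (arcc_ball pk qk) => w /= /nYk.
have XY : g @` `[0, 1] `&` Y `<=` [set g 1].
  move=> _ [[t /= + <-]]; rewrite in_itv /= => t01 [/= |[_]].
    by have [+ _] := gE t => /[swap] ->; rewrite ltxx.
  have [_ ->] := gE t; have tt := tauP t => -[] [s /=]; rewrite in_itv /= => s01 /ie E'.
    by exfalso; have : s = tau t by [apply: E'; lra]; lra.
  have {}E' : s = tau t by apply: E'; lra.
  have tE : t = 1.
    have : tau t = r + d by lra.
    rewrite tau01 // => h; have : t * L = 1 * L by rewrite /L in h *; lra.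
    by move/mulIf; apply; rewrite gt_eqF.
  by rewrite tE.
have := arc_nonseparating ler01 cg ig kY XY (nX _ nKp) (nX _ nKq) (nYk _ pk) (nYk _ qk) aY.
have nXYp : (~` (g @` `[0, 1] `|` Y)) p by move=> [|]; [exact: nX|exact: nYk].
move=> /(arcc_connected nXYp)[C cC [Cp Cq CXY]].
have Cball w : C w -> `|z0 - w| < rho.
  move=> Cw; apply: (@connected_locconst _ C [set w | `|z0 - w| < rho] p) => //=; last lra.
  move=> u Cu; have nu : `|z0 - u| != rho.
    by apply/eqP => ur; apply: (CXY u Cu); right; left.
  have [ur|ur|/eqP] := ltgtP `|z0 - u| rho; last by rewrite (negbTE nu).
    by apply: filterS (near_dist_lt ur) => v h _ /=; rewrite h.
  by apply: filterS (near_dist_gt ur) => v h _ /=; split; lra.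
(* [C] meets the drawing only in the gap, where [F] does not adhere; elsewhere on [C] an adherent
   point belongs to [F]. So membership in [F] does not change along [C]. *)
apply: (@connected_locconst _ C [set w | F (psi w)] p) => //= w Cw.
have [Ow phw cw _] := h1 w (ltW (Cball w Cw)).
have [Fw|nFw] := pselect (F (psi w)).
  have n1 : \forall v \near w, F (psi v) by apply: (cw F); exact: open_nbhs_nbhs.
  by apply: filterS n1.
have ncw : ~ closure F (psi w).
  move=> clw; have [//|Kw] := clF _ Ow clw.
  have [t /=] : (e @` `[0, 1]) (psi w) by exact: OK.
  rewrite in_itv /= => t01 tw.
  have nXw : ~ (g @` `[0, 1]) w by move=> h; apply: (CXY w Cw); left.
  have nEw : ~ E (psi w).
    by move=> h; apply: (CXY w Cw); right; right; split=> //; apply: ltW; exact: Cball.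
  have [h|h] := leP t (r' - eta).
    by apply: nEw; left; exists t => //=; rewrite in_itv /=; lra.
  have [h'|h'] := leP (r + d) t.
    by apply: nEw; right; exists t => //=; rewrite in_itv /=; lra.
  have [h2|h2] := leP r' t.
    have hr : 0 <= (t - r') / L <= 1.
      by apply: ratio01; [rewrite h2 ltW|exact: lt_trans r'r rrd].
    apply: nXw; exists ((t - r') / L); first by rewrite /= in_itv.
    rewrite /g tau01 //.
    by rewrite divfK ?gt_eqF // addrC subrK tw phw.
  by apply: (heta t); [lra|rewrite tw].
have n1 : \forall v \near w, ~ closure F (psi v).
  exact: (cw _ (near_not (@closed_closure _ F) ncw)).
apply: filterS n1 => v h _; split=> // Fv; exfalso; apply: h; exact: subset_closure.
Qed.

Section Arc.
Variable e : R -> S.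
Hypotheses (ce : continuous e) (ie : injon e 0 1) (eK : e @` `[0, 1] `<=` K).
Hypothesis eN : forall t, 0 < t < 1 -> exists N, [/\ open N, N (e t) & N `&` K `<=` e @` `[0, 1]].

(** Unless [F] adheres to the arc all around [e r], there is a gap close by; then [gap_both_sides]
    puts every nearby point off [K] into [F], and such points are dense. *)
Lemma adherence_open O F (r : R) : 0 < r < 1 -> open O -> O (e r) -> open F -> F `<=` ~` K ->
  (forall x, O x -> closure F x -> F x \/ K x) -> closure F (e r) ->
  \forall t \near r, closure F (e t).
Proof.
move=> r01 oO Oe oF FK clF cF; have [N [oN Ne NK]] := eN r01.
have [phi [psi [rho ch]]] := chart_exists lS (openI oO oN) (conj Oe Ne).
have [rho0 psix h1 _] := ch.
have clF' x : (O `&` N) x -> closure F x -> F x \/ K x by move=> [Ox _]; exact: clF.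
have ONK : (O `&` N) `&` K `<=` e @` `[0, 1] by move=> x [[_ Nx] Kx]; exact: NK.
have n0 : \forall t \near r, (psi @` [set q | `|phi (e r) - q| < rho]) (e t).
  exact: (ce (chart_nbhs ch rho0)).
have /nbhs_ballP[d0 /= d00 hd] := n0.
pose d := Num.min (d0 / 2) (Num.min r (1 - r)).
have [dd0 dr d1r] : [/\ d <= d0 / 2, d <= r & d <= 1 - r].
  by rewrite /d !ge_min !lexx !orbT.
have d_gt0 : 0 < d by rewrite /d !lt_min; lra.
have ed t : r - d <= t <= r + d -> (psi @` [set q | `|phi (e r) - q| < rho]) (e t).
  by move=> h; apply: hd; rewrite /ball /= ltr_norml; lra.
have [all|] := pselect (forall t, r - d <= t <= r + d -> closure F (e t)).
  apply/nbhs_ballP; exists d => //= t; rewrite /ball /= ltr_norml => h; apply: all; lra.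
move=> /existsNP[r' /not_implyP[r'd ncF]].
suff [k /andP[k0 kr] hk] : exists2 k, 0 < k <= rho &
    forall q, `|phi (e r) - q| < k -> ~ K (psi q) -> F (psi q).
  have n1 : \forall t \near r, (psi @` [set q | `|phi (e r) - q| < k]) (e t).
    exact: (ce (chart_nbhs ch k0)).
  apply: filterS n1 => t et V /nbhs_interior nV.
  have [||z [Vz [q qk qz]] nKz] := ndK.2 (V°%classic `&` psi @` [set q | `|phi (e r) - q| < k]).
    by apply: openI; [exact: open_interior|exact: chart_open ch kr].
  - by exists (e t); split=> //; exact: nbhs_singleton nV.
  - by exists z; split; [rewrite -qz; apply: hk => //; rewrite qz|exact: nbhs_singleton Vz].
have r'r : r' != r by apply: contra_notN ncF => /eqP ->.
have [lt|gt|/eqP] := ltgtP r' r; last by rewrite (negbTE r'r).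
  apply: (@gap_both_sides e (O `&` N) F r r' d) => //; lra.
have rr (u : R) : 1 - (1 - u) = u by ring.
(* A gap after [r] is a gap before [1 - r] on the reversed arc. *)
have := @gap_both_sides (fun t => e (1 - t)) (O `&` N) F (1 - r) (1 - r') d phi psi rho.
rewrite /= !rr; apply => //.
- exact: continuous_reverse.
- exact: injon_reverse.
- by rewrite image_reverse.
- by rewrite image_reverse.
- lra.
- lra.
- by move=> t td; apply: ed; lra.
- lra.
- lra.
Qed.

(** The parameters of adherence form a set that is closed by continuity of [e] and open by
    [adherence_open]. *)
Lemma adherence_follow O F (s t : R) : 0 < s -> s <= t -> t < 1 -> open O ->
  (forall u, s <= u <= t -> O (e u)) -> open F -> F `<=` ~` K ->
  (forall x, O x -> closure F x -> F x \/ K x) -> closure F (e s) -> closure F (e t).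
Proof.
move=> s0 st t1 oO Oe oF FK clF.
pose P (x y : R) := closure F (e x) -> closure F (e y).
suff : P s t by [].
apply: interval_induction => //; rewrite /P.
  by move=> x y z _ _ _ _ h1 h2 /h1 /h2.
move=> x xst; have [cx|ncx] := pselect (closure F (e x)).
  have := @adherence_open O F x; rewrite (le_lt_trans _ t1) ?(lt_le_trans s0); [|lra|lra].
  move=> /(_ isT oO (Oe x xst) oF FK clF cx) /nbhs_ballP[d /= d0 hd].
  exists d => // y z sy yx xz zt xdy zxd _; apply: hd.
  by rewrite /ball /= ltr_norml; lra.
have n1 : \forall t \near x, ~ closure F (e t).
  exact: (ce (near_not (@closed_closure _ F) ncx)).
move/nbhs_ballP : n1 => [d /= d0 hd]; exists d => // y z sy yx xz zt xdy zxd cy; exfalso.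
by apply: (hd y) => //; rewrite /ball /= ltr_norml; lra.
Qed.

End Arc.

(** [x] itself may be inaccessible from [F]. An arc in a chart from a nearby point of [F] to [x] is
    cut at its first point of [K], which is accessible and still in [O]. *)
Lemma access_near F O x : F `<=` ~` K -> closure F x -> K x -> open O -> O x ->
  exists p z C, [/\ F p, K z, O z, simple_arc R p z C & C `<=` O /\ C `&` K `<=` [set z]].
Proof.
move=> FK cF Kx oO Ox; have [phi [psi [r ch]]] := chart_exists lS oO Ox.
have [r0 psix h1 _] := ch.
have [y [Fp [q qr qy]]] := cF _ (chart_nbhs ch r0); rewrite -qy in Fp.
have nKp : ~ K (psi q) by exact: FK.
have sub : [set p : R * R | `|phi x - p| < r] `<=` [set p | `|phi x - p| <= r] by move=> p /= /ltW.
have := chart_arcc ch sub (arcc_ball qr (_ : `|phi x - phi x| < r)).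
rewrite subrr normr0 => /(_ r0); rewrite psix => -[E|[C aC Cr]]; first by rewrite E in nKp.
have [z [C' [Kz aC' CC CK]]] := simple_arc_trim aC ndK.1 Kx nKp.
have CO : C' `<=` O.
  by move=> u /CC /Cr[w wr <-]; have [] := h1 w (ltW wr).
exists (psi q), z, C'; split=> //; apply: CO; exact: simple_arc_right aC'.
Qed.

End Follow.

(** * Walking along an arc off a closed nowhere dense set *)

Section Access.
Variables (R : realType) (S : topologicalType).
Hypotheses (hS : hausdorff_space S) (kS : compact [set: S]) (lS : locally_planar R S).
Variable K : set S.
Hypothesis ndK : nowhere_dense_closed K.
Implicit Types (O F N V C : set S) (x y z p w : S).

Lemma near_end p x C O : simple_arc R p x C -> open O -> O x ->
  exists w, [/\ C w, w <> x, O w & exists2 D, simple_arc R w x D & D `<=` C `&` O].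
Proof.
move=> /simple_arcP[f [cf inf _ <- ->]] oO O1.
have n1 : \forall t \near (1 : R), O (f t) by apply: (cf 1 O); exact: open_nbhs_nbhs.
have /nbhs_ballP[d /= d0 hd] := n1.
pose u := Num.max 0 (1 - d / 2).
have [u0 ud u1] : [/\ 0 <= u, 1 - d / 2 <= u & u < 1].
  by rewrite /u !le_max !lexx orbT gt_max ltr01; split=> //=; lra.
have sub : f @` `[u, 1] `<=` f @` `[0, 1] `&` O.
  move=> _ [t /= + <-]; rewrite in_itv /= => tu; split.
    by exists t => //=; rewrite in_itv /=; lra.
  by apply: hd; rewrite /ball /= ltr_norml; lra.
have fu : (f @` `[0, 1] `&` O) (f u).
  by apply: sub; exists u => //=; rewrite in_itv /=; lra.
exists (f u); split; [exact: fu.1| |exact: fu.2|].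
  by move=> /inf E; have : u = 1 by [apply: E; lra]; lra.
by exists (f @` `[u, 1]) => //; apply: simple_arc_sub_right => //; lra.
Qed.

Lemma access_component p x C O w : simple_arc R p x C -> C `&` K `<=` [set x] -> C `<=` O ->
  C w -> w <> x -> arcc R (O `\` K) p w.
Proof.
move=> aC CK CO Cw wx; have [->|wp] := pselect (w = p); first exact: arcc_refl.
have [D [aD DC nx]] := simple_arc_sub (simple_arc_sym aC) Cw wp.
apply: arcc_sym; right; exists D => // y Dy; split; first exact/CO/DC.
by move=> Ky; apply: (nx wx); rewrite -(CK y) //; split=> //; exact: DC.
Qed.

Variable e : R -> S.
Hypotheses (ce : continuous e) (ie : injon e 0 1) (eK : e @` `[0, 1] `<=` K).
Hypothesis eN : forall t, 0 < t < 1 -> exists N, [/\ open N, N (e t) & N `&` K `<=` e @` `[0, 1]].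
Variable h : S -> R.
Hypotheses (ch : continuous h) (he : forall t, 0 <= t <= 1 -> h (e t) = t).

(* A state (t, p, C) of the walk: the arc [C] leads from [p] to [e t] off [K].
   *)
Definition access (s : R * S * set S) :=
  simple_arc R s.1.2 (e s.1.1) s.2 /\ s.2 `&` K `<=` [set e s.1.1].

(** The end of the current access arc lies in one arc component [F] of [O] off [K]. Adherence of [F]
    is carried from the current parameter to [t], and a new access arc is found from [F] near [e t];
    the old and the new one are thus joined within [O] off [K]. *)
Lemma access_step (s : R * S * set S) O (t : R) (a b : R) : access s -> 0 < s.1.1 -> s.1.1 <= t -> t < 1 ->
  0 <= a -> a < t -> t < b -> b <= 1 -> open O -> (forall u, s.1.1 <= u <= t -> O (e u)) ->
  exists s', [/\ access s', a < s'.1.1 < b, s'.2 `<=` O &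
    exists w, [/\ s.2 w, w <> e s.1.1, O w & arcc R (O `\` K) w s'.1.2]].
Proof.
move: s => [[t0 p] C] /= [/= aC CK] t00 t0t t1 a0 at' tb b1 oO Oe.
have Oe0 : O (e t0) by apply: Oe; rewrite lexx.
have [w [Cw we Ow [D aD DCO]]] := near_end aC oO Oe0.
have nKw : ~ K w by move=> Kw; apply: we; exact: CK.
have oOK : open (O `\` K) by apply: openI => //; exact: closed_openC ndK.1.
pose F := [set y | arcc R (O `\` K) w y].
have FOK y : F y -> (O `\` K) y.
  by move=> [<-//|[E aE EO]]; apply: EO; exact: simple_arc_right aE.
have oF : open F.
  rewrite openE => y Fy; rewrite /interior.
  by apply: filterS (near_arcc hS lS w oOK (FOK y Fy)) => z [_]; apply.
have FK : F `<=` ~` K by move=> y /FOK[].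
have clF x : O x -> closure F x -> F x \/ K x.
  move=> Ox cx; have [Kx|nKx] := pselect (K x); [by right|left].
  have [y [Fy]] := cx _ (near_arcc hS lS w oOK (conj Ox nKx)).
  by move=> [+ _]; apply.
have cF0 : closure F (e t0).
  move=> V nV; have [U oU [Ue UV]] : exists2 U, open U & U (e t0) /\ U `<=` V.
    exists V°%classic; first exact: open_interior.
    by split; [exact: nbhs_singleton (nbhs_interior nV)|exact: interior_subset].
  have [y [Dy ye Uy _]] := near_end aD oU Ue.
  exists y; split; last exact: UV.
  apply: (access_component aD) => //; last by move=> u /DCO[].
  by move=> u [/DCO[Cu _] Ku]; exact: CK.
have cF : closure F (e t).
  by apply: (adherence_follow hS lS ndK ce ie eK eN t00 t0t t1 oO Oe oF FK clF).
have t01 : 0 < t < 1 by rewrite t1 (lt_le_trans t00).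
have [N [oN Nt NK]] := eN t01.
(* The condition on [h] forces the parameter of the new access point into []a, b[]. *)
pose O' := O `&` N `&` (h @^-1` [set u | a < u < b]).
have oO' : open O'.
  apply: openI; first exact: openI.
  apply: open_comp; first by move=> ? _; exact: ch.
  rewrite (_ : [set u | a < u < b] = [set u | a < u] `&` [set u | u < b]).
    by apply: openI; [exact: open_gt|exact: open_lt].
  by apply/seteqP; split=> u /=; [move=> /andP[]|move=> [-> ->]].
have O't : O' (e t).
  split; first by split=> //; apply: Oe; rewrite t0t lexx.
  by rewrite /= he; [rewrite at' tb|lra].
have Kt : K (e t) by apply: eK; exists t => //=; rewrite in_itv /=; lra.
have [q [z [C' [Fq Kz [[Oz Nz] hz] aC' [C'O C'K]]]]] := access_near lS ndK FK cF Kt oO' O't.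
have [t' /= + t'z] := NK z (conj Nz Kz); rewrite in_itv /= => t'01.
have ht' : h z = t' by rewrite -t'z he.
exists ((t', q), C'); split=> //=.
- by split=> /=; rewrite t'z.
- by rewrite -ht'.
- by move=> y /C'O[[]].
- by exists w.
Qed.

Lemma basis_at x : exists B : nat -> set S, [/\ forall n, open (B n), forall n, B n x,
    forall n, B n.+1 `<=` B n & forall V, nbhs x V -> exists n, B n `<=` V].
Proof.
have [phi [psi [r cx]]] := chart_exists lS (@openT S) (I : [set: S] x).
have [r0 psix h1 _] := cx.
have rn n : r / n.+1%:R <= r by rewrite ler_pdivrMr ?ltr0n // ler_peMr ?ler1n // ltW.
have rn0 n : 0 < r / n.+1%:R by rewrite divr_gt0.
exists (fun n => psi @` [set q | `|phi x - q| < r / n.+1%:R]); split.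
- by move=> n; exact: chart_open cx (rn n).
- by move=> n; exists (phi x) => //=; rewrite subrr normr0.
- move=> n; apply: image_subset => q /= qn; apply: lt_le_trans qn _.
  by rewrite ler_pM2l // lef_pV2 ?posrE ?ltr0n // ler_nat.
- move=> V nV; have [|_ _ cp _] := h1 (phi x); first by rewrite subrr normr0 ltW.
  have nV' : nbhs (psi (phi x)) V by rewrite psix.
  have [d d0 dV] := nbhs_norm_ball (cp V nV').
  exists (Num.truncn (r / d)) => _ [q /= qr <-]; apply: dV => /=.
  apply: lt_trans qr _; rewrite ltr_pdivrMr ?ltr0n // mulrC -ltr_pdivrMr //.
  exact: truncnS_gt.
Qed.

(* The walk proceeds through neighbourhoods [O n] of [e] on ]a n, a n.+2[ that
   shrink to [e 1]; [O n] and [O m] are disjoint if [n.+1 < m], so the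
   infinitely many pieces of the walk form an arc ending in [e 1]. *)
Lemma follow_to_end (s : R * S * set S) : access s -> 0 < s.1.1 < 1 ->
  arcc R (~` K `|` [set e 1]) s.1.2 (e 1).
Proof.
move: s => [[t0 p0] C0]; set s0 := (t0, p0, C0) => acc0 /= /andP[t00 t01].
set b := e 1.
have [B0 [oB0 B0b B0S B0V]] := basis_at b.
(* The start [t0] may be far from the end of the arc, so stage 0 has to contain the arc over all of
   []0, a 2[]; its neighbourhood is the whole space. *)
pose B n := if n is m.+1 then B0 m else setT.
have oB n : open (B n) by case: n => [|n]; [exact: openT|exact: oB0].
have BS n : B n.+1 `<=` B n by case: n => [|n] //=; exact: B0S.
have Bmono n m : (n <= m)%N -> B m `<=` B n.
  move=> nm; elim: m nm => [|m IH]; first by rewrite leqn0 => /eqP ->.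
  rewrite leq_eqVlt ltnS => /orP[/eqP -> //|/IH]; exact: subset_trans.
have /choice[al alP] : forall n, exists a : R, a < 1 /\ forall u, a < u <= 1 -> B n (e u).
  move=> n; have n1 : \forall t \near (1 : R), B n (e t).
    apply: (ce (_ : nbhs (e 1) (B n))); apply: open_nbhs_nbhs; split; first exact: oB.
    by case: n => [|n] //; exact: B0b.
  have /nbhs_ballP[d /= d0 hd] := n1; exists (1 - d); split; first lra.
  by move=> u u1; apply: hd; rewrite /ball /= ltr_norml; lra.
(* Halfway from a maximum to 1: exceeding the previous value makes [a] increase, exceeding [t0] puts
   the start into []a 0, a 1[], and exceeding [al n] keeps the arc beyond [a n] in [B n]. *)
pose a := fix a n : R := if n is m.+1 then (1 + Num.max (Num.max (a m) t0) (al n)) / 2 else 0.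
have aS n : [/\ 0 <= a n < 1, a n < a n.+1 < 1, t0 < a n.+1 & al n.+1 < a n.+1].
  have al1 := (alP n.+1).1.
  have : a n < 1 -> [/\ a n < a n.+1, t0 < a n.+1, al n.+1 < a n.+1 & a n.+1 < 1].
    move=> an1; have -> : a n.+1 = (1 + Num.max (Num.max (a n) t0) (al n.+1)) / 2 by [].
    set m := Num.max _ _; have : m < 1 by rewrite /m !gt_max an1 t01 al1.
    have [h1 h2 h3] : [/\ a n <= m, t0 <= m & al n.+1 <= m].
      by rewrite /m !le_max !lexx !orbT.
    by split; lra.
  suff : 0 <= a n < 1 by move=> /[dup] /andP[_ an1] an01 /(_ an1)[h1 h2 h3 h4]; split=> //; rewrite h1.
  elim: n {al1} => [|n /andP[an0 an1]]; first by rewrite /= lexx ltr01.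
  have -> : a n.+1 = (1 + Num.max (Num.max (a n) t0) (al n.+1)) / 2 by [].
  set m := Num.max _ _; have : m < 1 by rewrite /m !gt_max an1 t01 (alP n.+1).1.
  have : a n <= m by rewrite /m !le_max lexx.
  lra.
have amono n m : (n <= m)%N -> a n <= a m.
  move=> nm; elim: m nm => [|m IH]; first by rewrite leqn0 => /eqP ->.
  rewrite leq_eqVlt ltnS => /orP[/eqP -> //|/IH]; have [_ /andP[] + _ _ _] := aS m; lra.
pose O n := h @^-1` [set u | a n < u < a n.+2] `&` B n.
have oO n : open (O n).
  apply: openI => //; apply: open_comp; first by move=> ? _; exact: ch.
  rewrite (_ : [set u | a n < u < a n.+2] = [set u | a n < u] `&` [set u | u < a n.+2]).
    by apply: openI; [exact: open_gt|exact: open_lt].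
  by apply/seteqP; split=> u /=; [move=> /andP[]|move=> [-> ->]].
have OO n m : (n.+1 < m)%N -> O n `&` O m = set0.
  move=> /amono nm; apply/seteqP; split=> // x [[/andP[_ h1] _] [/andP[h2 _] _]].
  by have := lt_le_trans (lt_trans h2 h1) nm; rewrite ltxx.
have Oe n u : a n < u < a n.+2 -> O n (e u).
  move=> au; have [a01 _ _ _] := aS n; have [a21 _ _ _] := aS n.+2.
  split; first by rewrite /preimage /mkset he //; lra.
  case: n au a01 a21 => [//|n] au a01 a21; apply: (alP n.+1).2; have [_ _ _] := aS n; lra.
pose inv n (s : R * S * set S) := access s /\ a n < s.1.1 < a n.+1.
pose rel n (s s' : R * S * set S) := s'.2 `<=` O n /\
  exists w, [/\ s.2 w, w <> e s.1.1, O n w & arcc R (O n `\` K) w s'.1.2].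
have /choice[nxt nxtP] : forall ns : nat * (R * S * set S), exists s',
    inv ns.1 ns.2 -> inv ns.1.+1 s' /\ rel ns.1 ns.2 s'.
  move=> [n s] /=; have [[acc sa]|ni] := pselect (inv n s); last by exists s.
  have [a01 _ _ _] := aS n; have [a11 a12 _ _] := aS n.+1; have [a21 _ _ _] := aS n.+2.
  pose t := (a n.+1 + a n.+2) / 2.
  have [tl tu] : a n.+1 < t /\ t < a n.+2 by rewrite /t; split; lra.
  have Os u : s.1.1 <= u <= t -> O n (e u) by move=> su; apply: Oe; lra.
  have [h0 h1 h2] : [/\ 0 < s.1.1, s.1.1 <= t & t < 1] by split; lra.
  have [h3 h4] : 0 <= a n.+1 /\ a n.+2 <= 1 by split; lra.
  have [s' [acc' s'a s'O s'w]] := access_step acc h0 h1 h2 h3 tl tu h4 (oO n) Os.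
  by exists s' => _.
pose st := fix st n := if n is m.+1 then nxt (m, st m) else s0.
have stP n : inv n (st n).
  elim: n => [|n IH]; last by have [] := nxtP (n, st n) IH.
  by split=> //=; rewrite t00; have [_ _ + _] := aS 0%N.
have stR n : rel n (st n) (st n.+1) by have [] := nxtP (n, st n) (stP n).
have /choice[w wP] : forall n, exists w, [/\ (st n).2 w, w <> e (st n).1.1, O n w &
    arcc R (O n `\` K) w (st n.+1).1.2].
  by move=> n; have [_] := stR n.
have nKw n : ~ K (w n).
  by move=> Kw; have [[_ h1] _] := stP n; have [h2 h3 _ _] := wP n; apply: h3; exact: h1.
have ww n : arcc R (O n `\` K) (w n) (w n.+1).
  have [_ _ _ h1] := wP n; have [h2 h3 _ _] := wP n.+1.
  have [[aC CK] _] := stP n.+1; have [CO _] := stR n.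
  exact: (arcc_trans hS) h1 (access_component aC CK CO h2 h3).
have wO n : O n (w n.+1).
  by have [h2 _ _ _] := wP n.+1; have [CO _] := stR n; exact: CO.
have wO' n : O n (w n) by have [] := wP n.
(* [w n.+1] also lies in the preceding stage [O n], which is disjoint from [O n.+2]. [w 0] has no
   preceding stage, so the sequence of arcs starts at [w 1], and [w 0] is joined to it
   separately. *)
have wneq n : w n.+1 <> w n.+2.
  move=> E; have : (O n `&` O n.+2) (w n.+1) by split; [exact: wO|rewrite E; exact: wO'].
  by rewrite OO.
have /choice[D DP] : forall n, exists D, simple_arc R (w n.+1) (w n.+2) D /\ D `<=` O n.+1 `\` K.
  by move=> n; have [/wneq//|[D aD DO]] := ww n.+1; exists D.
have aD n : simple_arc R (w n.+1) (w n.+2) (D n) by have [] := DP n.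
have DO n : D n `<=` O n.+1 `\` K by have [] := DP n.
have DD n m : (n.+1 < m)%N -> D n `&` D m = set0.
  move=> nm; apply/seteqP; split=> // y [/DO[Oy _] /DO[Oy' _]].
  by have : (O n.+1 `&` O m.+1) y by []; rewrite OO.
have nD : ~ D 1%N (w 1%N).
  move=> /DO[Oy _]; have : (O 0%N `&` O 2%N) (w 1%N) by split=> //; exact: wO.
  by rewrite OO.
have [x [E [x0 aE ED EE]]] := arc_telescope hS aD DD nD.
have Kb : K b by apply: eK; exists 1 => //=; rewrite in_itv /= ler01 lexx.
have aw : simple_arc R (w 1%N) b (b |` \bigcup_n E n).
  rewrite -x0; apply: arc_sequence => //.
  - move=> n m nm; apply/seteqP; split=> // y [/ED Dy /ED Dy'].
    by have : (D n `&` D m) y by []; rewrite DD.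
  - by move=> n /ED /DO[_ /(_ Kb)].
  - move=> V nV; have [n nB] := B0V V nV; exists n => m nm y /ED /DO[[_ By] _].
    by apply: nB; apply: (Bmono n.+1 m.+1) => //; rewrite ltnS.
have sub1 n : O n `\` K `<=` ~` K `|` [set b] by move=> y [_ nK]; left.
apply: (arcc_trans hS) (_ : arcc _ _ _ (w 0%N)) _.
  apply: (@arcc_sub _ _ (setT `\` K)); first by move=> y [_ nK]; left.
  have [[aC CK] _] := stP 0%N; have [h2 h3 _ _] := wP 0%N.
  exact: access_component aC CK _ h2 h3.
apply: (arcc_trans hS) (arcc_sub (@sub1 0%N) (ww 0%N)) _.
right; exists (b |` \bigcup_n E n) => // y [->|[n _ /ED /DO[_ nK]]]; [by right|by left].
Qed.

End Access.

Section FollowEdge.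
Variables (R : realType) (S : topologicalType).
Hypotheses (hS : hausdorff_space S) (kS : compact [set: S]) (lS : locally_planar R S).

(** Away from its ends, [A] is locally all of [K], as an edge is of a drawing; a small chart there
    sees nothing but [A]. Reversing [A] gives the same for its other end. *)
Lemma follow_edge (K C A : set S) (x y z p : S) : nowhere_dense_closed K ->
  simple_arc R x y A -> A `<=` K ->
  (forall u, A u -> u <> x -> u <> y -> exists N, [/\ open N, N u & N `&` K `<=` A]) ->
  A z -> z <> x -> z <> y -> simple_arc R p z C -> C `&` K `<=` [set z] ->
  arcc R (~` K `|` [set y]) p y.
Proof.
move=> ndK /simple_arcP[e [ce ie <- <- ->]] eK eN [t /= + <-] tx ty aC CK.
rewrite in_itv /= => t01.
have [h ch he] := arc_coordinate hS kS ce ie.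
have t01' : 0 < t < 1.
  rewrite !lt_neqAle; move: t01 => /andP[-> ->]; rewrite !andbT; apply/andP; split.
    by apply: contra_notN tx => /eqP ->.
  by apply: contra_notN ty => /eqP ->.
have := @follow_to_end R S hS lS K ndK e ce ie eK _ h ch he (t, p, C); apply => //.
move=> u u01; apply: eN.
- by exists u => //=; rewrite in_itv /=; lra.
- by move=> /ie E; have : u = 0 by [apply: E; lra]; lra.
- by move=> /ie E; have : u = 1 by [apply: E; lra]; lra.
Qed.

End FollowEdge.

(** * Spanning trees *)

Lemma set2_eq (T : finType) (a b c d : T) : c != d -> [set a; b]%SET = [set c; d]%SET ->
  (a = c /\ b = d) \/ (a = d /\ b = c).
Proof.
move=> cd E.
have : a \in [set c; d]%SET by rewrite -E !inE eqxx.
have : c \in [set a; b]%SET by rewrite E !inE eqxx.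
have : d \in [set a; b]%SET by rewrite E !inE eqxx orbT.
rewrite !inE => /orP[]/eqP dE /orP[]/eqP cE /orP[]/eqP aE; subst; rewrite ?eqxx // in cd *; auto.
Qed.

Section Trees.
Local Open Scope nat_scope.
Variable G : sgraph.
Implicit Types (T : {set {set G}}) (A : {set G}) (u v w x y : G).

Lemma adj_sym T : symmetric (adj T).
Proof. by move=> u v; rewrite /adj finset.setUC. Qed.

Lemma adj_connect_sym T : connect_sym (adj T).
Proof. exact/sym_connect_sym/adj_sym. Qed.

Lemma adj_edge T u v : T \subset edge_set G -> adj T u v -> edge u v.
Proof.
move=> /fintype.subsetP TE /TE; rewrite inE => /existsP[x /existsP[y /andP[xy /eqP E]]].
have xny : x != y by apply: contraTneq xy => ->; rewrite edge_irr.
by have [[-> ->]|[-> ->]] := set2_eq xny E; rewrite // edge_sym.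
Qed.

Lemma adj_neq T u v : T \subset edge_set G -> adj T u v -> u != v.
Proof. by move=> TE /(adj_edge TE); apply: contraTneq => ->; rewrite edge_irr. Qed.

(** The other edges of the cycle still join [x] and [y], so each use of the removed edge can be
    replaced. *)
Lemma connect_removed T x y s : ucycle (adj T) [:: x, y & s] -> 2 < size [:: x, y & s] ->
  forall u v, connect (adj T) u v -> connect (adj (T :\ [set x; y]%SET)) u v.
Proof.
move=> /andP[/= /andP[xy +] /and3P[xys ys us]] ss.
set T' := (T :\ _)%SET => pth.
have adj' u v : adj T u v -> [set u; v]%SET != [set x; y]%SET -> adj T' u v.
  by rewrite /adj /T' in_setD1 => -> ->.
have path' p u : path (adj T) u p -> all (fun w => (w != x) && (w != y)) (belast u p) ->
    path (adj T') u p.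
  elim: p u => [|v p IH] u //= /andP[uv pv] /andP[/andP[ux uy] av].
  rewrite IH // andbT; apply: adj' => //; apply/eqP => E.
  have : u \in [set x; y]%SET by rewrite -E !inE eqxx.
  by rewrite !inE (negbTE ux) (negbTE uy).
have xny : x != y by apply: contraNneq xys => ->; rewrite inE eqxx.
have cyx : connect (adj T') y x.
  case: s xys ys us ss pth => [//|z s] xys ys us _ /= /andP[yz pz].
  have zx : z != x by apply: contraNneq xys => ->; rewrite !inE eqxx orbT.
  apply/connectP; exists (z :: rcons s x); last by rewrite /= last_rcons.
  rewrite /= path' // ?andbT; last first.
    rewrite belast_rcons; apply/allP => w ws; apply/andP; split.
      by apply: contraNneq xys => <-; rewrite inE ws orbT.
    by apply: contraNneq ys => <-.
  apply: adj' => //; apply/eqP => E.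
  have : x \in [set y; z]%SET by rewrite E !inE eqxx.
  by rewrite !inE (negbTE xny) eq_sym (negbTE zx).
apply: connect_sub => u v uv; have [E|ne] := eqVneq [set u; v]%SET [set x; y]%SET; last first.
  exact/connect1/adj'.
have [[-> ->]|[-> ->]] := set2_eq xny E; last exact: cyx.
by rewrite adj_connect_sym.
Qed.

(* A minimal connected spanning set of edges in which the vertices of [A] have
   degree at most 1. *)
Lemma spanning_tree_leaves A :
  (forall u v, u \notin A -> v \notin A ->
     connect (fun x y => [&& x \notin A, y \notin A & edge x y]) u v) ->
  (forall a, a \in A -> exists2 b, b \notin A & edge a b) ->
  exists2 T, spanning_tree T & A \subset leaves T.
Proof.
move=> Bc Ad.
have /choice[f fP] : forall a, exists b, a \in A -> b \notin A /\ edge a b.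
  move=> a; have [/Ad[b bA ab]|_] := boolP (a \in A); first by exists b.
  by exists a.
pose good T := [&& T \subset edge_set G, [forall u, forall v, connect (adj T) u v] &
  [forall (a | a \in A), #|[set u | adj T a u]%SET| <= 1]].
(* All edges off [A] and, for each vertex of [A], the one edge to its chosen neighbour. That
   neighbour is outside [A], so vertices of [A] get no further edges. *)
pose T0 := [set e : {set G} | [exists u, exists v, [&& edge u v, e == [set u; v]%SET &
   (u \notin A) && (v \notin A) || (u \in A) && (v == f u)]]]%SET.
have T0P u v : edge u v -> (u \notin A) && (v \notin A) || (u \in A) && (v == f u) -> adj T0 u v.
  by move=> uv h; rewrite /adj inE; apply/existsP; exists u; apply/existsP; exists v; rewrite uv eqxx.
have goodT0 : good T0.
  apply/and3P; split.
  - apply/fintype.subsetP => e; rewrite !inE => /existsP[u /existsP[v /and3P[uv eE _]]].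
    by apply/existsP; exists u; apply/existsP; exists v; rewrite uv.
  - have cB u v : u \notin A -> v \notin A -> connect (adj T0) u v.
      move=> uA vA; apply: connect_sub (Bc u v uA vA) => x y /and3P[xA yA xy].
      by apply/connect1/T0P; rewrite // xA yA.
    have cr u : exists2 u', u' \notin A & connect (adj T0) u u'.
      have [uA|uA] := boolP (u \in A); last by exists u.
      by have [fA uf] := fP u uA; exists (f u) => //; apply/connect1/T0P; rewrite // uA eqxx orbT.
    apply/forallP => u; apply/forallP => v.
    have [u' u'A uu'] := cr u; have [v' v'A vv'] := cr v.
    apply: connect_trans uu' _; apply: connect_trans (cB _ _ u'A v'A) _.
    by rewrite adj_connect_sym.
  - apply/forall_inP => a aA; rewrite -(cards1 (f a)); apply: subset_leq_card.
    apply/fintype.subsetP => w; rewrite !inE /adj inE => /existsP[u /existsP[v /and3P[uv /eqP E h]]].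
    have unv : u != v by apply: contraTneq uv => ->; rewrite edge_irr.
    have [[e1 e2]|[e1 e2]] := set2_eq unv E; subst; move: h; rewrite aA /= ?andbF //=.
    by move=> /andP[uA /eqP vf]; have [] := fP u uA; rewrite -vf aA.
(* Minimality excludes cycles, since by [connect_removed] an edge of a cycle could be dropped. *)
have [T /minsetP[/and3P[TE /forallP Tc /forallP TA] Tmin] _] := minset_exists goodT0.
exists T; last first.
  apply/fintype.subsetP => a aA; rewrite inE.
  rewrite (_ : [set u | adj T u a]%SET = [set u | adj T a u]%SET); first exact: (implyP (TA a) aA).
  by apply/setP => u; rewrite !inE adj_sym.
split=> // [u v|c cs uc]; first by have /forallP := Tc u.
case: c cs uc => [|x [|y s]] // cs uc.
have xyT : [set x; y]%SET \in T by move: uc => /andP[/= /andP[]].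
have := Tmin (T :\ [set x; y])%SET; rewrite finset.subsetDl => E.
suff /E/(_ isT)/setP/(_ [set x; y]%SET) : good (T :\ [set x; y])%SET by rewrite !inE eqxx xyT.
apply/and3P; split.
- exact: fintype.subset_trans (finset.subsetDl _ _) TE.
- apply/forallP => u; apply/forallP => v; apply: connect_removed uc cs _ _ _.
  by have /forallP := Tc u.
- apply/forall_inP => a aA; have := TA a; rewrite aA; apply: leq_trans.
  apply: subset_leq_card; apply/fintype.subsetP => w; rewrite !inE /adj inE => /andP[_ h]; exact: h.
Qed.

(** An inner vertex of a simple path has two distinct neighbours on it, so it is not a leaf. *)
Lemma tree_path_avoiding T A p q : spanning_tree T -> A \subset leaves T ->
  p \notin A -> q \notin A ->
  connect (fun x y => [&& x \notin A, y \notin A & adj T x y]) p q.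
Proof.
move=> [TE Tc _] /fintype.subsetP AL pA qA.
have /connectP[s0 ps0 qE] := Tc p q.
case/shortenP: ps0 qE => s ps us _ qE {s0}; rewrite {q}qE in qA *.
elim: s p pA ps us qA => [|v s IH] p pA /=; first by [].
move=> /andP[pv pvs] /andP[pvn us] lA.
have vA : v \notin A.
  case: s pvs lA pvn {IH us} => [//|w s] /= /andP[vw _] _ pvn.
  apply/negP => /AL; rewrite inE leqNgt => /negP; apply.
  have pw : p != w by apply: contraNneq pvn => ->; rewrite !inE eqxx orbT.
  have <- : #|[set p; w]%SET| = 2 by rewrite cards2 pw.
  apply: subset_leq_card; apply/fintype.subsetP => x; rewrite !inE => /orP[]/eqP -> //.
  by rewrite adj_sym.
by apply: connect_trans (IH _ vA pvs us lA); apply: connect1; rewrite pA vA.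
Qed.

End Trees.

(** * Edge-maximal embeddings *)

Section Embedding.
Variables (R : realType) (S : topologicalType).
Hypotheses (hS : hausdorff_space S) (kS : compact [set: S]) (lS : locally_planar R S).
Variables (G : sgraph) (Gt : embedding R S G).
Implicit Types (u v w a b : G) (A B : {set G}) (x y z p : S) (P : pred (G * G)).

Notation pt := (point Gt).
Notation cv := (curve Gt).

Lemma edge_neq u v : edge u v -> u != v.
Proof. by apply: contraTneq => ->; rewrite edge_irr. Qed.

Definition edges_where P := [set x | exists u v, [/\ edge u v, P (u, v) & cv u v x]].

Lemma edges_where_nowhere_dense P : nowhere_dense_closed (edges_where P).
Proof.
have -> : edges_where P = [set x | exists2 e, e \in [seq e <- enum {: G * G} | edge e.1 e.2 && P e] & cv e.1 e.2 x].
  apply/seteqP; split=> x.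
    by move=> [u [v [uv Puv xuv]]]; exists (u, v) => //; rewrite mem_filter uv Puv mem_enum.
  move=> [[u v]]; rewrite mem_filter => /andP[/= /andP[uv Puv] _] xuv.
  by exists u, v.
apply: nowhere_dense_seq => -[u v]; rewrite mem_filter => /andP[/andP[/= uv _] _].
exact: (nowhere_dense_arc hS kS lS (curve_arc Gt uv)).
Qed.

Lemma points_nowhere_dense A : nowhere_dense_closed [set x | exists2 u, u \in A & x = pt u].
Proof.
have -> : [set x | exists2 u, u \in A & x = pt u] = [set x | exists2 u, u \in enum A & [set pt u] x].
  by apply/seteqP; split=> x [u uA xu]; exists u => //; rewrite ?mem_enum // in uA *.
by apply: nowhere_dense_seq => u _; exact: (nowhere_dense1 hS lS).
Qed.

Lemma support_nowhere_dense A : nowhere_dense_closed (support Gt A).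
Proof.
have -> : support Gt A = [set x | exists2 u, u \in A & x = pt u] `|`
    edges_where (fun e => (e.1 \in A) && (e.2 \in A)).
  apply/seteqP; split=> x [h|]; [by left| |by left|].
    by move=> [u [v [uA vA uv xuv]]]; right; exists u, v; rewrite /= uA vA.
  by move=> [u [v [uv /= /andP[uA vA] xuv]]]; right; exists u, v.
apply: nowhere_denseU; [exact: points_nowhere_dense|exact: edges_where_nowhere_dense].
Qed.

(** Unlike in [support], one end in [B] is enough for an edge, so the part of the drawing outside
    the support of [A] lies in the star of the complement of [A]. *)
Definition star B := [set x | (exists2 u, u \in B & x = pt u) \/
  exists u v, [/\ u \in B, edge u v & cv u v x]].

Lemma star_closed B : closed (star B).
Proof.
have -> : star B = [set x | exists2 u, u \in B & x = pt u] `|` edges_where (fun e => e.1 \in B).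
  apply/seteqP; split=> x [h|]; [by left| |by left|].
    by move=> [u [v [uB uv xuv]]]; right; exists u, v.
  by move=> [u [v [uv /= uB xuv]]]; right; exists u, v.
by apply: closedU; [have [] := points_nowhere_dense B|have [] := edges_where_nowhere_dense (fun e => e.1 \in B)].
Qed.

Local Notation K := (support Gt [set: G]%SET).

Let ndK : nowhere_dense_closed K := support_nowhere_dense _.

Lemma supportT A : support Gt A `<=` K.
Proof.
by move=> x [[u _ ->]|[u [v [_ _ uv xuv]]]]; [left; exists u|right; exists u, v; rewrite !inE].
Qed.

Lemma starT B : star B `<=` K.
Proof.
by move=> x [[u _ ->]|[u [v [_ uv xuv]]]]; [left; exists u|right; exists u, v; rewrite !inE].
Qed.

Lemma point_support u : K (pt u). Proof. by left; exists u; rewrite ?inE. Qed.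

Lemma support_point A u : support Gt A (pt u) -> u \in A.
Proof.
move=> [[w wA /point_inj -> //]|[w [v [wA vA wv]]]].
by move=> /(curve_point wv)[->|->].
Qed.

Lemma support_star A x : K x -> ~ support Gt A x -> star (~: A)%SET x.
Proof.
move=> [[u _ ->]|[u [v [_ _ uv xuv]]]] nA.
  by left; exists u => //; rewrite inE; apply/negP => uA; apply: nA; left; exists u.
have [uA|uA] := boolP (u \in A); last by right; exists u, v; rewrite inE.
have [vA|vA] := boolP (v \in A); last by right; exists v, u; rewrite inE vA edge_sym uv -(curve_sym Gt uv).
by exfalso; apply: nA; right; exists u, v.
Qed.

(** The complement of all vertices and all other edges is open, as these are finitely many closed
    sets. This is the local hypothesis of [follow_edge]. *)
Lemma curve_nbhs u v x : edge u v -> cv u v x -> x <> pt u -> x <> pt v ->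
  exists N, [/\ open N, N x & N `&` K `<=` cv u v].
Proof.
move=> uv xuv xu xv.
pose P (e : G * G) := [set e.1; e.2]%SET != [set u; v]%SET.
exists (~` ([set y | exists2 w, w \in [set: G]%SET & y = pt w] `|` edges_where P)); split.
- apply: closed_openC; apply: closedU; first by have [] := points_nowhere_dense [set: G]%SET.
  by have [] := edges_where_nowhere_dense P.
- have nw w : x <> pt w.
    by move=> xw; move: xuv xu xv; rewrite xw => /(curve_point uv)[->|->].
  move=> [[w _ xw]|[u' [v' [uv' Pe xuv']]]]; first exact: (nw w).
  have : cv u' v' x /\ cv u v x by [].
  by move=> /(curve_curve uv' uv Pe)[w _ wx]; apply: (nw w); rewrite wx.
- move=> y [ny [[w wT yw]|[u' [v' [_ _ uv' yuv']]]]].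
    by exfalso; apply: ny; left; exists w.
  have [/eqP E|ne] := boolP ([set u'; v']%SET == [set u; v]%SET); last first.
    by exfalso; apply: ny; right; exists u', v'.
  have [[e1 e2]|[e1 e2]] := set2_eq (edge_neq uv) E; subst => //.
  by rewrite (curve_sym Gt uv).
Qed.

(* [u] lies on the boundary of the face containing [p]. *)
Definition reach p u := arcc R (~` K `|` [set pt u]) p (pt u).

Lemma reach_point p u C : simple_arc R p (pt u) C -> C `&` K `<=` [set pt u] -> reach p u.
Proof.
move=> aC CK; right; exists C => // y Cy.
by have [Ky|nKy] := pselect (K y); [right; exact: CK|left].
Qed.

Lemma reach_edge u v p z C : edge u v -> cv u v z -> z <> pt u -> z <> pt v ->
  simple_arc R p z C -> C `&` K `<=` [set z] -> reach p u.
Proof.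
move=> uv zuv zu zv aC CK.
have cK : cv u v `<=` K by move=> y yuv; right; exists u, v; rewrite !inE.
apply: (follow_edge hS kS lS ndK (simple_arc_sym (curve_arc Gt uv)) cK _ zuv zv zu aC CK).
by move=> y yuv yv yu; exact: curve_nbhs.
Qed.

(** [B] is a union of components of the graph with [A] deleted. *)
Definition closed_off A B := (forall u, u \in B -> u \notin A) /\
  (forall u v, u \in B -> edge u v -> (v \in A) || (v \in B)).

(** The far end of an edge at [B] is in [A] or in [B]; in the first case its point belongs to the
    support of [A]. *)
Lemma star_cases A B x : closed_off A B -> star B x -> ~ support Gt A x ->
  (exists2 u, u \in B & x = pt u) \/
  (exists u v, [/\ u \in B, edge u v, cv u v x, x <> pt u & x <> pt v]).
Proof.
move=> [_ BA] [h|[u [v [uB uv xuv]]]] nA; first by left.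
have [xu|xu] := pselect (x = pt u); first by left; exists u.
have [xv|xv] := pselect (x = pt v); last by right; exists u, v.
left; exists v => //; have /orP[vA|//] := BA u v uB uv.
by exfalso; apply: nA; left; exists v.
Qed.

Lemma star_reach A B p z C : closed_off A B -> star B z -> ~ support Gt A z ->
  simple_arc R p z C -> C `&` K `<=` [set z] -> exists2 u, u \in B & reach p u.
Proof.
move=> AB sz nz aC CK; have [[u uB zu]|[u [v [uB uv zuv zu zv]]]] := star_cases AB sz nz.
  by exists u => //; rewrite zu in aC CK; exact: reach_point CK.
by exists u => //; exact: (reach_edge uv zuv zu zv aC CK).
Qed.

Lemma reach_adjacent p u v : edge_maximal Gt -> reach p u -> reach p v -> u != v -> edge u v.
Proof.
move=> em pu pv uv; apply: contrapT => /negP nuv; apply: (em u v uv nuv).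
have : arcc R (~` K `|` [set pt u; pt v]) (pt u) (pt v).
  apply: (arcc_trans hS) (arcc_sym (arcc_sub _ pu)) (arcc_sub _ pv).
    by move=> y [|->]; [left|right; left].
  by move=> y [|->]; [left|right; right].
move=> [/point_inj E|[C aC CM]]; first by rewrite E eqxx in uv.
by exists C; split=> // y [/CM[//|//]].
Qed.

(** Access is guaranteed only near a given point, not at the vertex itself. If [a] has an edge, a
    face is found at an inner point of it and followed to [a]; otherwise the drawing near [a] is a
    single point. *)
Lemma vertex_reached a : exists2 p, ~ K p & reach p a.
Proof.
have cK x : closure (~` K) x.
  move=> V nV; have [||z Vz nz] := ndK.2 V°%classic.
  - exact: open_interior.
  - by exists x; exact: nbhs_singleton (nbhs_interior nV).
  - by exists z; split=> //; exact: interior_subset.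
have [[b ab]|na] := pselect (exists b, edge a b).
  have [x [C1 [C2 [a1 a2 s1 s2]]]] := simple_arc_split (curve_arc Gt ab).
  have [xab xb] := s1 _ (simple_arc_left a1); have [_ xa] := s2 _ (simple_arc_left a2).
  have [N [oN Nx NK]] := curve_nbhs ab xab xa xb.
  have c1 w : open (~` [set pt w]).
    by apply: closed_openC; have [] := nowhere_dense1 hS lS (pt w).
  have oO : open (N `&` (~` [set pt a] `&` ~` [set pt b])) by apply: openI => //; apply: openI.
  have Kx : K x by right; exists a, b; rewrite !inE.
  have [p [z [C [nKp Kz [Nz [za zb]] aC [CO CK]]]]] :=
    access_near lS ndK (@subset_refl _ (~` K)) (cK x) Kx oO (conj Nx (conj xa xb)).
  by exists p => //; apply: (reach_edge ab _ za zb aC CK); exact: NK.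
pose T' := (~: [set a])%SET.
have oO : open (~` support Gt T') by apply: closed_openC; have [] := support_nowhere_dense T'.
have Oa : (~` support Gt T') (pt a) by move=> /support_point; rewrite !inE eqxx.
have [p [z [C [nKp Kz Oz aC [CO CK]]]]] :=
  access_near lS ndK (@subset_refl _ (~` K)) (cK (pt a)) (point_support a) oO Oa.
exists p => //; have za : z = pt a.
  have := support_star Kz Oz; rewrite finset.setCK => -[[u]|[u [v []]]].
    by rewrite inE => /eqP ->.
  by rewrite inE => /eqP -> av; exfalso; apply: na; exists v.
by rewrite za in aC CK; exact: reach_point CK.
Qed.

Hypothesis em : edge_maximal Gt.

Lemma complete_of_nonseparating : nonseparating Gt [set: G]%SET ->
  forall u v, u != v -> edge u v.
Proof.
move=> cW u v uv; have [p nKp pu] := vertex_reached u; have [q nKq qv] := vertex_reached v.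
have pq : arcc R (~` K) p q.
  by apply: (connected_arcc hS lS) cW _ _ _ => //; apply: closed_openC; exact: ndK.1.
apply: reach_adjacent em pu _ uv.
by apply: (arcc_trans hS) (arcc_sub _ pq) qv; move=> y; left.
Qed.

Variable A : {set G}.
Hypothesis nsA : nonseparating Gt A.

Let oW : open (~` support Gt A).
Proof. by apply: closed_openC; have [] := support_nowhere_dense A. Qed.

(** An arc off the support of [A], from a face at [a] to [b], stays in that face until it meets the
    star of the complement of [A]. There the face reaches a vertex outside [A], which is then
    adjacent to [a]. *)
Lemma nonseparating_dominated a b : a \in A -> b \notin A -> exists2 c, c \notin A & edge a c.
Proof.
move=> aA bA; have [p nKp pa] := vertex_reached a.
have nAb : ~ support Gt A (pt b) by move=> /support_point; rewrite (negbTE bA).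
have nAp : ~ support Gt A p by move=> /supportT.
have [pb|[C aC CW]] := connected_arcc hS lS oW nsA (@subset_refl _ _) nAp nAb.
  by exfalso; apply: nKp; rewrite pb; exact: point_support.
pose B := (~: A)%SET.
have sb : star B (pt b) by left; exists b; rewrite ?inE.
have nsp : ~ star B p by move=> /starT.
have [z [C' [sz aC' C'C C's]]] := simple_arc_trim aC (star_closed (B := B)) sb nsp.
have C'K : C' `&` K `<=` [set z].
  by move=> y [C'y Ky]; apply: C's; split=> //; apply: support_star Ky _; apply/CW/C'C.
have AB : closed_off A B by split=> [u|u v _ _]; rewrite inE // orbN.
have nz : ~ support Gt A z by apply/CW/C'C; exact: simple_arc_right aC'.
have [c cB pc] := star_reach AB sz nz aC' C'K.
exists c; first by rewrite inE in cB.
by apply: reach_adjacent em pa pc _; apply: contraTneq aA => ->; rewrite inE in cB.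
Qed.

(** If the component of [u] and the remaining vertices outside [A] were not joined by an edge, an
    arc off the support of [A] would contain a piece leading from the star of one class to the star
    of the other with only its ends on the drawing. Its interior lies in one face, which reaches
    both classes. *)
Lemma nonseparating_connected u v : u \notin A -> v \notin A ->
  connect (fun w w' : G => [&& w \notin A, w' \notin A & edge w w']) u v.
Proof.
set r := (fun x y : G => _) => uA vA; apply: contrapT => /negP nuv.
pose B1 := [set w | (w \notin A) && connect r u w]%SET.
pose B2 := [set w | (w \notin A) && ~~ connect r u w]%SET.
have disj w : w \in B1 -> w \in B2 -> False by rewrite !inE => /andP[-> ->].
have noedge b1 b2 : b1 \in B1 -> b2 \in B2 -> edge b1 b2 -> False.
  rewrite !inE => /andP[n1 c1] /andP[n2 /negP c2] e12; apply: c2.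
  by apply: connect_trans c1 _; apply: connect1; rewrite /r n1 n2.
have AB1 : closed_off A B1.
  split=> [w|w w' wB ww']; first by rewrite inE => /andP[].
  have [//|w'A /=] := boolP (w' \in A); apply: contrapT => /negP nB; apply: (noedge w w') => //.
  by move: nB; rewrite !inE w'A /= => ->.
have AB2 : closed_off A B2.
  split=> [w|w w' wB ww']; first by rewrite inE => /andP[].
  have [//|w'A /=] := boolP (w' \in A); apply: contrapT => /negP nB.
  by apply: (noedge w' w); rewrite // 1?edge_sym //; move: nB; rewrite !inE w'A /= negbK.
(* The two stars can meet only in the support of [A], so the two ends of the trimmed piece are
   distinct. *)
have nst x : star B1 x -> star B2 x -> ~ support Gt A x -> False.
  move=> s1 s2 nx; have [[w1 B1w e1]|[u1 [v1 [B1u uv1 x1 xu1 xv1]]]] := star_cases AB1 s1 nx;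
    have [[w2 B2w e2]|[u2 [v2 [B2u uv2 x2 xu2 xv2]]]] := star_cases AB2 s2 nx.
  - by apply: (disj w1) => //; rewrite (_ : w1 = w2) //; apply: (@point_inj _ _ _ Gt); rewrite -e1.
  - by move: x2; rewrite e1 => /(curve_point uv2)[E|E]; [apply: xu2|apply: xv2]; rewrite e1 E.
  - by move: x1; rewrite e2 => /(curve_point uv1)[E|E]; [apply: xu1|apply: xv1]; rewrite e2 E.
  - have [/eqP E|ne] := boolP ([set u1; v1]%SET == [set u2; v2]%SET).
      have [[E1 E2]|[E1 E2]] := set2_eq (edge_neq uv2) E; first by apply: (disj u1); rewrite // E1.
      by apply: (noedge u1 u2); rewrite // -E2.
    have : cv u1 v1 x /\ cv u2 v2 x by [].
    move=> /(curve_curve uv1 uv2 ne)[w _ wx]; move: x1; rewrite -wx => /(curve_point uv1)[E|E].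
      by apply: xu1; rewrite -wx E.
    by apply: xv1; rewrite -wx E.
have nA w : w \notin A -> ~ support Gt A (pt w) by move=> wA /support_point; rewrite (negbTE wA).
have uB1 : u \in B1 by rewrite inE uA connect0.
have vB2 : v \in B2 by rewrite inE vA.
have su : star B1 (pt u) by left; exists u.
have sv : star B2 (pt v) by left; exists v.
have [/point_inj E|[C aC CW]] := connected_arcc hS lS oW nsA (@subset_refl _ _) (nA u uA) (nA v vA).
  by rewrite E connect0 in nuv.
have nsu : ~ star B2 (pt u) by move=> h; apply: (nst (pt u)) => //; exact: nA.
have [z2 [C2 [sz2 aC2 C2C C2s]]] := simple_arc_trim aC (star_closed (B := B2)) sv nsu.
have nz2 : ~ support Gt A z2 by apply/CW/C2C; exact: simple_arc_right aC2.
have nsz2 : ~ star B1 z2 by move=> h; exact: (nst z2).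
have [z1 [C1 [sz1 aC1 C1C C1s]]] := simple_arc_trim (simple_arc_sym aC2) (star_closed (B := B1)) su nsz2.
have C1W : C1 `<=` ~` support Gt A by move=> y /C1C /C2C /CW.
have nz1 : ~ support Gt A z1 by apply: C1W; exact: simple_arc_right aC1.
have C1K y : C1 y -> K y -> y = z1 \/ y = z2.
  move=> C1y Ky; have := support_star Ky (C1W y C1y) => -[[w]|[w [w' []]]]; rewrite inE => wA.
    move=> yw; have [wB|wB] := boolP (w \in B1).
      by left; apply: C1s; split=> //; left; exists w.
    right; apply: C2s; split; first exact: C1C.
    by left; exists w => //; move: wB; rewrite !inE wA.
  move=> ww' yw; have [wB|wB] := boolP (w \in B1).
    by left; apply: C1s; split=> //; right; exists w, w'.
  right; apply: C2s; split; first exact: C1C.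
  by right; exists w, w'; split=> //; move: wB; rewrite !inE wA.
(* An inner point of the piece represents the face, and the two halves are its access arcs. *)
have [p [D1 [D2 [aD1 aD2 D1C D2C]]]] := simple_arc_split aC1.
have D1K : D1 `&` K `<=` [set z2].
  by move=> y [D1y Ky]; have [C1y ny] := D1C y D1y; have [//|] := C1K y C1y Ky.
have D2K : D2 `&` K `<=` [set z1].
  by move=> y [D1y Ky]; have [C1y ny] := D2C y D1y; have [|//] := C1K y C1y Ky.
have [b2 bB2 pb2] := star_reach AB2 sz2 nz2 aD1 D1K.
have [b1 bB1 pb1] := star_reach AB1 sz1 nz1 aD2 D2K.
apply: (noedge b1 b2) => //; apply: reach_adjacent em pb1 pb2 _.
by apply/eqP => E; apply: (disj b1); rewrite // E.
Qed.

End Embedding.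

(** * Induced, triangular and extended embeddings *)

Section Induced.
Variables (R : realType) (S : topologicalType) (G : sgraph) (Gt : embedding R S G).

(** Robust connectivity ranges over all nonempty vertex sets, so surface connectivity is applied to
    the subgraph induced by each; equality of the supports carries nonseparating sets back to
    [G]. *)
Lemma induced_embedding (A : {set G}) : A != finset.set0 ->
  exists (H : sgraph) (Ht : embedding R S H) (i : H -> G),
  [/\ injective i, forall x, i x \in A, #|H| = #|A| &
      forall B : {set H}, support Ht B = support Gt (i @: B)%SET].
Proof.
move=> A0; pose V := {x : G | x \in A}.
pose e : rel V := fun x y => edge (val x) (val y).
have es : symmetric e by move=> x y; exact: edge_sym.
have ei : irreflexive e by move=> x; exact: edge_irr.
have cV : #|{: V}| = #|A| by rewrite card_sig; apply: eq_card => x; rewrite inE.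
have V0 : (0 < #|{: V}|)%N by rewrite cV card_gt0.
pose H := SGraph es ei V0.
pose pt (x : H) := point Gt (val x); pose cv (x y : H) := curve Gt (val x) (val y).
have pinj : injective pt by move=> x y /point_inj /val_inj.
have csym (x y : H) : edge x y -> cv x y = cv y x by move=> xy; exact: (curve_sym Gt xy).
have carc (x y : H) : edge x y -> simple_arc R (pt x) (pt y) (cv x y) by move=> xy; exact: (curve_arc Gt xy).
have cpt (x y z : H) : edge x y -> cv x y (pt z) -> z = x \/ z = y.
  move=> xy h; have := @curve_point _ _ _ Gt (val x) (val y) (val z) xy h.
  by move=> [] /val_inj; [left|right].
have ccv (x y x' y' : H) : edge x y -> edge x' y' -> [set x; y]%SET != [set x'; y']%SET ->
    cv x y `&` cv x' y' `<=` range pt.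
  move=> xy xy' ne z [z1 z2].
  have ne' : [set val x; val y]%SET != [set val x'; val y']%SET.
    apply: contraNneq ne => E; apply/eqP.
    have ne : val x' != val y' by exact: edge_neq xy'.
    by have [[/val_inj -> /val_inj ->]|[/val_inj -> /val_inj ->]] := set2_eq ne E; rewrite // finset.setUC.
  have [w _ wz] := @curve_curve _ _ _ Gt (val x) (val y) (val x') (val y') xy xy' ne' z (conj z1 z2).
  rewrite -wz in z1 z2 *.
  by have [->|->] := @curve_point _ _ _ Gt (val x) (val y) w xy z1; [exists x|exists y].
exists H, (@Embedding R S H pt cv pinj csym carc cpt ccv), val; split=> //.
- by move=> x; exact: valP.
- move=> B; apply/seteqP; split=> z.
    move=> [[u uB ->]|[u [v [uB vB uv zuv]]]]; [left|right].
      by exists (val u) => //; exact: imset_f.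
    by exists (val u), (val v); rewrite !imset_f.
  move=> [[_ /imsetP[u uB ->] ->]|[_ [_ [/imsetP[u uB ->] /imsetP[v vB ->] uv zuv]]]]; [left|right].
    by exists u.
  by exists u, v.
Qed.

End Induced.

(** * A triangle drawn in a chart *)

Section Triangle.
Variables (R : realType) (S : topologicalType).
Hypotheses (hS : hausdorff_space S) (lS : locally_planar R S).
Variable x0 : S.

Definition K3_edge : rel 'I_3 := fun i j => i != j.
Lemma K3_sym : symmetric K3_edge. Proof. by move=> i j; rewrite /K3_edge eq_sym. Qed.
Lemma K3_irr : irreflexive K3_edge. Proof. by move=> i; rewrite /K3_edge eqxx. Qed.
Lemma K3_gt0 : (0 < #|'I_3|)%N. Proof. by rewrite card_ord. Qed.
Definition K3 := SGraph K3_sym K3_irr K3_gt0.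

Lemma ord3P (P : 'I_3 -> Prop) : P 0 -> P 1 -> P 2%:R -> forall i, P i.
Proof.
move=> P0 P1 P2 [[|[|[|//]]] h].
- by rewrite (_ : Ordinal h = 0) //; exact: val_inj.
- by rewrite (_ : Ordinal h = 1) //; exact: val_inj.
- by rewrite (_ : Ordinal h = 2%:R) //; exact: val_inj.
Qed.

Definition corner (a : R * R) (r : R) (i : 'I_3) : R * R :=
  if i == 1 then a + (r, 0) else if i == 2%:R then a + (0, r) else a.

(* Barycentric coordinates with respect to the corners. *)
Definition bary (a : R * R) (r : R) (i : 'I_3) (z : R * R) : R :=
  if i == 1 then (z.1 - a.1) / r else if i == 2%:R then (z.2 - a.2) / r
  else 1 - (z.1 - a.1) / r - (z.2 - a.2) / r.

Lemma bary_corner a r i j : r != 0 -> bary a r i (corner a r j) = (i == j)%:R.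
Proof.
by move=> r0; elim/ord3P: i; elim/ord3P: j; rewrite /bary /corner /=; field.
Qed.

Lemma bary_sum a r z : bary a r 0 z + bary a r 1 z + bary a r 2%:R z = 1.
Proof. by rewrite /bary /=; ring. Qed.

Lemma bary_seg a r i p q t : bary a r i (seg p q t) = (1 - t) * bary a r i p + t * bary a r i q.
Proof. by elim/ord3P: i; rewrite /bary /seg /=; rewrite /GRing.scale /=; ring. Qed.

Lemma bary_inj a r z w : r != 0 -> (forall i, bary a r i z = bary a r i w) -> z = w.
Proof.
move=> r0 E; have := E 1; have := E 2%:R; rewrite /bary /=.
have ri : r^-1 != 0 by rewrite invr_eq0.
move=> /(mulIf ri) /addIr E2 /(mulIf ri) /addIr E1.
by case: z w E1 E2 {E} => [z1 z2] [w1 w2] /= -> ->.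
Qed.

Lemma bary_continuous a r i : continuous (bary a r i).
Proof.
have c1 : continuous (fun z : R * R => (z.1 - a.1) / r).
  move=> z; apply: cvgMl; apply: cvgB; [exact: cvg_fst|exact: cvg_cst].
have c2 : continuous (fun z : R * R => (z.2 - a.2) / r).
  move=> z; apply: cvgMl; apply: cvgB; [exact: cvg_snd|exact: cvg_cst].
elim/ord3P: i => z; [|exact: c1|exact: c2].
by apply: cvgB; [apply: cvgB; [exact: cvg_cst|exact: c1]|exact: c2].
Qed.


Definition triangle a r : set (R * R) := [set z | forall i, 0 <= bary a r i z].

Lemma triangle_closed a r : closed (triangle a r).
Proof.
have -> : triangle a r = \bigcap_(i in setT) bary a r i @^-1` [set t | 0 <= t].
  by apply/seteqP; split=> z h i; [move=> _; exact: h|exact: (h i I)].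
apply: closed_bigI => i _; apply: closed_comp; last exact: closed_ge.
by move=> z _; exact: bary_continuous.
Qed.

Lemma triangle_sub a r : 0 < r -> triangle a r `<=` [set z | `|a - z| <= r].
Proof.
move=> r0 z h; have := h 0; have := h 1; have := h 2%:R; rewrite /bary /=.
rewrite !pmulr_lge0 ?invr_gt0 //; move=> h2 h1 h0.
have E : (z.1 - a.1) + (z.2 - a.2) <= r.
  have : (z.1 - a.1) / r + (z.2 - a.2) / r <= 1 by lra.
  by rewrite -mulrDl ler_pdivrMr // mul1r.
by rewrite prod_normE /= ge_max !ler_norml; apply/andP; split; lra.
Qed.

Lemma segment_bary a r i j z : 0 < r -> i != j -> (seg (corner a r i) (corner a r j) @` `[0, 1]) z ->
  triangle a r z /\ forall k, bary a r k z != 0 -> k = i \/ k = j.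
Proof.
move=> r0 ij [t /= + <-]; rewrite in_itv /= => t01.
have rn : r != 0 by rewrite gt_eqF.
have bk k : bary a r k (seg (corner a r i) (corner a r j) t) = (1 - t) * (k == i)%:R + t * (k == j)%:R.
  by rewrite bary_seg !bary_corner.
split=> k; rewrite bk.
  by case: (k == i); case: (k == j) => /=; lra.
have [->|_] := eqVneq k i; first by left.
have [->|_] := eqVneq k j; first by right.
by rewrite !mulr0 addr0 eqxx.
Qed.

Lemma bary_segment a r i j z : 0 < r -> i != j -> triangle a r z ->
  (forall k, k != i -> k != j -> bary a r k z = 0) ->
  (seg (corner a r i) (corner a r j) @` `[0, 1]) z.
Proof.
move=> r0 ij tz z0; have rn : r != 0 by rewrite gt_eqF.
have sij : bary a r i z + bary a r j z = 1.
  have := bary_sum a r z; move: ij (z0 0) (z0 1) (z0 2%:R).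
  by elim/ord3P: i {z0}; elim/ord3P: j => //= _ h0 h1 h2 E;
    first [have := h0 isT isT; lra|have := h1 isT isT; lra|have := h2 isT isT; lra].
have := tz i; have := tz j => hj hi.
exists (bary a r j z); first by rewrite /= in_itv /=; lra.
apply: (bary_inj (a := a) rn) => k; rewrite bary_seg !bary_corner //.
have [->|ki] := eqVneq k i; first by rewrite (negbTE ij) /=; lra.
have [->|kj] := eqVneq k j; first by rewrite /=; lra.
by rewrite (z0 k) // !mulr0 addr0.
Qed.

Lemma segment_corner a r k z : 0 < r -> (forall i, bary a r i z != 0 -> i = k) -> z = corner a r k.
Proof.
move=> r0 h; have rn : r != 0 by rewrite gt_eqF.
apply: (bary_inj (a := a) rn) => i; rewrite bary_corner //.
have b0 j : j != k -> bary a r j z = 0.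
  by move=> jk; apply/eqP; apply: contraNT jk => /h ->.
have [->|ik] := eqVneq i k; last by rewrite b0.
have := bary_sum a r z; move: b0; elim/ord3P: k {h} => b0.
- by rewrite (b0 1) // (b0 2%:R) // !addr0.
- by rewrite (b0 0) // (b0 2%:R) // addr0 add0r.
- by rewrite (b0 0) // (b0 1) // !add0r.
Qed.

Lemma seg_sym (p q : R * R) : seg p q @` `[0, 1] = seg q p @` `[0, 1].
Proof.
suff h (u v : R * R) : seg u v @` `[0, 1] `<=` seg v u @` `[0, 1] by apply/seteqP; split; exact: h.
move=> _ [t /= + <-]; rewrite in_itv /= => t01; exists (1 - t); first by rewrite /= in_itv /=; lra.
by rewrite /seg; apply: injective_projections; rewrite /= /GRing.scale /=; ring.
Qed.

(** Any set of more than two vertices is the whole triangle, whose sides separate the barycentre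
    from a point outside. *)
Lemma triangle_embedding : exists Gt : embedding R S K3, (max_nonseparating Gt <= 2)%N.
Proof.
have [phi [psi [r cx]]] := chart_exists lS (@openT S) (I : [set: S] x0).
have [r0 psix h1 h2] := cx; have rn : r != 0 by rewrite gt_eqF.
set a := phi x0 in h1 h2 *.
pose c := corner a r; pose sg i j := seg (c i) (c j) @` `[0, 1].
have Tr : triangle a r `<=` [set z | `|a - z| <= r] by exact: triangle_sub.
have psi_inj z w : `|a - z| <= r -> `|a - w| <= r -> psi z = psi w -> z = w.
  by move=> /h1[_ e1 _ _] /h1[_ e2 _ _] E; rewrite -e1 -e2 E.
have sgT i j : i != j -> sg i j `<=` triangle a r by move=> ij z /(segment_bary r0 ij)[].
have cT i : triangle a r (c i) by move=> j; rewrite bary_corner //; case: (_ == _).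
have cinj : injective c.
  move=> i j E; have := bary_corner a i i rn; rewrite -/c -/(c i) E bary_corner // eqxx.
  by case: eqP => // _ /esym/eqP; rewrite oner_eq0.
pose pt (i : K3) := psi (c i); pose cv (i j : K3) := psi @` sg i j.
have pinj : injective pt by move=> i j /psi_inj E; apply/cinj/E; exact/Tr/cT.
have csym (i j : K3) : edge i j -> cv i j = cv j i by move=> _; rewrite /cv /sg seg_sym.
have carc (i j : K3) : edge i j -> simple_arc R (pt i) (pt j) (cv i j).
  move=> ij; apply: (chart_simple_arc cx); first exact: subset_trans (sgT _ _ ij) Tr.
  by apply: seg_simple_arc => /cinj E; rewrite E (edge_irr (s := K3)) in ij.
have cpt (i j k : K3) : edge i j -> cv i j (pt k) -> k = i \/ k = j.
  move=> ij [z zij /psi_inj E]; have zc : z = c k by apply: E; [exact/Tr/(sgT _ _ ij)|exact/Tr/cT].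
  have [_] := segment_bary r0 ij zij; apply.
  by rewrite zc bary_corner // eqxx oner_eq0.
have ccv (i j i' j' : K3) : edge i j -> edge i' j' -> [set i; j]%SET != [set i'; j']%SET ->
    cv i j `&` cv i' j' `<=` range pt.
  move=> ij ij' ne _ [[z zij <-] [w wij E]].
  have wz : w = z by apply: psi_inj E; [exact/Tr/(sgT _ _ ij')|exact/Tr/(sgT _ _ ij)].
  rewrite wz in wij.
  have [tz b1] := segment_bary r0 ij zij; have [_ b2] := segment_bary r0 ij' wij.
  have [k kz] : exists k, bary a r k z != 0.
    apply: contrapT => n; have := bary_sum a r z.
    have b0 k : bary a r k z = 0 by apply/eqP; apply: contrapT => /negP nk; apply: n; exists k.
    by rewrite !b0 !addr0 => /eqP; rewrite eq_sym oner_eq0.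
  exists k => //; congr psi; apply/esym/segment_corner => // m mz.
  apply/eqP; apply: contraNT ne => mk.
  have two (u v : 'I_3) : (k = u \/ k = v) -> (m = u \/ m = v) -> [set u; v]%SET = [set k; m]%SET.
    case=> ?; case=> ?; subst => //; rewrite ?eqxx // in mk *.
    by rewrite finset.setUC.
  by rewrite (two i j) ?(two i' j') //; [exact: b2|exact: b2|exact: b1|exact: b1].
pose Gt := @Embedding R S K3 pt cv pinj csym carc cpt ccv.
exists Gt; apply/bigop.bigmax_leqP => A /asboolP nsA.
have [AT|nAT] := eqVneq A [set: K3]%SET; last first.
  rewrite -ltnS -[3%N]card_ord -[#|'I_3|]cardsT; apply: proper_card.
  by rewrite properT.
exfalso; rewrite AT in nsA.
pose Ti : set (R * R) := [set z | forall i, 0 < bary a r i z].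
have Tir z : Ti z -> triangle a r z by move=> h i; exact: ltW.
have supp_psi z : triangle a r z -> support Gt [set: K3]%SET (psi z) <-> ~ Ti z.
  move=> tz; split.
    have zr := Tr z tz.
    move=> [[i _ /psi_inj E]|[i [j [_ _ ij [w wij /psi_inj E]]]]] Tz.
      have zc : z = c i by apply: E => //; exact/Tr/cT.
      have [j ji] : exists j : 'I_3, j != i by case: (eqVneq i 0) => [->|i0]; [exists 1|exists 0; rewrite eq_sym].
      by have := Tz j; rewrite zc bary_corner // (negbTE ji) ltxx.
    have wz : w = z by apply: E => //; exact/Tr/(sgT _ _ ij).
    rewrite wz in wij; have [_ b] := segment_bary r0 ij wij.
    have al k : k = i \/ k = j by apply: b; rewrite gt_eqF.
    have [] := al 0; have [] := al 1; have [] := al 2%:R => e2 e1 e0;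
      by [have := etrans e0 (esym e1)|have := etrans e0 (esym e2)|have := etrans e1 (esym e2)].
  move=> nTz; have [k kz] : exists k, bary a r k z = 0.
    apply: contrapT => n; apply: nTz => i; rewrite lt_neqAle tz andbT eq_sym.
    by apply/eqP => i0; apply: n; exists i.
  (* [z] lies on the side opposite to corner [k], whose ends are the two other indices. *)
  right; exists (lift k ord0), (lift k ord_max); rewrite !inE.
  have ij : lift k ord0 != lift k ord_max by rewrite (inj_eq lift_inj).
  split=> //; exists z => //; apply: bary_segment => // m m1 m2.
  case: (unliftP k m) => [l mE|-> //]; exfalso; move: m1 m2; rewrite mE !(inj_eq lift_inj).
  by case: l {mE} => [[|[|//]]] ? /eqP l0 /eqP l1; [apply: l0|apply: l1]; exact: val_inj.
have pz z : `|a - z| <= r -> ~ triangle a r z -> ~ (psi @` triangle a r) (psi z).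
  by move=> zr nt [w tw /psi_inj E]; apply: nt; rewrite -E //; exact: Tr.
have cPT : closed (psi @` triangle a r).
  apply: compact_closed => //; apply: continuous_compact.
    by apply: continuous_in_subspaceT => z /set_mem /Tr /h1[].
  apply: (subclosed_compact (@triangle_closed a r) (cball_compact (z := a) (r := r))) => //.
have suppT : support Gt [set: K3]%SET `<=` psi @` triangle a r.
  move=> z [[i _ ->]|[i [j [_ _ ij [w /(sgT _ _ ij) tw <-]]]]]; last by exists w.
  by exists (c i) => //; exact: cT.
(* The barycentre, and a point on the rim of the chart with a negative barycentric coordinate. *)
pose inn := a + (r / 3%:R, r / 3%:R); pose out := a + (- r, 0).
have inT : Ti inn.
  have b3 : forall i, bary a r i inn = 1 / 3%:R.
    by elim/ord3P; rewrite /bary /inn /=; field.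
  by move=> i; rewrite b3 divr_gt0.
have outr : `|a - out| <= r.
  rewrite /out opprD addrA subrr sub0r normrN prod_normE /= normrN normr0 ge_max.
  by rewrite gtr0_norm // lexx ltW.
have nout : ~ triangle a r out.
  move=> /(_ 1); rewrite /bary /out /= pmulr_lge0 ?invr_gt0 //; lra.
have Win : (~` support Gt [set: K3]%SET) (psi inn).
  by move=> /(supp_psi inn (Tir _ inT)); apply.
have Wout : (~` support Gt [set: K3]%SET) (psi out).
  by move=> /suppT; exact: pz.
(* Off the drawing, lying in the image of the triangle is locally constant; connectedness would
   carry it from [inn] to [out]. *)
suff : (psi @` triangle a r) (psi out) by apply: pz.
apply: (connected_locconst nsA _ Win Wout); last by exists inn => //; exact: Tir.
move=> y Wy; have [[z tz zy]|ny] := pselect ((psi @` triangle a r) y); last first.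
  by apply: filterS (near_not cPT ny) => w nw _; split.
have Tz : Ti z by apply: contrapT => nT; apply: Wy; rewrite -zy; apply/(supp_psi z tz).
have nTi : \forall w \near z, triangle a r w.
  have nb i : \forall w \near z, 0 < bary a r i w.
    have n : nbhs (bary a r i z) [set t | 0 < t].
      by apply: open_nbhs_nbhs; split; [exact: open_gt|exact: Tz].
    exact: (@bary_continuous a r i z _ n).
  apply: filterS3 (nb 0) (nb 1) (nb 2%:R) => w w0 w1 w2.
  by elim/ord3P; exact: ltW.
have := h2 z _ (Tr z tz) nTi; rewrite zy; apply: filterS => w hw _; split=> // _.
by exists z.
Qed.

End Triangle.

(** * Adding vertices and edges to an embedding *)

Section Extension.
Variables (R : realType) (S : topologicalType).

Definition extends (G H : sgraph) (Gt : embedding R S G) (Ht : embedding R S H) (i : G -> H) :=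
  [/\ injective i, forall v, point Ht (i v) = point Gt v &
     forall u v, edge u v -> edge (i u) (i v) /\ curve Ht (i u) (i v) = curve Gt u v].

Lemma extends_comp (G H L : sgraph) (Gt : embedding R S G) (Ht : embedding R S H)
    (Lt : embedding R S L) i j :
  extends Gt Ht i -> extends Ht Lt j -> extends Gt Lt (j \o i).
Proof.
move=> [ii ip ie] [ji jp je]; split.
- exact: inj_comp.
- by move=> v /=; rewrite jp ip.
- by move=> u v /ie[/je[uv cuv] cE]; rewrite /= cuv cE.
Qed.

Lemma extends_support (G H : sgraph) (Gt : embedding R S G) (Ht : embedding R S H) i (A : {set G}) :
  extends Gt Ht i -> support Gt A `<=` support Ht (i @: A)%SET.
Proof.
move=> [_ ip ie] x [[u uA ->]|[u [v [uA vA uv xuv]]]]; [left|right].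
  by exists (i u); [exact: imset_f|rewrite ip].
have [iuv cE] := ie u v uv.
by exists (i u), (i v); rewrite !imset_f // cE.
Qed.

Lemma add_points (G : sgraph) (Gt : embedding R S G) (s : seq S) : uniq s ->
  (forall x, x \in s -> ~ support Gt [set: G]%SET x) ->
  exists (H : sgraph) (Ht : embedding R S H) (i : G -> H), extends Gt Ht i /\
    forall x, x \in s -> exists v : H, point Ht v = x /\ forall u, i u <> v.
Proof.
move=> us sK; pose V := (G + seq_sub s)%type.
pose e : rel V := fun x y => match x, y with inl u, inl v => edge u v | _, _ => false end.
have es : symmetric e by move=> [x|x] [y|y] //=; exact: edge_sym.
have ei : irreflexive e by move=> [x|x] //=; exact: edge_irr.
have V0 : (0 < #|{: V}|)%N by rewrite card_sum addn_gt0 vertex_gt0.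
pose H := SGraph es ei V0.
pose pt (x : H) := match x with inl u => point Gt u | inr x => ssval x end.
pose cv (x y : H) := match x, y with inl u, inl v => curve Gt u v | _, _ => set0 end.
have nK u x : x \in s -> point Gt u <> x.
  by move=> /sK nx E; apply: nx; rewrite -E; left; exists u; rewrite ?inE.
have pinj : injective pt.
  move=> [u|x] [v|y] /=.
  - by move=> /point_inj ->.
  - by move=> /nK []; exact: ssvalP.
  - by move=> /esym /nK []; exact: ssvalP.
  - by move=> /val_inj ->.
have csym (x y : H) : edge x y -> cv x y = cv y x.
  by case: x y => [u|x] [v|y] //= uv; exact: (curve_sym Gt uv).
have carc (x y : H) : edge x y -> simple_arc R (pt x) (pt y) (cv x y).
  by case: x y => [u|x] [v|y] //= uv; exact: (curve_arc Gt uv).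
have cpt (x y z : H) : edge x y -> cv x y (pt z) -> z = x \/ z = y.
  case: x y z => [u|x] [v|y] [w|z] //= uv h.
    by have [->|->] := curve_point uv h; [left|right].
  exfalso; apply: (sK (ssval z)); first exact: ssvalP.
  by right; exists u, v; rewrite !inE.
have ccv (x y x' y' : H) : edge x y -> edge x' y' -> [set x; y]%SET != [set x'; y']%SET ->
    cv x y `&` cv x' y' `<=` range pt.
  case: x y => [u|x] [v|y] //= uv; case: x' y' => [u'|x'] [v'|y'] //= uv' ne z [z1 z2].
  have ne' : [set u; v]%SET != [set u'; v']%SET.
    apply: contraNneq ne => E; apply/eqP.
    have [[-> ->]|[-> ->]] := set2_eq (edge_neq uv') E; rewrite //; exact: finset.setUC.
  have [w _ wz] := @curve_curve _ _ _ Gt _ _ _ _ uv uv' ne' z (conj z1 z2).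
  by exists (inl w).
exists H, (@Embedding R S H pt cv pinj csym carc cpt ccv), inl; split.
  by split=> // u v [].
move=> x xs; exists (inr (SeqSub xs)); split=> // u.
Qed.

Lemma add_edge (G : sgraph) (Gt : embedding R S G) (u v : G) (C : set S) :
  u != v -> ~~ edge u v -> simple_arc R (point Gt u) (point Gt v) C ->
  C `&` support Gt [set: G]%SET `<=` [set point Gt u; point Gt v] ->
  exists (H : sgraph) (Ht : embedding R S H) (i : G -> H), [/\ extends Gt Ht i, bijective i &
    edge (i u) (i v)].
Proof.
move=> uv nuv aC CK.
pose new (x y : G) := (x == u) && (y == v) || (x == v) && (y == u).
have new_sym x y : new x y = new y x by rewrite /new orbC; congr orb; rewrite andbC.
pose e : rel G := fun x y => edge x y || new x y.
have es : symmetric e by move=> x y; rewrite /e edge_sym new_sym.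
have ei : irreflexive e.
  move=> x; rewrite /e edge_irr /new /=; apply/negP => /orP[]/andP[/eqP -> /eqP E];
    by rewrite E eqxx in uv.
pose H := SGraph es ei (vertex_gt0 G).
pose cv (x y : H) := if @edge G x y then curve Gt x y else C.
have newE x y : e x y -> ~~ @edge G x y -> (x = u /\ y = v) \/ (x = v /\ y = u).
  by rewrite /e => /orP[->//|] /orP[]/andP[/eqP -> /eqP ->]; [left|right].
have csym (x y : H) : edge x y -> cv x y = cv y x.
  rewrite /cv => xy; rewrite [in RHS]edge_sym; case: ifP => // xy'; exact: (curve_sym Gt xy').
have carc (x y : H) : edge x y -> simple_arc R (point Gt x) (point Gt y) (cv x y).
  rewrite /cv => xy; case: ifPn => xy'; first exact: (curve_arc Gt xy').
  by have [[-> ->]|[-> ->]] := newE x y xy xy' => //; exact: simple_arc_sym.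
have Cpt z : C (point Gt z) -> z = u \/ z = v.
  move=> Cz; have [|/point_inj ->|/point_inj ->] := CK (point Gt z); [|by left|by right].
  by split=> //; exact: point_support.
have cpt (x y z : H) : edge x y -> cv x y (point Gt z) -> z = x \/ z = y.
  rewrite /cv => xy; case: ifPn => xy'; first exact: (curve_point xy').
  by have [[-> ->]|[-> ->]] := newE x y xy xy' => /Cpt[]; auto.
have Ccv x y : @edge G x y -> C `&` curve Gt x y `<=` range (point Gt).
  move=> xy z [Cz zxy]; have [||] := CK z; last 2 first.
  - by move=> ->; exists u.
  - by move=> ->; exists v.
  - by split=> //; right; exists x, y; rewrite !inE.
have ccv (x y x' y' : H) : edge x y -> edge x' y' -> [set x; y]%SET != [set x'; y']%SET ->
    cv x y `&` cv x' y' `<=` range (point Gt).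
  rewrite /cv => xy xy' ne; case: ifPn => h; case: ifPn => h'.
  - exact: (curve_curve h h' ne).
  - by rewrite setIC; exact: Ccv.
  - exact: Ccv.
  - by move: ne; have [[-> ->]|[-> ->]] := newE x y xy h; have [[-> ->]|[-> ->]] := newE x' y' xy' h';
      rewrite ?eqxx // finset.setUC eqxx.
exists H, (@Embedding R S H (point Gt) cv (@point_inj _ _ _ Gt) csym carc cpt ccv), id; split.
- split=> // x y xy; split; first by rewrite /edge /= /e xy.
  by rewrite /= /cv xy.
- by exists id.
- by rewrite /edge /= /e /new !eqxx orbT.
Qed.

(** Induction on the number of nonadjacent ordered pairs, which every added edge lowers while the
    vertices stay the same. *)
Lemma edge_maximal_extension (G : sgraph) (Gt : embedding R S G) :
  exists (H : sgraph) (Ht : embedding R S H) (i : G -> H),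
    [/\ extends Gt Ht i, bijective i & edge_maximal Ht].
Proof.
pose non (L : sgraph) := #|[set e : L * L | ~~ edge e.1 e.2]%SET|.
suff : forall n (L : sgraph) (Lt : embedding R S L), (non L <= n)%N ->
    exists (H : sgraph) (Ht : embedding R S H) (i : L -> H),
    [/\ extends Lt Ht i, bijective i & edge_maximal Ht].
  by move=> /(_ (non G) G Gt (leqnn _)).
elim=> [|n IH] L Lt nL.
  exists L, Lt, id; split; [by split|by exists id|move=> u v uv nuv _].
  move: nL; rewrite leqn0 cards_eq0 => /eqP/setP/(_ (u, v)).
  by rewrite !inE nuv.
have [em|/existsNP[u /existsNP[v /not_implyP[uv /not_implyP[nuv /contrapT[C [aC CK]]]]]]] :=
  pselect (edge_maximal Lt).
  by exists L, Lt, id; split; [split|exists id|].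
have [L' [Lt' [i [ext [j ij ji] iuv]]]] := add_edge uv nuv aC CK.
have nL' : (non L' <= n)%N.
  rewrite -ltnS; apply: leq_trans nL.
  pose jj (e : L' * L') := (j e.1, j e.2).
  have jj_inj : injective jj.
    by apply: (can_inj (g := fun e => (i e.1, i e.2))) => -[x y]; rewrite /= !ji.
  rewrite /non -[X in (X < _)%N](card_imset _ jj_inj).
  apply: proper_card; apply/properP; split.
    apply/fintype.subsetP => _ /imsetP[[x y] /[!inE] /= nxy ->] /=; apply: contra nxy => jxy.
    by have [_ _ /(_ _ _ jxy)[]] := ext; rewrite !ji.
  exists (u, v); first by rewrite inE.
  apply/negP => /imsetP[[x y] /[!inE] /= nxy [ux vy]].
  by move: nxy; rewrite -(ji x) -(ji y) -ux -vy iuv.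
have [H [Ht [k [ext' bk em]]]] := IH L' Lt' nL'.
exists H, Ht, (k \o i); split=> //; first exact: extends_comp ext ext'.
by apply: bij_comp => //; exists j.
Qed.

End Extension.

(** * Robust connectivity and surface connectivity *)

Section Main.
Variables (R : realType) (S : topologicalType).
Hypothesis surf : surface R S.

Let hS : hausdorff_space S. Proof. by case: surf. Qed.
Let kS : compact [set: S]. Proof. by case: surf. Qed.
Let lS : locally_planar R S. Proof. by case: surf. Qed.

(** Both parts of a disconnection are open and nonempty, and the drawing is nowhere dense, so the
    two points can be chosen off the whole drawing; only then can they become new vertices. *)
Lemma separated_points (G : sgraph) (Gt : embedding R S G) (A : {set G}) :
  ~ nonseparating Gt A -> exists p q, [/\ ~ support Gt [set: G]%SET p,
    ~ support Gt [set: G]%SET q & ~ arcc R (~` support Gt A) p q].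
Proof.
move=> nsA; set W := ~` support Gt A.
have oW : open W by apply: closed_openC; have [] := support_nowhere_dense hS kS lS Gt A.
have ndK := support_nowhere_dense hS kS lS Gt [set: G]%SET.
have /existsNP[B /not_implyP[B0 /not_implyP[BOpen /not_implyP[BClosed BW]]]] : ~ connected W by [].
have [b Bb] := B0; have [U oU BU] := BOpen; have [F cF BF] := BClosed.
have [p Bp nKp] : exists2 p, B p & ~ support Gt [set: G]%SET p.
  by apply: ndK.2; [rewrite BU; exact: openI|exists b].
have [q [Wq nFq] nKq] : exists2 q, (W `&` ~` F) q & ~ support Gt [set: G]%SET q.
  apply: ndK.2; first by apply: openI => //; exact: closed_openC.
  apply: contrapT => n; apply: BW; rewrite BF; apply/seteqP; split=> x; first by case.
  by move=> Wx; split=> //; apply: contrapT => nF; apply: n; exists x.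
exists p, q; split=> // pq.
have Wp : W p by move: Bp; rewrite BU => -[].
have [C cC [Cp Cq CW]] := arcc_connected Wp pq.
have : B q.
  apply: (connected_locconst cC _ Cp Cq Bp) => x Cx; have Wx := CW x Cx.
  have [Bx|nBx] := pselect (B x).
    have Ux : U x by move: Bx; rewrite BU => -[].
    apply: filterS (open_nbhs_nbhs (conj oU Ux)) => y Uy Cy; split=> // _.
    by rewrite BU; split=> //; exact: CW.
  have nFx : ~ F x by move=> Fx; apply: nBx; rewrite BF.
  apply: filterS (near_not cF nFx) => y nFy Cy; split=> //.
  by rewrite BF => -[].
by rewrite BF => -[].
Qed.

Lemma curve_avoids (G : sgraph) (Gt : embedding R S G) (A : {set G}) x y :
  x \notin A -> y \notin A -> edge x y -> curve Gt x y `<=` ~` support Gt A.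
Proof.
move=> xA yA xy z zxy [[w wA zw]|[u [v [uA vA uv zuv]]]].
  rewrite zw in zxy; have [wE|wE] := curve_point xy zxy; rewrite wE in wA.
    by rewrite wA in xA.
  by rewrite wA in yA.
have [/eqP E|ne] := boolP ([set x; y]%SET == [set u; v]%SET).
  by have [[xu _]|[xv _]] := set2_eq (edge_neq uv) E; [rewrite xu uA in xA|rewrite xv vA in xA].
have [w _ wz] := @curve_curve _ _ _ Gt _ _ _ _ xy uv ne z (conj zxy zuv).
rewrite -wz in zxy zuv; have wA : w \in A by have [->|->] := curve_point uv zuv.
by have [wE|wE] := curve_point xy zxy; [rewrite -wE wA in xA|rewrite -wE wA in yA].
Qed.

Lemma max_nonseparating_ge (G : sgraph) (Gt : embedding R S G) (A : {set G}) :
  nonseparating Gt A -> (#|A| <= max_nonseparating Gt)%N.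
Proof. by move=> nsA; apply: (bigop.bigmax_sup A) => //; exact/asboolP. Qed.

(** The empty set is nonseparating because the surface is connected, so the maximum is over a
    nonempty family and is attained. *)
Lemma nonseparating_witness (G : sgraph) (Gt : embedding R S G) :
  exists2 A : {set G}, nonseparating Gt A & #|A| = max_nonseparating Gt.
Proof.
have ns0 : nonseparating Gt finset.set0.
  rewrite /nonseparating (_ : support Gt finset.set0 = set0).
    by rewrite setC0; case: surf.
  by apply/seteqP; split=> // x [[u]|[u [v []]]]; rewrite inE.
have [|A /asboolP nsA AE] := @eq_bigmax_cond _ [pred A : {set G} | `[< nonseparating Gt A >]] (fun A => #|A|).
  by apply/card_gt0P; exists finset.set0; exact/asboolP.
by exists A => //; rewrite -AE.
Qed.

Lemma surface_connectivity_le (G : sgraph) (Gt : embedding R S G) :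
  surface_connectivity R S <= (max_nonseparating Gt)%:R / #|G|%:R.
Proof.
apply: ge_inf; last by exists G, Gt.
by exists 0 => _ [H [Ht ->]]; rewrite divr_ge0.
Qed.

Lemma max_nonseparating_of_robust (k : R) (G : sgraph) (Gt : embedding R S G) :
  (forall H : sgraph, (exists Ht : embedding R S H, edge_maximal Ht) ->
     k <= robust_connectivity R H) ->
  k <= (max_nonseparating Gt)%:R / #|G|%:R.
Proof.
(* Positivity of [k] later excludes the default value 0 of the maximum, so that an actual spanning
   tree is obtained. *)
move=> robust; have [k0|k0] := leP k 0; first by rewrite (le_trans k0) // divr_ge0.
have /choice[f fP] : forall A : {set G}, exists pq : S * S, ~ nonseparating Gt A ->
    [/\ ~ support Gt [set: G]%SET pq.1, ~ support Gt [set: G]%SET pq.2 &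
        ~ arcc R (~` support Gt A) pq.1 pq.2].
  move=> A; have [ns|/separated_points[p [q pq]]] := pselect (nonseparating Gt A).
    have [[x _] _ _ _ _] := surf; by exists (x, x).
  by exists (p, q).
pose s := undup (flatten [seq [:: (f A).1; (f A).2] | A <- enum [pred A : {set G} | ~~ `[< nonseparating Gt A >]]]).
have sP A : ~ nonseparating Gt A -> (f A).1 \in s /\ (f A).2 \in s.
  move=> ns; split; rewrite mem_undup; apply/flattenP; exists [:: (f A).1; (f A).2];
    rewrite ?inE ?eqxx ?orbT //; apply/mapP; exists A => //; rewrite mem_enum inE; exact/asboolPn.
have sK x : x \in s -> ~ support Gt [set: G]%SET x.
  rewrite mem_undup => /flattenP[_ /mapP[A + ->]]; rewrite mem_enum inE => /asboolPn /fP[h1 h2 _].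
  by rewrite !inE => /orP[]/eqP ->.
have [H0 [Ht0 [i0 [ext0 new]]]] := add_points (undup_uniq _) sK.
have [H [Ht [i1 [ext1 [j1 ij1 ji1] em]]]] := edge_maximal_extension Ht0.
pose i := i1 \o i0; have ext : extends Gt Ht i by exact: extends_comp ext0 ext1.
have [ii ip ie] := ext.
have := robust H (ex_intro _ Ht em); rewrite /robust_connectivity => /bigmin_geP[_].
(* The test set consists of the original vertices only: the added ones shape the tree but do not
   enter the ratio. *)
pose A1 := (i @: [set: G])%SET.
have A1E : #|A1| = #|G| by rewrite card_imset // cardsT.
have A10 : A1 != finset.set0 by rewrite -card_gt0 A1E vertex_gt0.
move=> /(_ _ A10) /bigmax_geP[|[T /asboolP tT]]; first by rewrite leNgt k0.
pose A := [set v | i v \in leaves T]%SET.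
have AE : (A1 :&: leaves T = i @: A)%SET.
  apply/setP => v; rewrite inE; apply/andP/imsetP.
    by move=> [/imsetP[w _ ->] wl]; exists w => //; rewrite inE.
  by move=> [w + ->]; rewrite finset.in_set => wl; split=> //; exact: imset_f.
rewrite AE card_imset // A1E => kA.
suff nsA : nonseparating Gt A.
  by rewrite (le_trans kA) // ler_pM2r ?invr_gt0 ?ltr0n ?vertex_gt0 // ler_nat max_nonseparating_ge.
apply: contrapT => /[dup] /sP[ps qs] /fP[_ _]; apply.
have newA x : x \in s -> exists2 v : H, point Ht v = x & v \notin (i @: A)%SET.
  move=> /new[v [vx nv]]; have [_ ip1 _] := ext1; exists (i1 v); first by rewrite ip1.
  apply/negP => /imsetP[w _ /(can_inj ij1) vw]; exact: (nv w).
have [p pE pA] := newA _ ps; have [q qE qA] := newA _ qs; rewrite -pE -qE.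
have AL : (i @: A)%SET \subset leaves T.
  by apply/fintype.subsetP => _ /imsetP[w + ->]; rewrite finset.in_set.
have [TE _ _] := tT.
have /connectP[c + ->] := tree_path_avoiding tT AL pA qA.
elim: c p {pE pA} => [|y c IH] p /=; first by move=> _; exact: arcc_refl.
move=> /andP[/and3P[pA yA /(adj_edge TE) py] /IH yq].
apply: (arcc_trans hS) _ yq; right; exists (curve Ht p y); first exact: (curve_arc Ht py).
by move=> z /(curve_avoids pA yA py) nz /(extends_support ext).
Qed.

Lemma surface_connectivity_le_two_thirds : surface_connectivity R S <= 2%:R / 3%:R.
Proof.
have [[x _] _ _ _ _] := surf.
have [Gt m2] := triangle_embedding hS lS x.
apply: le_trans (surface_connectivity_le Gt) _.
by rewrite card_ord ler_pM2r ?invr_gt0 ?ltr0n // ler_nat.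
Qed.

Lemma robust_of_surface_connectivity (k : R) (G : sgraph) (Gt : embedding R S G) :
  edge_maximal Gt -> k <= surface_connectivity R S -> k <= robust_connectivity R G.
Proof.
move=> em kS'; have k23 := le_trans kS' surface_connectivity_le_two_thirds.
(* The default value 1 of the minimum must also be at least [k], which the bound 2/3 ensures. *)
apply/bigmin_geP; split; first by apply: le_trans k23 _; rewrite ler_pdivrMr ?mul1r ?ler_nat ?ltr0n.
move=> B B0; apply/bigmax_geP; right.
suff [T tT kT] : exists2 T, spanning_tree T & k * #|B|%:R <= #|B :&: leaves T|%:R.
  by exists T; [exact/asboolP|rewrite ler_pdivlMr ?ltr0n ?card_gt0].
have [H [Ht [i [ii iB cH sup]]]] := induced_embedding Gt B0.
have [A' nsA' A'E] := nonseparating_witness Ht.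
pose A := (i @: A')%SET.
have nsA : nonseparating Gt A by move: nsA'; rewrite /nonseparating sup.
have AB : A \subset B by apply/fintype.subsetP => _ /imsetP[x _ ->].
have kA : k * #|B|%:R <= #|A|%:R.
  have := le_trans kS' (surface_connectivity_le Ht).
  by rewrite -A'E cH ler_pdivlMr ?ltr0n ?card_gt0 // card_imset.
have [[b bA]|nb] := pselect (exists b, b \notin A).
  have [T tT AT] := spanning_tree_leaves (nonseparating_connected hS kS lS em nsA)
    (fun a aA => nonseparating_dominated hS kS lS em nsA aA bA).
  exists T => //; apply: le_trans kA _; rewrite ler_nat; apply: subset_leq_card.
  by rewrite finset.subsetI AB.
have AT : A = [set: G]%SET.
  by apply/setP => v; rewrite !inE; apply: contrapT => /negP vA; apply: nb; exists v.
have BT : B = [set: G]%SET by apply/eqP; rewrite finset.eqEsubset finset.subsetT -AT.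
rewrite AT in nsA; have complete := complete_of_nonseparating hS kS lS em nsA.
have /card_gt0P[a0 _] := vertex_gt0 G.
pose A2 := (~: [set a0])%SET.
have A2P v : v \notin A2 -> v = a0 by rewrite !inE negbK => /eqP.
have [T tT AT2] : exists2 T : {set {set G}}, spanning_tree T & A2 \subset leaves T.
  apply: spanning_tree_leaves => [u v /A2P -> /A2P ->|a]; first exact: connect0.
  by rewrite !inE => aa0; exists a0; rewrite ?inE ?eqxx //; exact: complete.
exists T => //; rewrite BT finset.setTI cardsT.
have cA2 : #|A2| = #|G|.-1 by rewrite cardsC1.
have G0 : (0 < #|G|)%N by exact: vertex_gt0.
(* On at most two vertices all degrees are at most 1, so every vertex is a leaf. From [n = 3] on,
   [n - 1] leaves suffice, since [n - 1] is then at least two thirds of [n]. *)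
have [G2|G3] := leqP #|G| 2.
  have -> : leaves T = [set: G]%SET.
    apply/setP => v; rewrite !inE; apply: leq_trans (_ : #|~: [set v]|%SET <= _)%N.
      apply: subset_leq_card; apply/fintype.subsetP => u; rewrite !inE => uv.
      by have [TE _ _] := tT; exact: adj_neq TE uv.
    by rewrite cardsC1; lia.
  by rewrite cardsT; have : 0 <= #|G|%:R :> R by []; nra.
have : (#|G|.-1 <= #|leaves T|)%N by rewrite -cA2; exact: subset_leq_card.
rewrite -(ler_nat R) => h; apply: le_trans h.
have -> : #|G|.-1%:R = #|G|%:R - 1 :> R by rewrite -subn1 natrB.
have : 3%:R <= #|G|%:R :> R by rewrite ler_nat.
move: (#|G|%:R) => n n3; nra.
Qed.

End Main.

Theorem theorem5 (R : realType) (S : topologicalType) (hS : surface R S) (k : R) :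
  (forall G : sgraph,
     (exists Gt : embedding R S G, edge_maximal Gt) ->
     k <= robust_connectivity R G) <->
  k <= surface_connectivity R S.
Proof.
split=> [robust|kS G [Gt em]]; last exact: robust_of_surface_connectivity em kS.
apply: lb_le_inf; last by move=> _ [G [Gt ->]]; exact: max_nonseparating_of_robust.
(* The infimum bounds from below only over a nonempty set; the triangle provides an embedded
   graph. *)
have [[x _] hausS _ _ lS] := hS; have [Gt _] := triangle_embedding hausS lS x.
by exists ((max_nonseparating Gt)%:R / #|K3|%:R); exists K3, Gt.
Qed.
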